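(* Let $\ell\geq 1$ and let $\lambda,\mu,\nu$ be regular irreducible representations of $\mathrm G(\mathfrak o_\ell)$, and let $g_{\lambda\mu}^{\nu}$ denote the multiplicity of $\nu$ in $\lambda\otimes\mu$. (1) If $\mathbf{cus}\in\{\mathrm{tt}(\lambda),\mathrm{tt}(\mu),\mathrm{tt}(\nu)\}$, then $g_{\lambda\mu}^{\nu}\leq 1$. (2) If the set $\{\mathrm{tt}(\lambda),\mathrm{tt}(\mu),\mathrm{tt}(\nu)\}$ consists of exactly two types, then $g_{\lambda\mu}^{\nu}\leq 2$, with equality occurring only when the triple $(\mathrm{tt}(\lambda),\mathrm{tt}(\mu),\mathrm{tt}(\nu))$ is a permutation of $(\mathbf{ss},\mathbf{sns},\mathbf{ss})$. (3) If $\{\mathrm{tt}(\lambda),\mathrm{tt}(\mu),\mathrm{tt}(\nu)\}=\{\mathbf{ss}\}$, then $g_{\lambda\mu}^{\nu}\leq \ell+1$.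
   Context: Let $\mathcal O$ be a complete discrete valuation ring with maximal ideal $\mathfrak p=\pi\mathcal O$ and finite residue field of odd characteristic and cardinality $q$. Let $\mathfrak O=\mathcal O[\vartheta]$ be the unramified quadratic extension, with $\vartheta^2\in\mathcal O^\times$ a non-square, and Galois involution $x\mapsto x^\circ$, $\vartheta^\circ=-\vartheta$. For $\ell\geq1$ let $\mathfrak o_\ell=\mathcal O/\mathfrak p^\ell$ and $\mathfrak O_\ell=\mathfrak O/\pi^\ell\mathfrak O$. $\mathrm G$ denotes either $\mathrm{GL}_2$ (so $\mathrm G(\mathfrak o_\ell)=\mathrm{GL}_2(\mathfrak o_\ell)$, $R_\ell=\mathfrak o_\ell$, $\epsilon=1$, $\mathfrak g(\mathfrak o_\ell)=M_2(\mathfrak o_\ell)$) or $\mathrm{GU}_2$ (so $\mathrm G(\mathfrak o_\ell)=\{A\in \mathrm{GL}_2(\mathfrak O_\ell): A^\star A=I\}$ where $(a_{ij})^\star=W(a_{ji}^\circ)W^{-1}$, $W=\begin{pmatrix}0&1\\1&0\end{pmatrix}$, $R_\ell=\mathfrak O_\ell$, $\epsilon=\vartheta$, $\mathfrak g(\mathfrak o_\ell)=\{A\in M_2(\mathfrak O_\ell):A+A^\star=0\}$). Fix an additive character $\psi$ of $R_\ell$ nontrivial on $\pi^{\ell-1}\mathfrak o_\ell$ (for $\mathrm{GU}_2$ with $\psi(x+\vartheta y)=\psi'(x)\psi'(y)$ for such a character $\psi'$ of $\mathfrak o_\ell$). For $\ell\ge2$ let $K^{\ell-1}=\{I+\pi^{\ell-1}B\}\cap\mathrm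 G(\mathfrak o_\ell)$ and for $A\in\mathfrak g(\mathfrak o_1)$ let $\psi_A(I+\pi^{\ell-1}B)=\psi(\pi^{\ell-1}\mathrm{tr}(\tilde AB))$ with $\tilde A$ a lift of $A$. For $\ell\geq 2$, an irreducible representation $\rho$ of $\mathrm G(\mathfrak o_\ell)$ is regular if every character $\psi_A$ occurring in $\rho|_{K^{\ell-1}}$ has $A$ non-scalar; its type $\mathrm{tt}(\rho)$ is $\mathbf{cus}$, $\mathbf{ss}$, $\mathbf{sns}$ according as $\dim\rho=(q-1)q^{\ell-1}$, $(q+1)q^{\ell-1}$, $(q^2-1)q^{\ell-2}$. For $\ell=1$, the regular representations are all non-linear irreducible representations of $\mathrm G(\mathfrak o_1)$, of type $\mathbf{cus}$, $\mathbf{ss}$, $\mathbf{sns}$ according as the dimension is $q-1$, $q+1$, $q$. *)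

(* Defs.v *)
From HB Require Import structures.
From mathcomp Require Import all_boot all_order all_algebra all_fingroup all_solvable all_field all_character.
Set Implicit Arguments.
Unset Strict Implicit.
Unset Printing Implicit Defensive.
Import GRing.Theory Num.Theory.
Local Open Scope ring_scope.

Definition is_cdvr (O : idomainType) (pi : O) : Prop :=
  [/\ pi != 0, pi \notin GRing.unit,
      (forall x : O, x != 0 ->
         exists n : nat, exists2 u : O, u \is a GRing.unit & x = u * pi ^+ n)
    &
      (forall a : nat -> O,
         (forall n, exists y, a n.+1 - a n = pi ^+ n * y) ->
         exists b : O, forall n, exists y, b - a n = pi ^+ n * y)].

Definition is_add_char (R : nzRingType) (psi : R -> algC) : Prop :=
  psi 0 = 1 /\ forall x y, psi (x + y) = psi x * psi y.

Inductive ttype := cus | ss | sns.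

Definition type_dim (q l : nat) (t : ttype) : nat :=
  if (l <= 1)%N then
    match t with cus => (q - 1)%N | ss => q.+1 | sns => q end
  else
    match t with
    | cus => ((q - 1) * q ^ (l - 1))%N
    | ss => (q.+1 * q ^ (l - 1))%N
    | sns => ((q ^ 2 - 1) * q ^ (l - 2))%N
    end.

Definition has_type (gT : finGroupType) (G : {group gT}) (q l : nat)
  (i : Iirr G) (t : ttype) : Prop :=
  'chi_i 1%g = (type_dim q l t)%:R.

Definition tensor_mult (gT : finGroupType) (G : {group gT})
  (i j k : Iirr G) : algC :=
  '['chi_i * 'chi_j, 'chi_k].

Definition exactly_two_types (a b c : ttype) : Prop :=
  ~ (a = b /\ b = c) /\ (a = b \/ b = c \/ a = c).

Definition perm_ss_sns_ss (a b c : ttype) : Prop :=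
  (a, b, c) = (ss, sns, ss) \/ (a, b, c) = (ss, ss, sns) \/
  (a, b, c) = (sns, ss, ss).

Definition tensor_claims (gT : finGroupType) (G : {group gT})
  (reg : Iirr G -> Prop) (q l : nat) : Prop :=
  forall i j k : Iirr G, reg i -> reg j -> reg k ->
  forall a b c : ttype,
    has_type q l i a -> has_type q l j b -> has_type q l k c ->
  [/\ (a = cus \/ b = cus \/ c = cus) -> tensor_mult i j k <= 1,
      exactly_two_types a b c ->
        tensor_mult i j k <= 2 /\
        (tensor_mult i j k = 2 -> perm_ss_sns_ss a b c)
    & (a = ss /\ b = ss /\ c = ss) -> tensor_mult i j k <= (l + 1)%:R].

Section Regular.
Variables (Rl : finComUnitRingType) (G : {group {'GL_2[Rl]}}).
Variables (lie : pred 'M[Rl]_2) (psi : Rl -> algC) (pil : Rl) (l : nat).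

Definition Kcong : {set {'GL_2[Rl]}} :=
  [set g in G | [exists B : 'M[Rl]_2, GLval g == 1%:M + pil ^+ l.-1 *: B]].

(* psi_A (I + pi^{l-1} B) = psi (pi^{l-1} tr (A B)) = psi (tr (A (g - I))) *)
Definition psiA (A : 'M[Rl]_2) (g : {'GL_2[Rl]}) : algC :=
  psi (\tr (A *m (GLval g - 1%:M))).

Definition occurs_in (A : 'M[Rl]_2) (i : Iirr G) : Prop :=
  \sum_(g in Kcong) 'chi_i g * (psiA A g)^* != 0.

Definition scalar_mod_pi (A : 'M[Rl]_2) : Prop :=
  exists c : Rl, exists X : 'M[Rl]_2, A = c%:M + pil *: X.

Definition regular_rep (i : Iirr G) : Prop :=
  if (l <= 1)%N then is_true ('chi_i 1%g != 1)
  else forall A : 'M[Rl]_2, lie A -> occurs_in A i -> ~ scalar_mod_pi A.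

End Regular.

Section Unitary.
Variables (S : finComUnitRingType) (cj : {rmorphism S -> S}).

Definition Wmx : 'M[S]_2 := \matrix_(i < 2, j < 2) (i != j)%:R.

(* A^star = W (A^circ)^T W^{-1}, with W^{-1} = W *)
Definition star (A : 'M[S]_2) : 'M[S]_2 := Wmx *m (map_mx cj A)^T *m Wmx.

Lemma Wmx2 : Wmx *m Wmx = 1%:M.
Proof.
apply/matrixP=> i j; rewrite !mxE !big_ord_recl big_ord0 !mxE.
case: i => [[|[|//]] ?]; case: j => [[|[|//]] ?] /=;
  by rewrite ?mul0r ?mul1r ?mulr0 ?mulr1 ?addr0 ?add0r.
Qed.

Lemma starM A B : star (A *m B) = star B *m star A.
Proof.
rewrite /star map_mxM trmx_mul !mulmxA; congr (_ *m _).
by rewrite -[in RHS](mulmxA _ Wmx Wmx) Wmx2 mulmx1.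
Qed.

Lemma star1 : star 1%:M = 1%:M.
Proof. by rewrite /star map_mx1 trmx1 mulmx1 Wmx2. Qed.

Definition GU_set : {set {'GL_2[S]}} :=
  [set g : {'GL_2[S]} | star (GLval g) *m GLval g == 1%:M].

Lemma GU_group_set : group_set GU_set.
Proof.
apply/group_setP; split; first by rewrite inE GL_1E star1 mulmx1.
move=> x y; rewrite !inE GL_MxE starM => /eqP hx /eqP hy.
by rewrite mulmxA -(mulmxA _ _ (GLval x)) hx mulmx1 hy.
Qed.

Canonical GU_group := Group GU_group_set.

Definition lieU : pred 'M[S]_2 := fun A => A + star A == 0.

End Unitary.

Arguments regular_rep {Rl} G lie psi pil l i.
Arguments tensor_claims {gT} G reg q l.

(* Main.v *)
Require Import Defs.
From HB Require Import structures.
From mathcomp Require Import all_boot all_order all_algebra all_fingroup all_solvable all_field all_character.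
From mathcomp Require Import ring zify.
Set Implicit Arguments.
Unset Strict Implicit.
Unset Printing Implicit Defensive.
Import Order.TTheory GRing.Theory Num.Theory.
Local Open Scope ring_scope.

(** Let [p] generate the maximal ideal of [R = o_l], and let [Y] be the group of
    upper unipotent elements of [GL_2(R)] whose off-diagonal entry is killed by
    [p]; a regular character of [GL_2(R)] is not trivial on [Y].

    If [chi] has no nonzero [Y]-fixed vector, which Fourier analysis on the upper
    unipotent group [U] forces for the cuspidal degree, then every multiplicity
    involving [chi] is at most [1]: transposition makes the diagonal of [GL_2(R)^3]
    behave like the small subgroup of a Gelfand pair on the constituents
    containing [chi].

    Otherwise a character of type [ss] is induced from a linear character [b] of
    the Borel subgroup [B], so that [<chi mu nu, 1> = <b mu nu, 1>_B].  Let [chi0]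
    be the [Y]-fixed part of [chi], a character of the Iwahori subgroup [I].  The
    complements of [mu0] and [nu0] contain a generic character of [U] exactly once,
    and contribute at most [1].  The group [D] of diagonal matrices [(1/n, n)] with
    [n = 1] modulo the annihilator of [p] is trivial on [chi0] in type [sns],
    whereas in type [ss] one has [chi0 = Ind_B^I b + Ind_B^I b^w] with different
    actions of the diagonal torus, so that at most one summand pairs with [b].
    That term is bounded on the lower triangular subgroup [Q] of [I], by counting
    characters of its unipotent radical [V]: each constituent contains one of the
    [l] characters [x |-> psi (p^j x)].

    For [GU_2], the group [S^* GU_2] is equal to [S^* G1] inside [GL_2(S)], where
    [G1] is the conjugate of [GL_2(R)] by [diag(1, vt)]; this is Hilbert 90 and
    the surjectivity of the norm.  Restriction from this central product preserves
    irreducibility and multiplicities. *)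

(** * Characters of finite groups *)

(** Of the type, only the degree enters. The complement of [chi0] has dimension a positive multiple
    of [(q-1)q^(l-1)], the number of generic characters of [U]. It is smaller than twice this number
    as soon as [chi0] is nonzero, so the degree fixes [chi0(1)]: [0] for cus, [(q-1)q^(l-2)] for sns
    ([1] when [l = 1]), and [2q^(l-1)] or [0] for ss. The last alternative is why the multiplicity
    one argument is stated for every character without [Y]-fixed vectors. The obstacle in that
    argument is that a matrix is conjugate to its transpose while a pair of matrices need not be so
    simultaneously; the vanishing of sums over conjugates of [Y] disposes of the exceptional pairs.
    Origin of the constants: the generic parts give [1]. To this the fixed parts add nothing for
    (ss, sns, sns), at most [1] for (ss, ss, sns), where the sns factor carries a single weight of
    [V], and at most [l] for three ss, where the induced characters are regular on [V] and meet each
    of the [l] weights once. *)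

Lemma linear_char_exists (gT : finGroupType) (G : {group gT}) (f : gT -> algC) :
  f 1%g = 1 -> {in G &, {morph f : x y / (x * y)%g >-> x * y}} ->
  exists2 xi : 'CF(G), xi \is a linear_char & {in G, xi =1 f}.
Proof.
move=> f1 fM.
have rP : mx_repr G (fun x => (f x)%:M : 'M[algC]_1).
  by split=> [|x y Gx Gy]; rewrite ?f1 // fM // scalar_mxM.
exists (cfRepr (MxRepresentation rP)).
  by rewrite qualifE/= cfRepr_char cfRepr1 eqxx.
by move=> x Gx; rewrite cfunE Gx mulr1n /= mxtrace_scalar mulr1n.
Qed.

Lemma sum_mulchar (gT : finGroupType) (G : {group gT}) (f : gT -> algC) :
  f 1%g = 1 -> {in G &, {morph f : x y / (x * y)%g >-> x * y}} ->
  {in G, forall x, f x = 1} \/ \sum_(x in G) f x = 0.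
Proof.
move=> f1 fM; case: (pickP [pred x in G | f x != 1]) => [y /andP[/= Gy fy]|h].
  right; apply/eqP; rewrite -(mulrI_eq0 _ (GRing.lregP _ : GRing.lreg (f y - 1)));
    last by rewrite subr_eq0.
  rewrite mulrBl mul1r mulr_sumr subr_eq0; apply/eqP.
  rewrite [RHS](reindex_inj (mulgI y)) /=.
  by apply: eq_big => x; rewrite ?groupMl // => Gx; rewrite fM.
by left=> x Gx; apply/eqP; move: (h x); rewrite /= Gx /= => /negbFE.
Qed.

Lemma sum_mulchar_ge0 (gT : finGroupType) (G : {group gT}) (f : gT -> algC) :
  f 1%g = 1 -> {in G &, {morph f : x y / (x * y)%g >-> x * y}} ->
  0 <= \sum_(x in G) f x.
Proof.
move=> f1 fM; case: (sum_mulchar f1 fM) => [f_1|->//].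
by apply: sumr_ge0 => x Gx; rewrite f_1.
Qed.

(** Mackey's formula without double cosets: each [y] in [L] contributes the sum of a multiplicative
    function over the intersection of [K] with a conjugate of [H], which is nonnegative, and the
    contribution of [x] is positive because the two characters agree there. *)
Lemma cfdot_Ind_lin_neq0 (gT : finGroupType) (L H K : {group gT})
    (phi : 'CF(H)) (theta : 'CF(K)) (x : gT) :
  H \subset L -> K \subset L -> x \in L ->
  phi \is a linear_char -> theta \is a linear_char ->
  (forall g, g \in K -> (g ^ x)%g \in H -> phi (g ^ x)%g = theta g) ->
  '['Ind[L] phi, 'Ind[L] theta] != 0.
Proof.
move=> sHL sKL Lx lphi lth eqx.
have S y : y \in L -> \sum_(g in K) phi (g ^ y)%g * (theta g)^* =
    \sum_(g in (K :&: H :^ y^-1)%G) phi (g ^ y)%g * (theta g)^*.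
  move=> Ly; rewrite [LHS](bigID [pred g | (g ^ y)%g \in H]) /= addrC big1 ?add0r.
    by apply: eq_bigl => g; rewrite !inE mem_conjgV.
  by move=> g /andP[_ nH]; rewrite cfun0 ?mul0r.
have SM y : {in (K :&: H :^ y^-1)%G &,
  {morph (fun g => phi (g ^ y)%g * (theta g)^*) : a b / (a * b)%g >-> a * b}}.
  move=> a c /=; rewrite !inE !mem_conjgV => /andP[Ka Ha] /andP[Kc Hc].
  by rewrite conjMg (lin_charM lphi) // (lin_charM lth) // rmorphM mulrACA.
have S1 y : phi (1 ^ y)%g * (theta 1%g)^* = 1.
  by rewrite conj1g (lin_char1 lphi) (lin_char1 lth) rmorph1 mulr1.
rewrite -cfdot_Res_l cfdotE mulf_neq0 ?invr_eq0 ?pnatr_eq0 -?lt0n ?cardG_gt0 //.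
under eq_bigr => g Kg do rewrite cfResE // cfIndE // -mulrA mulr_suml.
rewrite -mulr_sumr mulf_neq0 ?invr_eq0 ?pnatr_eq0 -?lt0n ?cardG_gt0 //.
rewrite exchange_big (bigD1 x) //= gt_eqF // ltr_wpDr //.
  apply: sumr_ge0 => y /andP[Ly _]; rewrite S //.
  exact: (sum_mulchar_ge0 (S1 y) (SM y)).
rewrite S // (eq_bigr (fun=> 1)) => [|g].
  by rewrite sumr_const ltr0n cardG_gt0.
rewrite !inE mem_conjgV => /andP[Kg Hg].
by rewrite eqx // -lin_charV_conj // -lin_charM ?groupV // mulgV lin_char1.
Qed.

Lemma mx_abs_irr_irr (gT : finGroupType) (G : {group gT}) (i : Iirr G) :
  mx_absolutely_irreducible 'Chi_i.
Proof. by apply: groupC; apply: socle_irr. Qed.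

(** By Schur the sum over the normal subgroup [Y] acts as a scalar. If this scalar is nonzero then
    [Y] fixes a vector, and normality puts [Y] in the kernel. *)
Lemma normal_sum_irr (gT : finGroupType) (L Y : {group gT}) (c : Iirr L) x :
  (Y <| L)%g -> x \in L ->
  \sum_(y in Y) 'chi_c (y * x)%g =
    if Y \subset cfker 'chi_c then #|Y|%:R * 'chi_c x else 0.
Proof.
move=> nYL Lx; case/andP: (nYL) => sYL nY.
case: ifP => [kY|nkY].
  rewrite (eq_bigr (fun=> 'chi_c x)) ?sumr_const ?mulr_natl // => y Yy.
  by rewrite cfkerMl // (subsetP kY).
pose M := \sum_(y in Y) 'Chi_c y.
have cM : centgmx 'Chi_c M.
  apply/centgmxP=> g Lg; rewrite mulmx_suml mulmx_sumr.
  rewrite [RHS](reindex_inj (conjg_inj g)) /=.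
  apply: eq_big => y; rewrite ?memJ_norm ?(subsetP nY) // => Yy.
  have Ly := subsetP sYL y Yy.
  by rewrite -!repr_mxM ?groupJ // -conjgC.
have /is_scalar_mxP[a Ma] := mx_abs_irr_cent_scalar (mx_abs_irr_irr c) cM.
have sumE z : z \in L -> \sum_(y in Y) 'chi_c (y * z)%g = a * 'chi_c z.
  move=> Lz; transitivity (\tr (M *m 'Chi_c z)).
    rewrite mulmx_suml raddf_sum; apply: eq_bigr => y Yy.
    have Ly := subsetP sYL y Yy.
    by rewrite -irrRepr cfunE groupM // mulr1n repr_mxM.
  by rewrite Ma mul_scalar_mx mxtraceZ -irrRepr cfunE Lz mulr1n.
rewrite sumE //.
suff /eqP : a * 'chi_c 1%g = 0.
  by rewrite mulf_eq0 (negPf (irr1_neq0 c)) orbF => /eqP->; rewrite mul0r.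
rewrite -sumE //; apply: contraFeq nkY => nz; apply: (constt0_Res_cfker nYL).
rewrite irr_consttE irr0 cfdotE mulf_neq0 ?invr_eq0 ?pnatr_eq0 -?lt0n ?cardG_gt0 //.
rewrite (eq_bigr (fun y => 'chi_c (y * 1)%g)) // => y Yy.
by rewrite cfResE // cfun1E Yy rmorph1 mulr1 mulg1.
Qed.

Section FixedPart.
Variables (gT : finGroupType) (L Y : {group gT}).
Hypothesis nYL : (Y <| L)%g.

(** The character of [L] on the [Y]-fixed vectors. Defined through constituents, so that it and its
    complement are visibly characters; [cffixE] is the averaging formula. *)
Definition cffix (chi : 'CF(L)) : 'CF(L) :=
  \sum_(c : Iirr L | Y \subset cfker 'chi_c) '[chi, 'chi_c] *: 'chi_c.

Lemma cffixE chi x : x \in L ->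
  cffix chi x = #|Y|%:R^-1 * \sum_(y in Y) chi (y * x)%g.
Proof.
move=> Lx; have sYL := normal_sub nYL; rewrite [chi in RHS]cfun_sum_cfdot.
under eq_bigr => y Yy do rewrite sum_cfunE.
rewrite exchange_big /= mulr_sumr /cffix sum_cfunE [LHS]big_mkcond /=.
apply: eq_bigr => c _.
under eq_bigr => y Yy do rewrite cfunE.
rewrite -mulr_sumr normal_sum_irr //; case: ifP => _; last by rewrite !mulr0.
by rewrite cfunE mulrCA mulKf // pnatr_eq0 -lt0n cardG_gt0.
Qed.

Lemma cffix_char chi : chi \is a character -> cffix chi \is a character.
Proof.
move=> Nchi; apply: rpred_sum => c _.
have /natrP[n ->] := Cnat_cfdot_char_irr c Nchi.
by rewrite scaler_nat rpredMn ?irr_char.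
Qed.

Lemma cffix_ker chi : Y \subset cfker (cffix chi).
Proof.
rewrite /cffix; apply: subset_trans (cfker_sum _ _ _); rewrite subsetI normal_sub //.
apply/bigcapsP=> c kc.
exact: subset_trans kc (cfker_scale _ _).
Qed.

Lemma cffixC_char chi : chi \is a character -> chi - cffix chi \is a character.
Proof.
move=> Nchi; rewrite {1}[chi]cfun_sum_cfdot /cffix.
rewrite (bigID (fun c => Y \subset cfker 'chi_c)) /= [X in X - _]addrC addrK.
apply: rpred_sum => c _.
have /natrP[n ->] := Cnat_cfdot_char_irr c Nchi.
by rewrite scaler_nat rpredMn ?irr_char.
Qed.

Lemma cfdot_Res_cfun1 (chi : 'CF(L)) :
  '['Res[Y] chi, 1] = #|Y|%:R^-1 * \sum_(y in Y) chi y.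
Proof.
rewrite cfdotE; congr (_ * _); apply: eq_bigr => y Yy.
by rewrite cfResE ?normal_sub // cfun1E Yy rmorph1 mulr1.
Qed.

Lemma cffix1 chi : cffix chi 1%g = '['Res[Y] chi, 1].
Proof.
rewrite cffixE ?group1 // cfdot_Res_cfun1; congr (_ * _).
by apply: eq_bigr => y _; rewrite mulg1.
Qed.

Lemma cfdot_cffixC chi : '['Res[Y] (chi - cffix chi), 1] = 0.
Proof.
rewrite raddfB /= cfdotBl -cffix1 cfRes_sub_ker ?cffix_ker //.
by rewrite cfdotZl cfnorm1 mulr1 subrr.
Qed.

End FixedPart.

Lemma cfdot_char_ge0 (gT : finGroupType) (G : {group gT}) (a b : 'CF(G)) :
  a \is a character -> b \is a character -> 0 <= '[a, b].
Proof. by move=> Na Nb; rewrite natr_ge0 // Cnat_cfdot_char. Qed.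

(* Each constituent shared by alpha and beta is charged to one of the weights xi j. *)
Lemma cfdot_le_restr (gT : finGroupType) (Q V : {group gT}) (I : finType)
    (xi : I -> 'CF(V)) (alpha beta : 'CF(Q)) :
  V \subset Q -> (forall j, xi j \is a character) ->
  alpha \is a character -> beta \is a character ->
  (forall c, c \in irr_constt alpha -> exists j, '['Res[V] 'chi_c, xi j] != 0) ->
  (forall j, '['Res[V] beta, xi j] <= 1) ->
  '[alpha, beta] <= \sum_j '['Res[V] alpha, xi j].
Proof.
move=> sVQ Nxi Na Nb hc hb.
have NRes (c : Iirr Q) : 'Res[V] 'chi_c \is a character by rewrite cfRes_char ?irr_char.
have RE (phi : 'CF(Q)) j :
    '['Res[V] phi, xi j] = \sum_c '[phi, 'chi_c] * '['Res[V] 'chi_c, xi j].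
  rewrite {1}[phi]cfun_sum_cfdot linear_sum cfdot_suml.
  by apply: eq_bigr => c _; rewrite linearZ cfdotZl.
have ge0 c j : 0 <= '['Res[V] 'chi[Q]_c, xi j] by apply: cfdot_char_ge0.
have ge1 c j : '['Res[V] 'chi[Q]_c, xi j] != 0 -> 1 <= '['Res[V] 'chi_c, xi j].
  have /natrP[n ->] := Cnat_cfdot_char (NRes c) (Nxi j).
  by rewrite pnatr_eq0 -lt0n ler1n.
rewrite (eq_bigr _ (fun j _ => RE alpha j)) exchange_big /= cfdot_sum_irr.
apply: ler_sum => c _; rewrite -mulr_sumr.
have a0 : 0 <= '[alpha, 'chi_c] by apply: cfdot_char_ge0; rewrite ?irr_char.
have [e|ac] := eqVneq '[alpha, 'chi_c] 0; first by rewrite e !mul0r.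
apply: ler_wpM2l => //; have [j jc] := hc c ac.
have b0 k : 0 <= '[beta, 'chi_k] by apply: cfdot_char_ge0; rewrite ?irr_char.
rewrite (conj_Creal (ger0_real (b0 c))).
apply: (@le_trans _ _ 1); last first.
  apply: le_trans (ge1 c j jc) _; rewrite (bigD1 j) //= lerDl.
  by apply: sumr_ge0.
apply: le_trans (hb j); rewrite RE (bigD1 c) //=.
apply: (@le_trans _ _ ('[beta, 'chi_c] * '['Res[V] 'chi_c, xi j])).
  by rewrite -[leLHS]mulr1 ler_wpM2l // ge1.
by rewrite lerDl; apply: sumr_ge0 => k _; rewrite mulr_ge0.
Qed.

Lemma irr_add_char (gT : finGroupType) (G : {group gT}) (a b : 'CF(G)) :
  a \is a character -> b \is a character -> a + b \in irr G -> a = 0 \/ b = 0.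
Proof.
move=> Na Nb /irrP[i ab]; have [->|na] := eqVneq a 0; first by left.
have [->|nb] := eqVneq b 0; first by right.
have H (c d : 'CF(G)) : c \is a character -> d \is a character -> c != 0 ->
    c + d = 'chi_i -> 1 <= '[c, 'chi_i].
  move=> Nc Nd nc cd; have [k kc] := neq0_has_constt nc.
  suff -> : i = k.
    have /natrP[n e] := Cnat_cfdot_char_irr k Nc.
    by move: kc; rewrite irr_consttE e pnatr_eq0 -lt0n ler1n.
  apply/eqP/negPn/negP => ik; move: kc; rewrite irr_consttE.
  have : '[c + d, 'chi_k] = 0 by rewrite cd cfdot_irr (negPf ik).
  rewrite cfdotDl => /eqP; rewrite paddr_eq0 ?cfdot_char_ge0 ?irr_char //.
  by case/andP=> ->.
have h1 := H a b Na Nb na ab.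
have h2 : 1 <= '[b, 'chi_i] by apply: (H b a) => //; rewrite addrC.
have : '[a + b, 'chi_i] = 1 by rewrite ab cfnorm_irr.
rewrite cfdotDl => e; have := lerD h1 h2; rewrite e.
by rewrite gerDl ler10.
Qed.

Lemma Ind_irr_irr (gT : finGroupType) (G H : {group gT}) (N : 'CF(H)) :
  H \subset G -> N \is a character -> 'Ind[G] N \in irr G -> N \in irr H.
Proof.
move=> sHG NN iN; have nN : N != 0.
  by apply: contraTneq iN => ->; rewrite linear0; apply/irrP=> -[i /eqP]; rewrite eq_sym (negPf (irr_neq0 _)).
have [c cN] := neq0_has_constt nN.
have /(constt_charP _ NN)[r Nr e] := cN.
have : 'Ind[G] 'chi_c + 'Ind[G] r \in irr G by rewrite -linearD -e.
case/(irr_add_char (cfInd_char _ (irr_char _)) (cfInd_char _ Nr)) => /eqP.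
  by rewrite (negPf (Ind_irr_neq0 _ sHG)).
by rewrite cfInd_eq0 // => /eqP r0; rewrite e r0 addr0 mem_irr.
Qed.

(** The corner algebra of an idempotent of rank [r] is a full matrix algebra of size [r], so
    commutativity forces [r <= 1]. Testing on elementary matrices turns this into identities between
    entries of [E], and no change of basis is needed. *)
Lemma idem_commut_mxtrace n (E : 'M[algC]_n) : E *m E = E ->
  (forall A B, E *m A *m E *m B *m E = E *m B *m E *m A *m E) ->
  \tr E = 0 \/ \tr E ^+ 2 = 1.
Proof.
move=> EE cE.
have deltaE (i j k l p r : 'I_n) :
    (E *m delta_mx i j *m E *m delta_mx k l *m E) p r = E p i * E j k * E l r.
  have e (a b : 'I_n) (A B : 'M[algC]_n) u v :
      (A *m delta_mx a b *m B) u v = A u a * B b v.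
    rewrite -(mul_delta_mx (0 : 'I_1)) mulmxA -mulmxA -rowE -colE mxE.
    by rewrite big_ord1 !mxE.
  by rewrite e e.
have key i j k l p r : E p i * E j k * E l r = E p k * E l i * E j r.
  by rewrite -!deltaE cE.
have EEe a b : \sum_c E a c * E c b = E a b by rewrite -[in RHS]EE mxE.
have k1 j k l r : \tr E * (E j k * E l r) = E l k * E j r.
  rewrite -[in RHS]EEe mulr_suml mulr_suml; apply: eq_bigr => i _.
  by rewrite mulrA (key i j k l i r) (mulrC (E i k)).
have k2 l r : \tr E ^+ 2 * E l r = E l r.
  rewrite -[in RHS]EEe expr2 -mulrA [X in _ * X]mulr_suml mulr_sumr.
  by apply: eq_bigr => j _; rewrite k1.
have [->|nz] := eqVneq E 0; first by left; rewrite mxtrace0.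
have [[i j] /= nzij] : exists ij, E ij.1 ij.2 != 0.
  apply/existsP; apply: contraR nz; rewrite negb_exists => /forallP h.
  by apply/eqP/matrixP=> i j; move: (h (i, j)); rewrite negbK mxE => /eqP.
by right; apply: (mulIf nzij); rewrite mul1r k2.
Qed.

(** An anti-automorphism that acts trivially on the compressed operators [E x E] makes them commute.
    Triviality is only asked in the representation [m], not on the double cosets of [H], which is
    what allows a condition on one constituent. *)
Lemma gelfand_trick (gT : finGroupType) (G H : {group gT}) (m : Iirr G)
    (sg : gT -> gT) (E := \sum_(h in H) 'Chi_m h) :
  H \subset G -> {in G, forall x, sg x \in G} ->
  {in G &, forall x y, sg (x * y)%g = (sg y * sg x)%g} ->
  {in H, forall h, sg h \in H} -> {in H &, injective sg} ->
  {in G, forall x, E *m 'Chi_m x *m E = E *m 'Chi_m (sg x) *m E} ->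
  '['Res[H] 'chi_m, 1] <= 1.
Proof.
move=> sHG sgG sgM sgH sgI hE.
have nzH : #|H|%:R != 0 :> algC by rewrite pnatr_eq0 -lt0n cardG_gt0.
have EDE : E = \sum_(h in H) 'Chi_m h by [].
move: E EDE hE => E EDE hE; pose F := #|H|%:R^-1 *: E.
have Eh h : h \in H -> E *m 'Chi_m h = E.
  move=> Hh; rewrite EDE mulmx_suml [RHS](reindex_inj (mulIg h)) /=.
  apply: eq_big => k; rewrite ?groupMr // => Hk.
  by rewrite repr_mxM ?(subsetP sHG).
have EE : E *m E = #|H|%:R *: E.
  rewrite {2}EDE mulmx_sumr (eq_bigr (fun=> E)) => [|h Hh]; last exact: Eh.
  by rewrite sumr_const scaler_nat.
have FF : F *m F = F.
  by rewrite /F -scalemxAl -scalemxAr EE [X in _ *: X]scalerA mulVf // scale1r.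
have trF : \tr F = '['Res[H] 'chi_m, 1].
  rewrite mxtraceZ EDE raddf_sum cfdotE; congr (_ * _); apply: eq_bigr => h Hh.
  rewrite cfResE // cfun1E Hh rmorph1 mulr1 -irrRepr cfunE (subsetP sHG) //.
have EsgE a b : a \in G -> b \in G ->
    E *m 'Chi_m a *m E *m 'Chi_m b *m E =
    E *m 'Chi_m b *m E *m 'Chi_m a *m E.
  move=> Ga Gb.
  have L x y : x \in G -> y \in G -> E *m 'Chi_m x *m E *m 'Chi_m y *m E =
      \sum_(h in H) E *m 'Chi_m (x * h * y)%g *m E.
    move=> Gx Gy; rewrite {2}EDE mulmx_sumr !mulmx_suml; apply: eq_bigr => h Hh.
    have Gh := subsetP sHG h Hh.
    by rewrite !repr_mxM ?groupM // !mulmxA.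
  rewrite L //.
  rewrite (eq_bigr (fun h => E *m 'Chi_m (sg b * sg h * sg a)%g *m E)); last first.
    move=> h Hh; have Gh := subsetP sHG h Hh.
    by rewrite hE ?groupM // !sgM ?groupM // mulgA.
  have sgHP : \sum_(h in H) E *m 'Chi_m (sg b * sg h * sg a)%g *m E =
      \sum_(h in H) E *m 'Chi_m (sg b * h * sg a)%g *m E.
    have im : sg @: H = H.
      apply/eqP; rewrite eqEcard card_in_imset // leqnn andbT.
      by apply/subsetP=> _ /imsetP[h Hh ->]; apply: sgH.
    by rewrite -[in RHS]im big_imset.
  rewrite sgHP -L ?sgG // -hE //.
  by rewrite -!(mulmxA (E *m 'Chi_m b)) -hE.
(* An absolutely irreducible representation spans all matrices, so commutation passes from group
   elements to arbitrary [A] and [B]. *)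
have cE A B : E *m A *m E *m B *m E = E *m B *m E *m A *m E.
  have /mx_abs_irrP[_ [a_ aG]] := mx_abs_irr_irr m.
  have c1 x D : x \in G ->
      E *m 'Chi_m x *m E *m D *m E = E *m D *m E *m 'Chi_m x *m E.
    move=> Gx; rewrite [D]aG (mulmx_sumr E) mulmx_sumr !mulmx_suml.
    apply: eq_bigr => y Gy; rewrite -!scalemxAr -!scalemxAl.
    by rewrite EsgE.
  rewrite [A]aG (mulmx_sumr E) (mulmx_sumr (E *m B *m E)) !mulmx_suml.
  apply: eq_bigr => y Gy; rewrite -!scalemxAr -!scalemxAl.
  by rewrite c1.
have cF A B : F *m A *m F *m B *m F = F *m B *m F *m A *m F.
  by rewrite /F; do 6! rewrite -?scalemxAl -?scalemxAr; rewrite cE.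
have /natrP[n en] : '['Res[H] 'chi_m, 1] \in Num.nat.
  by apply: Cnat_cfdot_char; rewrite ?cfRes_char ?irr_char ?cfun1_char.
have [] := idem_commut_mxtrace FF cF; rewrite trF en; first by move->; exact: ler01.
by move/eqP; rewrite -natrX (eqr_nat _ _ 1) lern1; case: n {en} => [|[|n]].
Qed.

Lemma irr_setX (gT hT : finGroupType) (G : {group gT}) (H : {group hT})
    (i : Iirr G) (j : Iirr H) :
  exists m : Iirr (setX G H), forall x y, x \in G -> y \in H ->
    'chi_m (x, y) = 'chi_i x * 'chi_j y.
Proof.
pose f1 := fst : gT * hT -> gT; pose f2 := snd : gT * hT -> hT.
have rP1 : mx_repr (setX G H) (fun u => 'Chi_i (fst u)).
  split=> [|u v]; rewrite ?repr_mx1 // !inE => /andP[u1 _] /andP[v1 _].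
  exact: repr_mxM.
have rP2 : mx_repr (setX G H) (fun u => 'Chi_j (snd u)).
  split=> [|u v]; rewrite ?repr_mx1 // !inE => /andP[_ u1] /andP[_ v1].
  exact: repr_mxM.
pose c := cfRepr (MxRepresentation rP1) * cfRepr (MxRepresentation rP2).
have cE x y : x \in G -> y \in H -> c (x, y) = 'chi_i x * 'chi_j y.
  move=> Gx Hy; rewrite !cfunE inE /= Gx Hy -!irrRepr !cfunE Gx Hy //.
have ic : c \in irr (setX G H).
  rewrite irrEchar rpredM ?cfRepr_char //=.
  rewrite cfdotE cardsX natrM invfM.
  rewrite (eq_bigl (fun u => (u.1 \in G) && (u.2 \in H))); last by move=> u; rewrite inE.
  rewrite (eq_bigr (fun u => ('chi_i u.1 * ('chi_i u.1)^*) * ('chi_j u.2 * ('chi_j u.2)^*)));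
    last by case=> x y /andP[/= Gx Hy]; rewrite cE // rmorphM mulrACA.
  rewrite -(pair_big (mem G) (mem H) (fun x y =>
     ('chi_i x * ('chi_i x)^*) * ('chi_j y * ('chi_j y)^*))) /=.
  under eq_bigr => x _ do rewrite -mulr_sumr.
  by rewrite -mulr_suml mulrACA -!cfdotE !cfnorm_irr mulr1.
have /irrP[m em] := ic.
by exists m => x y Gx Hy; rewrite -em cE.
Qed.

(** The average over [Y] is idempotent, so its trace is its rank: a vanishing character sum kills
    the operator itself. *)
Lemma sum_repr_eq0 (gT : finGroupType) (G Y : {group gT}) n
    (rG : mx_representation algC G n) :
  Y \subset G -> \sum_(y in Y) cfRepr rG y = 0 -> \sum_(y in Y) rG y = 0.
Proof.
move=> sYG s0.
have nzH : #|Y|%:R != 0 :> algC by rewrite pnatr_eq0 -lt0n cardG_gt0.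
pose E := \sum_(y in Y) rG y; pose F := #|Y|%:R^-1 *: E.
have EE : E *m E = #|Y|%:R *: E.
  rewrite {2}/E mulmx_sumr (eq_bigr (fun=> E)) => [|h Hh].
    by rewrite sumr_const scaler_nat.
  rewrite mulmx_suml [RHS](reindex_inj (mulIg h)) /=.
  apply: eq_big => k; rewrite ?groupMr // => Hk.
  by rewrite repr_mxM ?(subsetP sYG).
have FF : F *m F = F.
  by rewrite /F -scalemxAl -scalemxAr EE [X in _ *: X]scalerA mulVf // scale1r.
have trF : \tr F = 0.
  rewrite mxtraceZ raddf_sum (eq_bigr (fun y => cfRepr rG y)) ?s0 ?mulr0 //.
  by move=> y Yy; rewrite cfunE (subsetP sYG).
suff F0 : F = 0.
  have : #|Y|%:R *: F = 0 by rewrite F0 scaler0.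
  by rewrite scalerA divff // scale1r.
have cr : row_base F *m col_base F = 1%:M.
  have e : col_base F *m (row_base F *m col_base F) *m row_base F =
           col_base F *m 1%:M *m row_base F.
    by rewrite mulmx1 mulmxA mulmx_base -mulmxA mulmx_base FF.
  have := row_free_inj (row_base_free F) e.
  by apply: row_full_inj; apply: col_base_full.
have : \tr F = (\rank F)%:R.
  by rewrite -{1}(mulmx_base F) mxtrace_mulC cr mxtrace_scalar.
rewrite trF => /eqP; rewrite eq_sym pnatr_eq0 mxrank_eq0 => /eqP; apply.
Qed.

Lemma char_sub_constt (gT : finGroupType) (G : {group gT}) (chi : 'CF(G)) i :
  chi \is a character -> chi - '[chi, 'chi_i] *: 'chi_i \is a character.
Proof.
move=> Nchi; rewrite {1}[chi]cfun_sum_cfdot (bigD1 i) //= [X in X - _]addrC addrK.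
apply: rpred_sum => c _; have /natrP[n ->] := Cnat_cfdot_char_irr c Nchi.
by rewrite scaler_nat rpredMn ?irr_char.
Qed.

Lemma fixed_cfker (gT : finGroupType) (L Y : {group gT}) (chi : 'CF(L)) :
  Y \subset L -> chi \is a character -> '['Res[Y] chi, 1] = chi 1%g ->
  Y \subset cfker chi.
Proof.
move=> sYL Nchi e; have NR := cfRes_char Y Nchi.
have := char_sub_constt 0 NR; rewrite irr0 e => N0.
have /eqP : 'Res[Y] chi - chi 1%g *: 1 == 0.
  by rewrite -char1_eq0 // !cfunE cfun1E group1 mulr1 cfRes1 subrr.
move/eqP; rewrite subr_eq0 => /eqP E.
apply/subsetP=> y Yy; rewrite cfkerEchar // inE (subsetP sYL) //=.
by rewrite -(cfResE _ sYL Yy) E !cfunE cfun1E Yy mulr1.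
Qed.

(** Every constituent uses up one occurrence of [xi], and there is only one to share. *)
Lemma irr_of_unique_weight (gT : finGroupType) (G U : {group gT}) (xi : 'CF(U)) (chi : 'CF(G)) :
  chi \is a character -> chi != 0 -> xi \is a character ->
  (forall k, k \in irr_constt chi -> 1 <= '['Res[U] 'chi_k, xi]) ->
  '['Res[U] chi, xi] <= 1 -> chi \in irr G.
Proof.
move=> Nchi nz Nxi wge wle; have [k kc] := neq0_has_constt nz.
have /(constt_charP _ Nchi)[r Nr e] := kc.
have [r0|nr] := eqVneq r 0; first by rewrite e r0 addr0 mem_irr.
have [k' kr] := neq0_has_constt nr.
have /(constt_charP _ Nr)[r' Nr' e'] := kr.
have k'c : k' \in irr_constt chi.
  by apply/constt_charP=> //; exists ('chi_k + r'); rewrite ?rpredD ?irr_char // e e' addrCA.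
have : 1 + 1 <= '['Res[U] chi, xi].
  rewrite e e' !linearD /= !cfdotDl addrA -[leLHS]addr0.
  by rewrite !lerD ?wge // cfdot_char_ge0 ?cfRes_char.
by move=> h; have := le_trans h wle; rewrite gerDl ler10.
Qed.

(** * Two by two matrices *)

Section Mx2.
Variable R : comNzRingType.
Implicit Types a b c d : R.

Definition mx2 a b c d : 'M[R]_2 :=
  \matrix_(i < 2, j < 2) if i == 0 then if j == 0 then a else b
                         else if j == 0 then c else d.

Lemma mx2P (A B : 'M[R]_2) : A 0 0 = B 0 0 -> A 0 1 = B 0 1 ->
  A 1 0 = B 1 0 -> A 1 1 = B 1 1 -> A = B.
Proof.
move=> h1 h2 h3 h4; apply/matrixP=> i j.
have ordE (k : 'I_2) : k = 0 \/ k = 1.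
  by case: k => [[|[|//]] ik]; [left|right]; apply: val_inj.
by case: (ordE i) => ->; case: (ordE j) => ->.
Qed.

Lemma mx2_00 a b c d : mx2 a b c d 0 0 = a. Proof. by rewrite mxE. Qed.
Lemma mx2_01 a b c d : mx2 a b c d 0 1 = b. Proof. by rewrite mxE. Qed.
Lemma mx2_10 a b c d : mx2 a b c d 1 0 = c. Proof. by rewrite mxE. Qed.
Lemma mx2_11 a b c d : mx2 a b c d 1 1 = d. Proof. by rewrite mxE. Qed.
Definition mx2E := (mx2_00, mx2_01, mx2_10, mx2_11).

Lemma mx2_eta (A : 'M[R]_2) : A = mx2 (A 0 0) (A 0 1) (A 1 0) (A 1 1).
Proof. by apply: mx2P; rewrite mx2E. Qed.

Lemma mulmx2 (A B : 'M[R]_2) i j : (A *m B) i j = A i 0 * B 0 j + A i 1 * B 1 j.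
Proof.
rewrite mxE !big_ord_recl big_ord0 addr0.
by congr (_ + A i _ * B _ j); apply: val_inj.
Qed.

Lemma mx2M a b c d a' b' c' d' : mx2 a b c d *m mx2 a' b' c' d' =
  mx2 (a * a' + b * c') (a * b' + b * d') (c * a' + d * c') (c * b' + d * d').
Proof. by apply: mx2P; rewrite mulmx2 !mx2E. Qed.

Lemma mx2_1 : 1%:M = mx2 1 0 0 1 :> 'M[R]_2.
Proof. by apply: mx2P; rewrite mx2E mxE. Qed.

Lemma mx2_tr a b c d : (mx2 a b c d)^T = mx2 a c b d.
Proof. by apply: mx2P; rewrite mxE !mx2E. Qed.

Lemma det_mx2E (A : 'M[R]_2) : \det A = A 0 0 * A 1 1 - A 0 1 * A 1 0.
Proof.
rewrite (expand_det_row _ 0) !big_ord_recl big_ord0 addr0 /cofactor !det_mx11 !mxE /=.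
rewrite !add0n expr0 expr1 mul1r mulN1r mulrN.
by congr (A _ _ * A _ _ - A _ _ * A _ _); apply: val_inj.
Qed.

Lemma det_mx2 a b c d : \det (mx2 a b c d) = a * d - b * c.
Proof. by rewrite det_mx2E !mx2E. Qed.

Lemma tr_mx2 (A : 'M[R]_2) : \tr A = A 0 0 + A 1 1.
Proof.
rewrite /mxtrace !big_ord_recl big_ord0 addr0.
by congr (_ + A _ _); apply: val_inj.
Qed.

End Mx2.

Section GL2.
Variable R : finComUnitRingType.
Implicit Types (a b c d : R) (g h : {'GL_2[R]}).
Local Notation unit := (GRing.unit : pred R).

(** Defaults to the identity when the determinant is not a unit; [gl2K] gives the entries back under
    the determinant condition. *)
Definition gl2 a b c d : {'GL_2[R]} := insubd (1%g : {'GL_2[R]}) (mx2 a b c d).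

Lemma gl2K a b c d : a * d - b * c \is a GRing.unit ->
  GLval (gl2 a b c d) = mx2 a b c d.
Proof. by move=> u; rewrite -[GLval _]/(val _) insubdK // -topredE /= unitmxE det_mx2. Qed.

Lemma gl2_unit g :
  GLval g 0 0 * GLval g 1 1 - GLval g 0 1 * GLval g 1 0 \is a GRing.unit.
Proof. by rewrite -det_mx2E -unitmxE; have := GL_unit g. Qed.

Lemma gl2_eta g :
  g = gl2 (GLval g 0 0) (GLval g 0 1) (GLval g 1 0) (GLval g 1 1).
Proof. by apply: val_inj; rewrite -[RHS]/(GLval _) gl2K ?gl2_unit // -mx2_eta. Qed.

Lemma gl2_ind (P : {'GL_2[R]} -> Prop) :
  (forall a b c d, a * d - b * c \is a GRing.unit -> P (gl2 a b c d)) -> forall g, P g.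
Proof. by move=> h g; rewrite (gl2_eta g); apply/h/gl2_unit. Qed.

Lemma GL2P g h : GLval g = GLval h -> g = h.
Proof. exact: val_inj. Qed.

Lemma gl2_det_mul a b c d a' b' c' d' :
  a * d - b * c \is a GRing.unit -> a' * d' - b' * c' \is a GRing.unit ->
  (a * a' + b * c') * (c * b' + d * d') - (a * b' + b * d') * (c * a' + d * c')
    \is a GRing.unit.
Proof.
move=> u u'; have -> : (a * a' + b * c') * (c * b' + d * d')
  - (a * b' + b * d') * (c * a' + d * c') = (a * d - b * c) * (a' * d' - b' * c').
  by ring.
by rewrite unitrM u u'.
Qed.

Lemma gl2M a b c d a' b' c' d' :
  a * d - b * c \is a GRing.unit -> a' * d' - b' * c' \is a GRing.unit ->
  (gl2 a b c d * gl2 a' b' c' d')%g =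
  gl2 (a * a' + b * c') (a * b' + b * d') (c * a' + d * c') (c * b' + d * d').
Proof.
move=> u u'; apply: GL2P.
by rewrite GL_MxE !gl2K ?gl2_det_mul // mx2M.
Qed.

Lemma gl2_1 : gl2 1 0 0 1 = 1%g.
Proof. by apply: GL2P; rewrite gl2K ?mulr0 ?mulr1 ?subr0 ?unitr1 // -mx2_1. Qed.

End GL2.

(** * Finite chain rings *)

(** What is kept of the quotient of the valuation ring modulo [p^l]. The residue cardinality [q]
    enters through the sizes of the ideals; for [l = 1] one has [p = 0]. *)
Record chain_ring (R : finComUnitRingType) (p : R) (l q : nat) : Prop := ChainRing {
  chain_l : (0 < l)%N;
  chain_nil : p ^+ l = 0;
  chain_fact : forall x : R, x != 0 ->
    exists i, (i < l)%N /\ exists2 u, u \is a GRing.unit & x = u * p ^+ i;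
  chain_card : forall i, (i <= l)%N -> #|[set p ^+ i * x | x : R]| = (q ^ (l - i))%N;
  chain_odd : odd q;
  chain_q : (1 < q)%N;
  chain_two : (2%:R : R) \is a GRing.unit }.

Section ChainRing.
Variables (R : finComUnitRingType) (p : R) (l q : nat).
Hypothesis cR : chain_ring p l q.
Let P := p ^+ l.-1.

Lemma chain_S : l = l.-1.+1.
Proof. by rewrite prednK ?(chain_l cR). Qed.

Lemma chain_pP : p * P = 0.
Proof. by rewrite -exprS -chain_S (chain_nil cR). Qed.

Lemma chain_p_nunit : p \isn't a GRing.unit.
Proof.
apply/negP=> up; have : p ^+ l \is a GRing.unit by rewrite unitrX.
by rewrite (chain_nil cR) unitr0.
Qed.

Lemma chain_pM_nunit y : p * y \isn't a GRing.unit.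
Proof. by rewrite unitrM negb_and chain_p_nunit. Qed.

Lemma chain_nunitP x : reflect (exists y, x = p * y) (x \isn't a GRing.unit).
Proof.
apply: (iffP idP) => [nx|[y ->]]; last exact: chain_pM_nunit.
have [->|nz] := eqVneq x 0; first by exists 0; rewrite mulr0.
have [[|i] [_ [u uu e]]] := chain_fact cR nz.
  by move: nx; rewrite e expr0 mulr1 uu.
by exists (u * p ^+ i); rewrite e exprS mulrCA.
Qed.

Lemma chain_unitD x y : x \is a GRing.unit -> x + p * y \is a GRing.unit.
Proof.
move=> ux; apply: contraLR ux => /chain_nunitP[z e].
have -> : x = p * (z - y) by rewrite mulrBr -e addrK.
exact: chain_pM_nunit.
Qed.

Lemma chain_card_pow i : (i <= l)%N -> p ^+ i = 0 -> i = l.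
Proof.
move=> il pi0; have := chain_card cR il; rewrite pi0.
have -> : [set 0 * x | x : R] = [set 0].
  apply/setP=> x; rewrite inE; apply/imsetP/eqP=> [[y _ ->]|->]; rewrite ?mul0r //.
  by exists 0; rewrite ?mul0r.
rewrite cards1 => /esym/eqP; rewrite -(expn0 q) eqn_exp2l ?(chain_q cR) // subn_eq0 => li.
by apply/eqP; rewrite eqn_leq il li.
Qed.

Lemma chain_Pneq0 : P != 0.
Proof.
apply/eqP=> P0; have := chain_card_pow (leq_pred l) P0.
by rewrite {2}chain_S => /n_Sn.
Qed.

Lemma chain_PM_eq0 x : (P * x == 0) = (x \isn't a GRing.unit).
Proof.
apply/eqP/chain_nunitP => [e|[y ->]]; last by rewrite mulrA [P * p]mulrC chain_pP mul0r.
apply/chain_nunitP; apply: contraTN isT => ux.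
by have := chain_Pneq0; rewrite -(mulrK ux P) e mul0r eqxx.
Qed.

Lemma chain_ann i x : (i <= l)%N -> p ^+ i * x = 0 -> exists y, x = p ^+ (l - i) * y.
Proof.
move=> il e; have [->|nz] := eqVneq x 0; first by exists 0; rewrite mulr0.
have [j [jl [u uu ex]]] := chain_fact cR nz.
exists (u * p ^+ (j - (l - i))); rewrite mulrCA -exprD ex.
suff h : (l - i <= j)%N by rewrite subnKC.
rewrite leqNgt; apply/negP=> h.
have : p ^+ (i + j) = 0.
  by apply: (mulrI uu); rewrite mulr0 exprD mulrCA -ex.
move/chain_card_pow=> h2; have : (i + j < l)%N by rewrite -ltn_subRL.
by move=> h3; move: (h3); rewrite h2 ?ltnn // ltnW.
Qed.

Lemma chain_card_R : #|R| = (q ^ l)%N.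
Proof.
have := chain_card cR (leq0n l); rewrite subn0 => <-.
rewrite -cardsT; congr #|pred_of_set _|; apply/setP=> x; rewrite inE.
by apply/esym/imsetP; exists x => //; rewrite expr0 mul1r.
Qed.

Lemma chain_card_nunit : #|[pred x : R | x \isn't a GRing.unit]| = (q ^ l.-1)%N.
Proof.
have := chain_card cR (chain_l cR); rewrite subn1 => <-.
apply: eq_card => x; rewrite inE; apply/chain_nunitP/imsetP => [[y ->]|[y _ ->]];
  by exists y; rewrite ?expr1.
Qed.

Lemma chain_card_unit : #|[pred x : R | x \is a GRing.unit]| = ((q - 1) * q ^ l.-1)%N.
Proof.
apply/eqP; rewrite -(eqn_add2r #|[pred x : R | x \isn't a GRing.unit]|).
rewrite chain_card_nunit mulnBl mul1n subnK; last first.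
  by rewrite leq_pmull // ltnW ?(chain_q cR).
rewrite -expnS -chain_S -chain_card_R -chain_card_nunit.
by rewrite -[X in _ == X](cardC [pred x : R | x \is a GRing.unit]).
Qed.

(** * Fourier coefficients of functions invariant under units *)

Section Fourier.
Variables (psi : R -> algC).
Hypotheses (psiA : is_add_char psi) (psiP : exists x : R, psi (P * x) != 1).

(** Every nonzero ideal contains the minimal ideal [P R], where [psi] is not trivial; so the
    character [a |-> psi (a * y)] is nontrivial unless [y = 0]. *)
Lemma sum_add_char y : \sum_a (psi (a * y))^* = #|R|%:R *+ (y == 0).
Proof.
have [psi0 psiD] := psiA.
have [->|nz] := eqVneq y 0.
  rewrite (eq_bigr (fun=> 1)) ?sumr_const // => a _.
  by rewrite mulr0 psi0 rmorph1.
have [i [il [u uu ey]]] := chain_fact cR nz.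
have [x px] := psiP.
have [z ez] : exists z, psi (z * y) != 1.
  exists (x * p ^+ (l.-1 - i) * u^-1).
  by rewrite ey mulrA divrK // -mulrA -exprD subnK 1?mulrC // -ltnS -chain_S.
apply/eqP; rewrite mulr0n -(mulrI_eq0 _ (_ : GRing.lreg ((psi (z * y))^* - 1))); last first.
  by apply/lregP; rewrite subr_eq0 fmorph_eq1.
rewrite mulrBl mul1r mulr_sumr subr_eq0; apply/eqP.
rewrite [RHS](reindex_inj (addrI z)) /=; apply: eq_bigr => a _.
by rewrite mulrDl psiD rmorphM.
Qed.

(** Multiplication by [p] maps [R] onto the nonunits, and its fibres are cosets of [P R], of size
    [q]. This reduces the sum to [sum_add_char] at [p * y]. *)
Lemma sum_add_char_nunit y :
  \sum_(a | a \isn't a GRing.unit) (psi (a * y))^* = (q ^ l.-1)%:R *+ (p * y == 0).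
Proof.
have [psi0 psiD] := psiA.
have e : \sum_a (psi (a * (p * y)))^* =
    q%:R * \sum_(a | a \isn't a GRing.unit) (psi (a * y))^*.
  rewrite (partition_big (fun a => p * a) (fun a => a \isn't a GRing.unit)) /=;
    last by move=> a _; apply: chain_pM_nunit.
  rewrite mulr_sumr; apply: eq_bigr => b /chain_nunitP[c ->].
  rewrite (eq_bigr (fun=> (psi (p * c * y))^*)); last first.
    by move=> a /eqP <-; rewrite mulrCA mulrA.
  rewrite sumr_const mulr_natl; congr (_ *+ _).
  have l1 : (l - l.-1 = 1)%N by rewrite {1}chain_S subSnn.
  have := chain_card cR (leq_pred l); rewrite l1 expn1 => <-.
  rewrite -[RHS](card_imset _ (addIr c)); apply: eq_card => a.
  rewrite unfold_in; apply/eqP/imsetP=> [e|[_ /imsetP[x _ ->] ->]]; last first.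
    by rewrite mulrDr mulrA chain_pP mul0r add0r.
  exists (a - c); last by rewrite subrK.
  have := @chain_ann 1 (a - c) (chain_l cR); rewrite expr1 mulrBr e subrr => /(_ erefl)[x ->].
  by apply/imsetP; exists x => //; rewrite subn1.
have lS : (q ^ l = q * q ^ l.-1)%N by rewrite -expnS -chain_S.
move: e; rewrite sum_add_char chain_card_R lS natrM => e.
apply: (@mulfI _ q%:R); first by rewrite pnatr_eq0 -lt0n ltnW // (chain_q cR).
by rewrite -e; case: (p * y == 0); rewrite ?mulr1n ?mulr0n ?mulr0.
Qed.

Variables (s : nat) (c : R -> algC).
Hypothesis cU : forall a y, a \is a GRing.unit -> c (a * y) = c y.
Let I := [set p ^+ s * x | x : R].
(** Unnormalised Fourier coefficient at frequency [a] of [c] restricted to the ideal generated by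
    [p ^+ s]. The case [s = 0] serves the upper unipotent group, [s = 1] the lower one inside the
    Iwahori subgroup. *)
Definition fcoef a := \sum_(y in I) c y * (psi (a * y))^*.

Lemma fcoefM a b : a \is a GRing.unit -> fcoef (a * b) = fcoef b.
Proof.
move=> ua; rewrite /fcoef [RHS](reindex_inj (mulrI ua)) /=.
apply: eq_big => y; last by rewrite cU // [b * _]mulrCA mulrA.
apply/imsetP/imsetP=> -[x _ e].
  by exists (a * x) => //; rewrite e mulrCA.
by exists (a^-1 * x) => //; apply: (mulrI ua); rewrite e mulrCA mulVKr.
Qed.

Lemma fcoef_sum : \sum_a fcoef a = #|R|%:R * c 0.
Proof.
have I0 : 0 \in I by apply/imsetP; exists 0; rewrite ?mulr0.
rewrite exchange_big /=.
rewrite (eq_bigr (fun y => c y * (#|R|%:R *+ (y == 0)))); last first.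
  by move=> y _; rewrite -mulr_sumr sum_add_char.
rewrite (bigD1 0) //= eqxx big1 ?addr0 ?mulr1n 1?mulrC // => y /andP[_ nz].
by rewrite (negPf nz) mulr0.
Qed.

Lemma fcoef_sum_nunit : \sum_(a | a \isn't a GRing.unit) fcoef a =
  (q ^ l.-1)%:R * \sum_(y in I | p * y == 0) c y.
Proof.
rewrite exchange_big /= mulr_sumr [RHS]big_mkcondr /=; apply: eq_bigr => y _.
rewrite -mulr_sumr sum_add_char_nunit; case: ifP => _; last by rewrite mulr0.
by rewrite mulrC.
Qed.

(** Removing the nonunit frequencies from the total leaves the [(q-1)q^(l-1)] unit frequencies,
    where the coefficient is constant because [c] is invariant under units. *)
Lemma fcoef1 : ((q - 1) * q ^ l.-1)%:R * fcoef 1 =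
  (q ^ l)%:R * c 0 - (q ^ l.-1)%:R * \sum_(y in I | p * y == 0) c y.
Proof.
rewrite -chain_card_R -fcoef_sum -fcoef_sum_nunit.
rewrite (bigID (fun a => a \is a GRing.unit)) /= addrK -chain_card_unit.
rewrite (eq_bigr (fun=> fcoef 1)); last by move=> a ua; rewrite -[a]mulr1 fcoefM.
by rewrite sumr_const mulr_natl.
Qed.

End Fourier.
End ChainRing.

(** * The transposition trick *)

Section Content.
Variables (R : finComUnitRingType) (p : R) (l q : nat).
Hypothesis cR : chain_ring p l q.

Lemma chain_content (x y : R) : (x != 0) || (y != 0) ->
  exists i x' y', [/\ (i < l)%N, x = p ^+ i * x', y = p ^+ i * y' &
     (x' \is a GRing.unit) || (y' \is a GRing.unit)].
Proof.
wlog nzx : x y / x != 0 => [H|] nz.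
  have [nzx|x0] := boolP (x != 0); first exact: H.
  move: nz; rewrite (negPf x0) /= => nzy.
  have [i [y' [x' [il ey ex u]]]] := H y x nzy (introT orP (or_introl nzy)).
  by exists i, x', y'; rewrite orbC.
have [i [il [u uu ex]]] := chain_fact cR nzx.
have [->|nzy] := eqVneq y 0.
  by exists i, u, 0; split; rewrite ?mulr0 ?uu // mulrC.
have [j [jl [v uv ey]]] := chain_fact cR nzy.
have [ij|ji] := leqP i j.
  exists i, u, (p ^+ (j - i) * v); split; rewrite ?uu //; first by rewrite mulrC.
  by rewrite mulrA -exprD subnKC // mulrC.
exists j, (p ^+ (i - j) * u), v; split; rewrite ?uv ?orbT //; last by rewrite mulrC.
by rewrite mulrA -exprD subnKC 1?ltnW // mulrC.
Qed.

Lemma chain_content3 (x y z : R) : exists s x' y' z',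
  [/\ x = s * x', y = s * y', z = s * z' &
    [|| x' \is a GRing.unit, y' \is a GRing.unit | z' \is a GRing.unit]].
Proof.
have [/chain_content[i [x1 [y1 [_ ex ey u1]]]]|] := boolP ((x != 0) || (y != 0)).
  have [/chain_content[j [s1 [z1 [_ es ez u2]]]]|] := boolP ((p ^+ i != 0) || (z != 0)).
    case/orP: u2 => u2.
      exists (p ^+ j * s1), x1, y1, (s1^-1 * z1); rewrite -es; split=> //; last by rewrite orbA u1.
      by rewrite es mulrA mulrK.
    exists (p ^+ j), (s1 * x1), (s1 * y1), z1; rewrite !mulrA -es; split=> //.
    by rewrite u2 !orbT.
  rewrite negb_or !negbK => /andP[/eqP e0 /eqP ez].
  by exists 0, 1, 0, 0; rewrite unitr1 ex ey ez e0 !mul0r.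
rewrite negb_or !negbK => /andP[/eqP -> /eqP ->].
by exists z, 0, 0, 1; rewrite unitr1 !mulr0 mulr1 !orbT.
Qed.

End Content.

Section Transpose.
Variables (R : finComUnitRingType) (p : R) (l q : nat).
Hypothesis cR : chain_ring p l q.
Local Notation gT := {'GL_2[R]}.
Let P := p ^+ l.-1.

Definition uu (x : R) : gT := gl2 1 x 0 1.
Definition ww : gT := gl2 0 1 1 0.
Definition trg (g : gT) : gT :=
  gl2 (GLval g 0 0) (GLval g 1 0) (GLval g 0 1) (GLval g 1 1).

Lemma unit_det1 (x y : R) : x = 1 -> y = 0 -> x - y \is a GRing.unit.
Proof. by move=> -> ->; rewrite subr0 unitr1. Qed.

Lemma uu_det (x : R) : 1 * 1 - x * 0 \is a GRing.unit.
Proof. by apply: unit_det1; rewrite ?mulr1 ?mulr0. Qed.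
Lemma ww_det : (0 * 0 - 1 * 1 : R) \is a GRing.unit.
Proof. by rewrite mul0r mulr1 sub0r unitrN unitr1. Qed.

Lemma trg_val g : GLval (trg g) = (GLval g)^T.
Proof.
rewrite gl2K; last by have := gl2_unit g; rewrite [_ 0 1 * _]mulrC.
by rewrite [in RHS](mx2_eta (GLval g)) mx2_tr.
Qed.

Lemma trgM g h : trg (g * h) = (trg h * trg g)%g.
Proof. by apply: GL2P; rewrite trg_val !GL_MxE trmx_mul !trg_val. Qed.

Lemma trgK : involutive trg.
Proof. by move=> g; apply: GL2P; rewrite !trg_val trmxK. Qed.

Lemma trg_uu x : trg (uu x) = (uu x ^ ww)%g.
Proof.
rewrite conjgE; apply: (mulgI ww); rewrite !mulgA mulgV mul1g.
apply: GL2P; rewrite !GL_MxE trg_val !gl2K ?uu_det ?ww_det //.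
by rewrite mx2_tr !mx2M; congr mx2; ring.
Qed.

Variable V : lmodType algC.
(** In the application [Psi x y] is the difference of the compressed operators at the triple
    [(x, y, 1)] and at its transpose; proving it zero supplies the condition of the Gelfand
    trick. *)
Variable Psi : gT -> gT -> V.
Hypothesis PsiJ : forall g x y : gT, Psi (x ^ g)%g (y ^ g)%g = Psi x y.
Hypothesis PsiT : forall g x y : gT, (x ^ g)%g = trg x -> (y ^ g)%g = trg y -> Psi x y = 0.
Hypothesis PsiS : forall h x y : gT, \sum_(z | p * z == 0) Psi (x * uu z ^ h)%g y = 0.

Lemma PsiTm (A : 'M[R]_2) (x y : gT) : \det A \is a GRing.unit ->
  A *m GLval x = (GLval x)^T *m A -> A *m GLval y = (GLval y)^T *m A -> Psi x y = 0.
Proof.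
move=> uA hx hy.
pose g : gT := gl2 (A 0 0) (A 0 1) (A 1 0) (A 1 1).
have gE : GLval g = A by rewrite gl2K -?mx2_eta // -det_mx2E.
have h (z : gT) : A *m GLval z = (GLval z)^T *m A -> (z ^ g^-1 = trg z)%g.
  move=> e; rewrite conjgE invgK; apply: (mulIg g); rewrite -!mulgA mulVg mulg1.
  by apply: GL2P; rewrite !GL_MxE trg_val gE.
by apply: (PsiT (h _ hx) (h _ hy)).
Qed.

(* Here y = al + s C with C the companion matrix of X^2 - ta X - be, and x is written
   on the basis 1, C together with its part outside R[C]: either a symmetric matrix
   conjugates both to their transposes, or Psi is invariant under translating x by
   a conjugate of Y, over which it sums to zero. *)
Lemma Psi0_companion (x : gT) (al s be ta : R) (y : gT) :
  GLval y = mx2 al (s * be) s (al + s * ta) -> Psi x y = 0.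
Proof.
move=> ey; pose Cy := GLval y.
have key (A : 'M[R]_2) (x' : gT) : \det A \is a GRing.unit ->
    A *m GLval x' = (GLval x')^T *m A ->
    A 0 1 = A 1 0 -> A 1 1 = be * A 0 0 + ta * A 0 1 -> Psi x' y = 0.
  move=> uA hx sA hA; apply: (PsiTm uA hx); rewrite ey mx2_tr (mx2_eta A) !mx2M.
  by rewrite hA -sA; congr mx2; ring.
have Zgood (x' : gT) : GLval x' 0 1 - be * GLval x' 1 0 = 0 ->
    GLval x' 1 1 - GLval x' 0 0 - ta * GLval x' 1 0 = 0 -> Psi x' y = 0.
  elim/gl2_ind: x' => a b c d u; rewrite gl2K // !mx2E => /eqP.
  rewrite subr_eq0 => /eqP hb; rewrite -addrA -opprD => /eqP.
  rewrite subr_eq0 => /eqP hd.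
  apply: (key (mx2 0 1 1 ta)); rewrite ?mx2E //.
  - by rewrite det_mx2 mul0r sub0r mulr1 unitrN unitr1.
  - by rewrite gl2K // mx2_tr !mx2M hb hd; congr mx2; ring.
  - by ring.
elim/gl2_ind: x => x1 x2 x3 x4 ux.
(* [x] is [x1 + x3 C] plus the matrix with first column zero and second column [(m, n)]; the pair
   measures the distance to [R[C]]. *)
pose m := x2 - be * x3; pose n := x4 - x1 - ta * x3.
have [/(chain_content cR)[d [m' [n' [dl em en mnu]]]]|] := boolP ((m != 0) || (n != 0));
  last first.
  rewrite negb_or !negbK => /andP[/eqP m0 /eqP n0].
  by apply: Zgood; rewrite gl2K // !mx2E.
have ex2 : x2 = be * x3 + p ^+ d * m' by rewrite -em /m; ring.
have ex4 : x4 = x1 + ta * x3 + p ^+ d * n' by rewrite -en /n; ring.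
(* A symmetric [A] with [A C] symmetric is determined by its first row, and [A x] is then symmetric
   when [A00 m + A01 n = 0]. The first row [(n', - m')] solves this, and [de] is the determinant of
   the resulting matrix. *)
pose de := be * n' ^+ 2 - ta * n' * m' - m' ^+ 2.
have [ude|nde] := boolP (de \is a GRing.unit).
  apply: (key (mx2 n' (- m') (- m') (be * n' - ta * m'))); rewrite ?mx2E //.
  - rewrite det_mx2; suff -> : n' * (be * n' - ta * m') - (- m') * - m' = de by [].
    by rewrite /de; ring.
  - by rewrite gl2K // mx2_tr !mx2M ex2 ex4; congr mx2; ring.
  - by ring.
have un : n' \is a GRing.unit.
  apply: contraLR mnu => nn; rewrite negb_or nn andbT.
  move: nde nn => /(chain_nunitP cR)[a ea] /(chain_nunitP cR)[b eb].
  have : m' ^+ 2 = p * (be * n' * b - ta * b * m' - a).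
    have : m' ^+ 2 = be * n' ^+ 2 - ta * n' * m' - de by rewrite /de; ring.
    by rewrite ea eb => ->; ring.
  move=> e; have : m' ^+ 2 \isn't a GRing.unit by apply/(chain_nunitP cR); eexists; exact: e.
  by rewrite unitrX_pos.
(* Since [de] is not a unit, [be = ta e + e^2] modulo [p]; multiplying by [P] keeps exactly the
   information modulo [p]. *)
pose e := m' / n'.
have em' : m' = e * n' by rewrite divrK.
have pP : P * p = 0 by rewrite mulrC (chain_pP cR).
have Pbe : P * be = P * ta * e + P * e * e.
  have : P * (be - ta * e - e ^+ 2) = 0.
    have -> : be - ta * e - e ^+ 2 = de * (n'^-1) ^+ 2.
      have n1 : n' * n'^-1 = 1 by rewrite divrr.
      by rewrite /de /e; ring: n1.
    by rewrite mulrA; have /eqP-> := etrans (chain_PM_eq0 cR de) nde; rewrite mul0r.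
  move=> h; apply/eqP; rewrite -subr_eq0 -h; apply/eqP; ring.
(* Modulo [p] the column [(e, 1)] is a common eigenvector of [x] and [y]. Its eigenvalue for [x] is
   [xi], the other eigenvalue of [x] being [x1 - x3 * e]. *)
pose xi := x1 + x3 * (e + ta) + p ^+ d * n'.
have uxi : xi \is a GRing.unit.
  apply: contraLR (ux) => nxi; rewrite -(chain_PM_eq0 cR) -/P; apply/eqP.
  have Pxi : P * xi = 0 by apply/eqP; rewrite (chain_PM_eq0 cR).
  suff -> : P * (x1 * x4 - x2 * x3) = P * xi * (x1 - x3 * e) by rewrite Pxi mul0r.
  by rewrite ex2 ex4 em' /xi; ring: Pbe.
pose h : gT := gl2 0 1 1 (- e).
have uh : 0 * (- e) - 1 * 1 \is a GRing.unit by rewrite mul0r sub0r mulr1 unitrN unitr1.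
have hV : h^-1%g = gl2 e 1 1 0.
  apply/eqP; rewrite eq_invg_mul gl2M ?uh //; last first.
    by rewrite mulr0 mulr1 sub0r unitrN unitr1.
  by rewrite -gl2_1; apply/eqP; congr gl2; ring.
(* The conjugate of [uu z] by [h] is [1 + z N], where the nilpotent [N] is the column [(e, 1)] times
   the row [(1, - e)]. For [z] killed by [p] the eigenvector property gives [z x N = z xi N]. *)
pose X z := (gl2 x1 x2 x3 x4 * uu z ^ h)%g.
have XE z' : GLval (X (P * z')) =
    mx2 (x1 + P * z' * xi * e) (x2 - P * z' * xi * e * e)
        (x3 + P * z' * xi) (x4 - P * z' * xi * e).
  rewrite /X conjgE hV !GL_MxE !gl2K ?uu_det ?uh //; last first.
    by rewrite mulr0 mulr1 sub0r unitrN unitr1.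
  by rewrite !mx2M ex2 ex4 em' /xi; congr mx2; ring: Pbe.
have X0 : X 0 = gl2 x1 x2 x3 x4.
  have -> : X 0 = X (P * 0) by rewrite mulr0.
  apply: GL2P; rewrite XE gl2K //; congr mx2; ring.
have sumX : \sum_(z | p * z == 0) Psi (X z) y = 0 by apply: PsiS.
clearbody X.
have dich z : p * z = 0 -> Psi (X z) y = Psi (X 0) y \/ Psi (X z) y = 0.
  move=> pz0.
  have [z' ez] : exists z', z = P * z'.
    have := @chain_ann _ _ _ _ cR 1 z (chain_l cR); rewrite expr1 subn1; exact.
  pose r := - (z' * xi / n').
  have rn : z' * xi = - (r * n') by rewrite /r mulNr opprK divrK.
  have XzE : GLval (X z) =
    mx2 (x1 - P * r * n' * e) (x2 + P * r * n' * e * e)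
        (x3 - P * r * n') (x4 + P * r * n' * e).
    rewrite ez XE; congr mx2; ring: rn.
  (* Units [k1 + k2 C] of [R[C]] commute with [y], so conjugating by one of them can move [x] to
     [X z] while fixing [y]. *)
  have conjk (k1 k2 : R) : k1 * (k1 + k2 * ta) - k2 * be * k2 \is a GRing.unit ->
     (let k := mx2 k1 (k2 * be) k2 (k1 + k2 * ta) in
     k *m mx2 x1 x2 x3 x4 = GLval (X z) *m k) -> Psi (X z) y = Psi (X 0) y.
    move=> uk /= hk; pose k : gT := gl2 k1 (k2 * be) k2 (k1 + k2 * ta).
    have e1 : X z = (X 0 ^ k^-1)%g.
      rewrite conjgE invgK X0; apply: (mulIg k); rewrite -!mulgA mulVg mulg1.
      by apply: GL2P; rewrite (GL_MxE (X z)) (GL_MxE k) (gl2K ux) (gl2K uk) hk.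
    have e2 : y = (y ^ k^-1)%g.
      rewrite conjgE invgK; apply: (mulIg k); rewrite -!mulgA mulVg mulg1.
      apply: GL2P; rewrite !GL_MxE ey (gl2K uk) !mx2M; congr mx2; ring.
    by rewrite -(PsiJ k^-1 (X 0) y) -e2 -e1.
  have [dl1|dl1] := ltnP d l.-1.
    have [c ec] : exists c, p ^+ (l.-1 - d) = p * c.
      exists (p ^+ (l.-1 - d).-1); rewrite -exprS prednK // subn_gt0 //.
    have ePd : p ^+ d * p ^+ (l.-1 - d) = P by rewrite -exprD subnKC // ltnW.
    (* The exponent makes the commutator of [k] with the part of [x] outside [R[C]], which is
       divisible by [p ^+ d], a multiple of [P]. *)
    left; apply: (conjk 1 (r * p ^+ (l.-1 - d))).
      have -> : 1 * (1 + r * p ^+ (l.-1 - d) * ta) -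
          r * p ^+ (l.-1 - d) * be * (r * p ^+ (l.-1 - d)) =
         1 + p * (r * c * ta - r * c * be * r * p * c) by rewrite ec; ring.
      by apply: (chain_unitD cR); rewrite unitr1.
    have Pc : P * p ^+ (l.-1 - d) = 0 by rewrite ec mulrA pP mul0r.
    rewrite /= XzE !mx2M ex2 ex4 em'.
    move: (p ^+ d) (p ^+ (l.-1 - d)) ePd Pc => pd pe ePd Pc.
    move: P ePd Pc Pbe => Q <- Qc Qbe {pP}.
    by congr mx2; ring: Qc Qbe.
  have dE : d = l.-1 by apply/eqP; rewrite eqn_leq dl1 andbT -ltnS -(chain_S cR).
  (* For [d = l.-1] the conjugating element is [(1 + r e) + r C], of determinant [1 + r (2 e + ta)]
     modulo [p]. When that fails to be a unit, [X z] itself falls into [R[C]]. *)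
  have [uk|nk] := boolP (1 + r * (2%:R * e + ta) \is a GRing.unit).
    left; apply: (conjk (1 + r * e) r).
      have [a ea] : exists a, be = e * ta + e * e + p * a.
        have : P * (be - (e * ta + e * e)) == 0.
          by apply/eqP; ring: Pbe.
        rewrite (chain_PM_eq0 cR) => /(chain_nunitP cR)[a ea]; exists a.
        by rewrite -ea addrC subrK.
      have -> : (1 + r * e) * (1 + r * e + r * ta) - r * be * r =
         1 + r * (2%:R * e + ta) + p * (- (r * r * a)) by rewrite ea; ring.
      exact: (chain_unitD cR).
    rewrite /= XzE !mx2M ex2 ex4 em' dE -/P.
    by congr mx2; ring: Pbe.
  right; apply: Zgood; rewrite XzE !mx2E ?ex2 ?ex4 ?em' dE -/P.
    have Pk : P * (1 + r * (2%:R * e + ta)) = 0 by apply/eqP; rewrite (chain_PM_eq0 cR).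
    transitivity (P * (1 + r * (2%:R * e + ta)) * (n' * e)); last by rewrite Pk mul0r.
    by ring: Pbe.
  have Pk : P * (1 + r * (2%:R * e + ta)) = 0 by apply/eqP; rewrite (chain_PM_eq0 cR).
  transitivity (P * (1 + r * (2%:R * e + ta)) * n'); last by rewrite Pk mul0r.
  by ring.
(* All nonzero terms equal the one at [z = 0], so the vanishing sum is a positive integer multiple
   of [Psi x y]. *)
move: sumX; rewrite (bigID (fun z => Psi (X z) y == Psi (X 0) y)) /= [X in _ + X]big1 ?addr0; last first.
  by move=> z /andP[/eqP pz0]; case: (dich z pz0) => [->|->]; rewrite ?eqxx.
rewrite (eq_bigr (fun=> Psi (X 0) y)); last by move=> z /andP[_ /eqP].
rewrite sumr_const -scaler_nat => /eqP; rewrite scaler_eq0 pnatr_eq0 => /orP[|/eqP].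
  rewrite eqn0Ngt => /card_gt0P[]; exists 0; rewrite unfold_in mulr0 !eqxx //.
by rewrite X0.
Qed.

(** Up to a scalar matrix, [y] is [s] times a matrix with rows [(e, b')] and [(c', 0)] whose entries
    generate the unit ideal. Such a matrix has a cyclic vector among [(1, 0)], [(0, 1)] and
    [(1, 1)], which conjugates it to companion form. *)
Lemma Psi0 x y : Psi x y = 0.
Proof.
elim/gl2_ind: y => a b c d uy.
have [s [b' [c' [e [eb ec ee u]]]]] := chain_content3 cR b c (a - d).
have main (v1 v2 : R) : v1 * (c' * v1) - v2 * (e * v1 + b' * v2) \is a GRing.unit ->
    Psi x (gl2 a b c d) = 0.
  move=> ug; pose g : gT := gl2 v1 (e * v1 + b' * v2) v2 (c' * v1).
  have ug' : v1 * (c' * v1) - (e * v1 + b' * v2) * v2 \is a GRing.unit.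
    by rewrite [_ * v2]mulrC.
  rewrite -(PsiJ g); apply: (@Psi0_companion _ d s (b' * c') e).
  have ea : a = d + s * e by rewrite -ee addrC subrK.
  suff : GLval (gl2 a b c d * g)%g = GLval g *m mx2 d (s * (b' * c')) s (d + s * e).
    move=> h; rewrite conjgE (GL_MxE g^-1) h mulmxA.
    by rewrite -GL_MxE mulVg GL_1E mul1mx.
  rewrite GL_MxE (gl2K uy) (gl2K ug') !mx2M ea eb ec; congr mx2; ring.
have [uc|nc] := boolP (c' \is a GRing.unit).
  by apply: (main 1 0); rewrite !mulr1 mul1r mul0r subr0.
have [ub|nb] := boolP (b' \is a GRing.unit).
  apply: (main 0 1).
  have -> : 0 * (c' * 0) - 1 * (e * 0 + b' * 1) = - b' by ring.
  by rewrite unitrN.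
move: u; rewrite (negPf nc) (negPf nb) /= => ue.
apply: (main 1 1).
have /(chain_nunitP cR)[c1 ->] := nc; have /(chain_nunitP cR)[b1 ->] := nb.
have -> : 1 * (p * c1 * 1) - 1 * (e * 1 + p * b1 * 1) = - (e + p * (b1 - c1)) by ring.
by rewrite unitrN (chain_unitD cR).
Qed.

End Transpose.

Section UU.
Variables (R : finComUnitRingType).

Lemma uuD (x y : R) : uu (x + y) = (uu x * uu y)%g.
Proof. by rewrite gl2M ?uu_det //; congr gl2; ring. Qed.

Lemma uu0 : uu 0 = 1%g :> {'GL_2[R]}.
Proof. exact: gl2_1. Qed.

Lemma uu_inj : injective (@uu R).
Proof.
move=> x y /(congr1 (fun g : {'GL_2[R]} => GLval g 0 1)).
by rewrite !gl2K ?uu_det // !mx2E.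
Qed.

Definition Yset (p : R) : {set {'GL_2[R]}} := [set uu z | z in [pred z | p * z == 0]].

Lemma Y_group_set p : group_set (Yset p).
Proof.
apply/group_setP; split.
  by apply/imsetP; exists 0; rewrite ?inE ?mulr0 ?uu0.
move=> _ _ /imsetP[x hx ->] /imsetP[y hy ->].
move: hx hy; rewrite !inE => /eqP hx /eqP hy.
by apply/imsetP; exists (x + y); rewrite ?uuD // inE mulrDr hx hy addr0.
Qed.
Definition Ygrp p := Group (Y_group_set p).

Lemma sum_Y (M : nmodType) p (f : {'GL_2[R]} -> M) :
  \sum_(y in Ygrp p) f y = \sum_(z | p * z == 0) f (uu z).
Proof. by rewrite big_imset /=; [apply: eq_bigl => z; rewrite inE | move=> x y _ _ /uu_inj]. Qed.

End UU.

(** The pair is the cube of [G] with its diagonal, acting in the external product of the three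
    characters; the anti-automorphism is [tr] on each factor. Compressed operators depend only on
    pairs up to simultaneous conjugation, and the condition on [chi_i] gives them zero sums over
    conjugates of [Y] in the first factor. *)
Lemma triple_gelfand (gT : finGroupType) (G := [set: gT]%G) (Y : {group gT})
    (tr : gT -> gT) (w : gT) (i j k : Iirr G) :
  involutive tr -> (forall x y, tr (x * y)%g = (tr y * tr x)%g) ->
  {in Y, forall y, tr y = (y ^ w)%g} ->
  (forall n (Psi : gT -> gT -> 'M[algC]_n),
    (forall g x y, Psi (x ^ g)%g (y ^ g)%g = Psi x y) ->
    (forall g x y, (x ^ g)%g = tr x -> (y ^ g)%g = tr y -> Psi x y = 0) ->
    (forall h x y, \sum_(z in Y) Psi (x * z ^ h)%g y = 0) ->
    forall x y, Psi x y = 0) ->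
  \sum_(z in Y) 'chi_i z = 0 -> '['chi_i * 'chi_j * 'chi_k, 1] <= 1.
Proof.
move=> trK trM trY Psi0P sY0.
have tr1 : tr 1%g = 1%g by apply: (mulgI (tr 1%g)); rewrite -trM !mulg1.
have trV x : tr x^-1%g = (tr x)^-1%g.
  by apply/eqP; rewrite eq_sym eq_invg_mul -trM mulVg tr1.
have inG x : x \in G by rewrite inE.
have [m2 m2E] := irr_setX j k.
have [m mE] := irr_setX i m2.
have {}mE x y z : 'chi_m (x, (y, z)) = 'chi_i x * 'chi_j y * 'chi_k z.
  by rewrite mE ?m2E ?mulrA // inE !inG.
clear m2E.
pose dg (x : gT) := (x, (x, x)).
have dgM x y : dg (x * y)%g = (dg x * dg y)%g by [].
have dgI : injective dg by move=> x y [].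
have dG : group_set (dg @: [set: gT]).
  apply/group_setP; split; first by apply/imsetP; exists 1%g; rewrite ?inE.
  move=> _ _ /imsetP[x _ ->] /imsetP[y _ ->].
  by apply/imsetP; exists (x * y)%g; rewrite ?inE.
pose H := Group dG; pose Ga := setX_group G (setX_group G G).
have inGa x : x \in Ga by rewrite !inE.
have inH x : dg x \in H by apply/imsetP; exists x.
have -> : '['chi_i * 'chi_j * 'chi_k, 1] = '['Res[H] 'chi_m, 1].
  rewrite !cfdotE card_imset // cardsT; congr (_ * _).
  rewrite big_imset /=; last by move=> x y _ _ /dgI.
  apply: eq_big => [x|x _]; first by rewrite !inE.
  rewrite cfResE ?inH //; last by apply/subsetP=> u _.
  have e1 : (1 : 'CF(H)) (dg x) = 1 by rewrite cfun1E (inH x).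
  by rewrite e1 cfun1E inG mE !cfunE.
pose sg (u : gT * (gT * gT)) := (tr u.1, (tr u.2.1, tr u.2.2)).
have sgK : involutive sg by case=> x [y z]; rewrite /sg /= !trK.
have sHGa : H \subset Ga by apply/subsetP=> u _; apply: inGa.
have sgGa : {in Ga, forall x, sg x \in Ga} by move=> x _; apply: inGa.
have sgM : {in Ga &, forall x y, sg (x * y)%g = (sg y * sg x)%g}.
  by case=> x [y z] [x' [y' z']] _ _; rewrite /sg /= !trM.
have sgH : {in H, forall h, sg h \in H}.
  by move=> _ /imsetP[x _ ->]; apply: (inH (tr x)).
have sgI : {in H &, injective sg} by move=> x y _ _; apply: (can_inj sgK).
apply: (gelfand_trick sHGa sgGa sgM sgH sgI).
have zero g : \sum_(z in Y) 'Chi_m ((z ^ g)%g, (1%g, 1%g)) = 0.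
  pose f (x : gT) : gT * (gT * gT) := ((x ^ g)%g, (1%g, 1%g)).
  have fM : {morph f : x y / (x * y)%g}.
    by move=> x y; rewrite /f conjMg; congr (_, (_, _)); rewrite mulg1.
  have fI : injective f by move=> x y [/conjg_inj].
  have fG : group_set (f @: Y).
    apply/group_setP; split.
      by apply/imsetP; exists 1%g; rewrite ?group1 // /f conj1g.
    move=> _ _ /imsetP[x Yx ->] /imsetP[y Yy ->].
    by apply/imsetP; exists (x * y)%g; rewrite ?groupM.
  have /= := @sum_repr_eq0 _ Ga (Group fG) _ 'Chi_m.
  rewrite !big_imset /=; try by move=> x y _ _ /fI.
  apply; first by apply/subsetP.
  rewrite irrRepr (eq_bigr (fun z => 'chi_i (z) * ('chi_j 1%g * 'chi_k 1%g))).
    by rewrite -mulr_suml sY0 mul0r.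
  by move=> z _; rewrite mE cfunJ // mulrA.
(* From here on only multiplicativity and the vanishing sums over conjugates of [Y] matter. *)
suff main n (rho : gT * (gT * gT) -> 'M[algC]_n) (E := \sum_(h in H) rho h) :
    (forall x y, rho (x * y)%g = rho x *m rho y) ->
    (forall g, \sum_(z in Y) rho ((z ^ g)%g, (1%g, 1%g)) = 0) ->
    forall u, E *m rho u *m E = E *m rho (sg u) *m E.
  by move=> u _; apply: main => // x y; rewrite repr_mxM.
move=> rM {}zero.
have Er x : E *m rho (dg x) = E.
  have Hx := inH x.
  rewrite /E mulmx_suml [RHS](reindex_inj (mulIg (dg x))).
  by apply: eq_big => [h|h _]; rewrite ?groupMr ?rM.
have El x : rho (dg x) *m E = E.
  have Hx := inH x.
  rewrite /E mulmx_sumr [RHS](reindex_inj (mulgI (dg x))).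
  by apply: eq_big => [h|h _]; rewrite ?groupMl ?rM.
have lr x u y : E *m rho (dg x * u * dg y)%g *m E = E *m rho u *m E.
  rewrite (rM (dg x * u)%g) (rM (dg x)) !mulmxA.
  by rewrite Er -(mulmxA _ (rho (dg y))) El.
clearbody E.
pose Phi x y := E *m rho (x, (y, 1%g)) *m E.
have PhiJ g x y : Phi (x ^ g)%g (y ^ g)%g = Phi x y.
  rewrite /Phi -(lr g^-1%g (x, (y, 1%g)) g) !conjgE.
  by congr (_ *m rho _ *m _); congr (_, (_, _)); rewrite /= ?mulgA ?mulg1 ?mulVg.
have PhiS1 h x y : \sum_(z in Y) Phi (x * z ^ h)%g y = 0.
  rewrite (eq_bigr (fun z => E *m rho (x, (y, 1%g)) *m
     rho ((z ^ h)%g, (1%g, 1%g)) *m E)).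
    by rewrite -mulmx_suml -mulmx_sumr zero mulmx0 mul0mx.
  move=> z _; rewrite /Phi -[E *m _ *m rho (_, _)]mulmxA -rM; congr (_ *m rho _ *m _).
  by congr (_, (_, _)); rewrite mulg1.
(* Transposition turns the right translate into a left one; [tr y = y ^ w] shows that it is still a
   translate by a conjugate of [Y]. *)
have PhiS2 h x y : \sum_(z in Y) Phi (tr (x * z ^ h)%g) (tr y) = 0.
  rewrite (eq_bigr (fun z => E *m (rho ((z ^ (w * tr h^-1))%g, (1%g, 1%g)) *m
     rho (tr x, (tr y, 1%g))) *m E)).
    by rewrite -mulmx_suml -mulmx_sumr -mulmx_suml zero mul0mx mulmx0 mul0mx.
  move=> z Yz; rewrite /Phi -rM; congr (_ *m rho _ *m _).
  congr (_, (_, _)); rewrite ?mul1g // trM; congr (_ * _)%g.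
  rewrite conjgM -trY // !conjgE !trM !trV invgK mulgA //.
have Psi0 := Psi0P _ (fun x y => Phi x y - Phi (tr x) (tr y)).
have PhiT x y : Phi x y = Phi (tr x) (tr y).
  apply/eqP; rewrite -subr_eq0; apply/eqP; apply: Psi0.
  - move=> g a b; rewrite PhiJ.
    have e c : tr (c ^ g)%g = (tr c ^ tr g^-1)%g.
      by rewrite !conjgE !trM !trV invgK mulgA.
    by rewrite !e PhiJ.
  - by move=> g a b <- <-; rewrite PhiJ subrr.
  - by move=> h a b; rewrite sumrB PhiS1 PhiS2 subrr.
case=> x [y z].
(* Diagonal factors are absorbed by [E] on either side: a triple is normalised to last component [1]
   from the left, its transpose from the right. *)
have e u1 u2 u3 : (u1, (u2, u3)) = (dg u3 * (u3^-1 * u1, (u3^-1 * u2, 1)) * dg 1)%g.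
  by congr (_, (_, _)); rewrite /= ?mulg1 ?mulKVg.
have e' u1 u2 u3 : (u1, (u2, u3)) = (dg 1 * (u1 * u3^-1, (u2 * u3^-1, 1)) * dg u3)%g.
  by congr (_, (_, _)); rewrite /= ?mul1g ?mulgKV.
transitivity (Phi (z^-1 * x)%g (z^-1 * y)%g); first by rewrite /Phi {1}e lr.
by rewrite PhiT /Phi /sg /= (e' (tr x)) lr !trM !trV.
Qed.

Section Triple.
Variables (R : finComUnitRingType) (p : R) (l q : nat).
Hypothesis cR : chain_ring p l q.

Theorem triple_mult_le1 (i j k : Iirr ('GL_2[R]%G)) :
  \sum_(z | p * z == 0) 'chi_i (uu z) = 0 -> '['chi_i * 'chi_j * 'chi_k, 1] <= 1.
Proof.
rewrite -sum_Y; apply: (@triple_gelfand _ (Ygrp p) (@trg R) (ww R)).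
- exact: trgK.
- exact: trgM.
- by move=> _ /imsetP[z _ ->]; apply: trg_uu.
move=> n Psi PsiJ PsiT PsiS x y; refine (@Psi0 R p l q cR _ Psi _ _ _ x y).
- by move=> g a b; have := PsiJ g a b.
- by move=> g a b; have := PsiT g a b.
- by move=> h a b; have := PsiS h a b; rewrite sum_Y.
Qed.

End Triple.

(** * Subgroups of GL_2 *)

(* The arguments below only use the entries of the elements of GL_2(R); keeping
   the group abstract prevents conversion from unfolding the matrices. *)
Record gl2_setting := Gl2Setting {
  sR : finComUnitRingType;
  sp : sR;
  sl : nat;
  sq : nat;
  s_chain : chain_ring sp sl sq;
  sT : finGroupType;
  gl : sR -> sR -> sR -> sR -> sT;
  ea : sT -> sR; eb : sT -> sR; ec : sT -> sR; ed : sT -> sR;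
  s_unit : forall g, ea g * ed g - eb g * ec g \is a GRing.unit;
  s_eta : forall g, g = gl (ea g) (eb g) (ec g) (ed g);
  s_ent : forall a b c d, a * d - b * c \is a GRing.unit ->
    [/\ ea (gl a b c d) = a, eb (gl a b c d) = b,
        ec (gl a b c d) = c & ed (gl a b c d) = d];
  s_mul : forall g h : sT, [/\ ea (g * h)%g = ea g * ea h + eb g * ec h,
     eb (g * h)%g = ea g * eb h + eb g * ed h,
     ec (g * h)%g = ec g * ea h + ed g * ec h &
     ed (g * h)%g = ec g * eb h + ed g * ed h];
  s_one : gl 1 0 0 1 = 1%g;
  spsi : sR -> algC;
  s_psi : is_add_char spsi;
  s_psiP : exists x, spsi (sp ^+ sl.-1 * x) != 1;
  s_gelfand : forall i j k : Iirr [set: sT]%G,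
    \sum_(z | sp * z == 0) 'chi_i (gl 1 z 0 1) = 0 ->
    '['chi_i * 'chi_j * 'chi_k, 1] <= 1 }.

Section Subgroups.
Variable S : gl2_setting.
Local Notation R := (sR S).
Local Notation p := (@sp S).
Local Notation gT := (sT S).
Local Notation cR := (s_chain S).
Implicit Types (g h : gT) (x y z : R).

Lemma eaM g h : ea (g * h)%g = ea g * ea h + eb g * ec h.
Proof. by case: (s_mul g h). Qed.
Lemma ebM g h : eb (g * h)%g = ea g * eb h + eb g * ed h.
Proof. by case: (s_mul g h). Qed.
Lemma ecM g h : ec (g * h)%g = ec g * ea h + ed g * ec h.
Proof. by case: (s_mul g h). Qed.
Lemma edM g h : ed (g * h)%g = ec g * eb h + ed g * ed h.
Proof. by case: (s_mul g h). Qed.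
Definition entM := (eaM, ebM, ecM, edM).

Lemma ea_gl a b c d : a * d - b * c \is a GRing.unit -> ea (@gl S a b c d) = a.
Proof. by case/s_ent. Qed.
Lemma eb_gl a b c d : a * d - b * c \is a GRing.unit -> eb (@gl S a b c d) = b.
Proof. by case/s_ent. Qed.
Lemma ec_gl a b c d : a * d - b * c \is a GRing.unit -> ec (@gl S a b c d) = c.
Proof. by case/s_ent. Qed.
Lemma ed_gl a b c d : a * d - b * c \is a GRing.unit -> ed (@gl S a b c d) = d.
Proof. by case/s_ent. Qed.

Lemma entP g h : ea g = ea h -> eb g = eb h -> ec g = ec h -> ed g = ed h -> g = h.
Proof. by move=> ha hb hc hd; rewrite (s_eta g) (s_eta h) ha hb hc hd. Qed.

Lemma det1 : 1 * 1 - 0 * 0 \is a @GRing.unit R.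
Proof. by rewrite mulr1 mulr0 subr0 unitr1. Qed.

Lemma ea1 : ea (1%g : gT) = 1. Proof. by rewrite -s_one ea_gl ?det1. Qed.
Lemma eb1 : eb (1%g : gT) = 0. Proof. by rewrite -s_one eb_gl ?det1. Qed.
Lemma ec1 : ec (1%g : gT) = 0. Proof. by rewrite -s_one ec_gl ?det1. Qed.
Lemma ed1 : ed (1%g : gT) = 1. Proof. by rewrite -s_one ed_gl ?det1. Qed.
Definition ent1 := (ea1, eb1, ec1, ed1).

Definition u x : gT := gl 1 x 0 1.
Definition v x : gT := gl 1 0 x 1.
Definition t x y : gT := gl x 0 0 y.
Definition w : gT := gl 0 1 1 0.

Lemma ud x : 1 * 1 - x * 0 \is a GRing.unit.
Proof. by rewrite mulr1 mulr0 subr0 unitr1. Qed.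
Lemma vd x : 1 * 1 - 0 * x \is a GRing.unit.
Proof. by rewrite mulr1 mul0r subr0 unitr1. Qed.
Lemma td x y : x \is a GRing.unit -> y \is a GRing.unit -> x * y - 0 * 0 \is a GRing.unit.
Proof. by move=> ux uy; rewrite mulr0 subr0 unitrM ux uy. Qed.
Lemma wd : 0 * 0 - 1 * 1 \is a @GRing.unit R.
Proof. by rewrite mulr0 mulr1 sub0r unitrN unitr1. Qed.

Lemma ent_u x : [/\ ea (u x) = 1, eb (u x) = x, ec (u x) = 0 & ed (u x) = 1].
Proof. exact: (s_ent (ud x)). Qed.
Lemma ent_v x : [/\ ea (v x) = 1, eb (v x) = 0, ec (v x) = x & ed (v x) = 1].
Proof. exact: (s_ent (vd x)). Qed.
Lemma ent_t x y : x \is a GRing.unit -> y \is a GRing.unit ->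
  [/\ ea (t x y) = x, eb (t x y) = 0, ec (t x y) = 0 & ed (t x y) = y].
Proof. by move=> ux uy; apply: (s_ent (td ux uy)). Qed.
Lemma ent_w : [/\ ea w = 0, eb w = 1, ec w = 1 & ed w = 0].
Proof. exact: (s_ent wd). Qed.

Lemma uD x y : u (x + y) = (u x * u y)%g.
Proof.
have [a1 b1 c1 d1] := ent_u x; have [a2 b2 c2 d2] := ent_u y.
have [a3 b3 c3 d3] := ent_u (x + y).
by apply: entP; rewrite !entM ?a1 ?a2 ?a3 ?b1 ?b2 ?b3 ?c1 ?c2 ?c3 ?d1 ?d2 ?d3; ring.
Qed.

Lemma vD x y : v (x + y) = (v x * v y)%g.
Proof.
have [a1 b1 c1 d1] := ent_v x; have [a2 b2 c2 d2] := ent_v y.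
have [a3 b3 c3 d3] := ent_v (x + y).
by apply: entP; rewrite !entM ?a1 ?a2 ?a3 ?b1 ?b2 ?b3 ?c1 ?c2 ?c3 ?d1 ?d2 ?d3; ring.
Qed.

Lemma u0 : u 0 = 1%g. Proof. exact: s_one. Qed.
Lemma v0 : v 0 = 1%g. Proof. exact: s_one. Qed.

Lemma uN x : u (- x) = (u x)^-1%g.
Proof. by apply/eqP; rewrite eq_sym eq_invg_mul -uD subrr u0. Qed.
Lemma vN x : v (- x) = (v x)^-1%g.
Proof. by apply/eqP; rewrite eq_sym eq_invg_mul -vD subrr v0. Qed.

Local Notation nunit x := (x \isn't a GRing.unit).

Lemma nunitM x y : nunit x -> nunit (x * y).
Proof. by rewrite unitrM => /negPf->. Qed.
Lemma nunitD x y : nunit x -> nunit y -> nunit (x + y).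
Proof.
move=> /(chain_nunitP cR)[a ->] /(chain_nunitP cR)[b ->].
by rewrite -mulrDr (chain_pM_nunit cR).
Qed.
Lemma nunit0 : nunit (0 : R). Proof. by rewrite unitr0. Qed.
Lemma unitD x y : x \is a GRing.unit -> nunit y -> x + y \is a GRing.unit.
Proof. by move=> ux /(chain_nunitP cR)[a ->]; apply: (chain_unitD cR). Qed.
Lemma ann_nunit x y : p * x = 0 -> nunit y -> y * x = 0.
Proof. by move=> px /(chain_nunitP cR)[a ->]; rewrite mulrAC px mul0r. Qed.
Lemma annM x y : p * x = 0 -> p * (x * y) = 0.
Proof. by move=> px; rewrite mulrA px mul0r. Qed.
Lemma annD x y : p * x = 0 -> p * y = 0 -> p * (x + y) = 0.
Proof. by move=> px py; rewrite mulrDr px py addr0. Qed.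

Lemma annMr x y : p * y = 0 -> p * (x * y) = 0.
Proof. by move=> py; rewrite mulrCA py mulr0. Qed.
Ltac ann := repeat (by [] || apply: annD || (by apply: annM) || (by apply: annMr)).

Definition Bset : {set gT} := [set g | ec g == 0].
Lemma B_group_set : group_set Bset.
Proof.
apply/group_setP; split=> [|g h]; rewrite !inE ?ec1 // entM => /eqP-> /eqP->.
by rewrite mul0r mulr0 addr0.
Qed.
Definition Bgrp := Group B_group_set.

Definition Iset : {set gT} := [set g | nunit (ec g)].
Lemma I_group_set : group_set Iset.
Proof.
apply/group_setP; split=> [|g h]; rewrite !inE ?ec1 ?nunit0 // entM => hg hh.
by apply: nunitD; [apply: nunitM | rewrite mulrC; apply: nunitM].
Qed.
Definition Igrp := Group I_group_set.

Definition Qset : {set gT} := [set g | (eb g == 0) && nunit (ec g)].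
Lemma Q_group_set : group_set Qset.
Proof.
apply/group_setP; split=> [|g h]; rewrite !inE ?eb1 ?ec1 ?nunit0 ?eqxx // !entM.
move=> /andP[/eqP-> hg] /andP[/eqP-> hh]; rewrite mulr0 mul0r addr0 eqxx.
by apply: nunitD; [apply: nunitM | rewrite mulrC; apply: nunitM].
Qed.
Definition Qgrp := Group Q_group_set.

Definition Uset : {set gT} := [set g | [&& ea g == 1, ec g == 0 & ed g == 1]].
Lemma U_group_set : group_set Uset.
Proof.
apply/group_setP; split=> [|g h]; rewrite !inE ?ent1 ?eqxx // !entM.
move=> /and3P[/eqP-> /eqP-> /eqP->] /and3P[/eqP-> /eqP-> /eqP->].
by rewrite !mulr0 !mul0r !mulr1 !addr0 !add0r !eqxx.
Qed.
Definition Ugrp := Group U_group_set.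

Definition YYset : {set gT} :=
  [set g | [&& ea g == 1, ec g == 0, ed g == 1 & p * eb g == 0]].
Lemma YY_group_set : group_set YYset.
Proof.
apply/group_setP; split=> [|g h]; rewrite !inE ?ent1 ?mulr0 ?eqxx // !entM.
move=> /and4P[/eqP-> /eqP-> /eqP-> /eqP pg] /and4P[/eqP-> /eqP-> /eqP-> /eqP ph].
by rewrite !mulr0 !mul0r !mulr1 !addr0 !add0r mul1r mulrDr pg ph addr0 !eqxx.
Qed.
Definition Yg := Group YY_group_set.

Definition Vset : {set gT} :=
  [set g | [&& ea g == 1, eb g == 0, ed g == 1 & nunit (ec g)]].
Lemma V_group_set : group_set Vset.
Proof.
apply/group_setP; split=> [|g h]; rewrite !inE ?ent1 ?nunit0 ?eqxx // !entM.
move=> /and4P[/eqP-> /eqP-> /eqP-> hg] /and4P[/eqP-> /eqP-> /eqP-> hh].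
by rewrite !mulr0 !mul0r !mulr1 !addr0 !add0r !eqxx mul1r nunitD.
Qed.
Definition Vgrp := Group V_group_set.

Definition Dset : {set gT} :=
  [set g | [&& eb g == 0, ec g == 0, ea g * ed g == 1 & p * (ea g - 1) == 0]].
Lemma D_group_set : group_set Dset.
Proof.
apply/group_setP; split=> [|g h]; rewrite !inE ?ent1 ?mulr1 ?subrr ?mulr0 ?eqxx // !entM.
move=> /and4P[/eqP-> /eqP-> /eqP dg /eqP pg] /and4P[/eqP-> /eqP-> /eqP dh /eqP ph].
rewrite !mulr0 !mul0r !addr0 !add0r eqxx /=; apply/andP; split; apply/eqP.
  by rewrite mulrACA dg dh mulr1.
have -> : ea g * ea h - 1 = (ea g - 1) * ea h + (ea h - 1) by ring.
by ann.
Qed.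
Definition Dgrp := Group D_group_set.

(** The elements of determinant one congruent to the identity modulo the annihilator of [p]. This is
    the normal closure of [Y], and it is all of [SL_2(R)] when [l = 1]. *)
Definition Kset : {set gT} :=
  [set g | [&& ea g * ed g - eb g * ec g == 1, p * (ea g - 1) == 0, p * eb g == 0,
     p * ec g == 0 & p * (ed g - 1) == 0]].
Lemma K_group_set : group_set Kset.
Proof.
apply/group_setP; split=> [|g h]; rewrite !inE ?ent1 ?mulr1 ?subrr ?mulr0 ?subr0 ?eqxx // !entM.
move=> /and5P[/eqP dg /eqP ag /eqP bg /eqP cg /eqP ddg].
move=> /and5P[/eqP dh /eqP ah /eqP bh /eqP ch /eqP ddh].
apply/and5P; split; apply/eqP.
- rewrite -[RHS]mulr1 -{1}dg -dh; ring.
- have -> : ea g * ea h + eb g * ec h - 1 = (ea g - 1) * ea h + (ea h - 1) + eb g * ec h by ring.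
  by ann.
- by ann.
- by ann.
- have -> : ec g * eb h + ed g * ed h - 1 = ec g * eb h + ((ed g - 1) * ed h + (ed h - 1)) by ring.
  by ann.
Qed.
Definition Kgrp := Group K_group_set.

(** Upper triangular matrices congruent to the identity modulo the annihilator of [p]. They act by
    scalars in characters induced from [B] to the Iwahori subgroup, which is how such characters get
    separated. *)
Definition Mset : {set gT} :=
  [set g | [&& ec g == 0, p * eb g == 0, p * (ea g - 1) == 0 & p * (ed g - 1) == 0]].
Lemma M_group_set : group_set Mset.
Proof.
apply/group_setP; split=> [|g h]; rewrite !inE ?ent1 ?subrr ?mulr0 ?eqxx // !entM.
move=> /and4P[/eqP-> /eqP bg /eqP ag /eqP dg] /and4P[/eqP-> /eqP bh /eqP ah /eqP dh].
apply/and4P; split; apply/eqP.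
- by ring.
- by ann.
- have -> : ea g * ea h + eb g * 0 - 1 = (ea g - 1) * ea h + (ea h - 1) by ring.
  by ann.
- have -> : 0 * eb h + ed g * ed h - 1 = (ed g - 1) * ed h + (ed h - 1) by ring.
  by ann.
Qed.
Definition Mgrp := Group M_group_set.

Lemma inB g : (g \in Bgrp) = (ec g == 0). Proof. by rewrite inE. Qed.
Lemma inI g : (g \in Igrp) = nunit (ec g). Proof. by rewrite inE. Qed.
Lemma inQ g : (g \in Qgrp) = (eb g == 0) && nunit (ec g). Proof. by rewrite inE. Qed.
Lemma inU g : (g \in Ugrp) = [&& ea g == 1, ec g == 0 & ed g == 1]. Proof. by rewrite inE. Qed.
Lemma inY g : (g \in Yg) = [&& ea g == 1, ec g == 0, ed g == 1 & p * eb g == 0].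
Proof. by rewrite inE. Qed.
Lemma inV g : (g \in Vgrp) = [&& ea g == 1, eb g == 0, ed g == 1 & nunit (ec g)].
Proof. by rewrite inE. Qed.
Lemma inD g : (g \in Dgrp) = [&& eb g == 0, ec g == 0, ea g * ed g == 1 & p * (ea g - 1) == 0].
Proof. by rewrite inE. Qed.
Lemma inK g : (g \in Kgrp) = [&& ea g * ed g - eb g * ec g == 1, p * (ea g - 1) == 0,
   p * eb g == 0, p * ec g == 0 & p * (ed g - 1) == 0].
Proof. by rewrite inE. Qed.
Lemma inM g : (g \in Mgrp) = [&& ec g == 0, p * eb g == 0, p * (ea g - 1) == 0 & p * (ed g - 1) == 0].
Proof. by rewrite inE. Qed.

Lemma UP g : reflect (exists x, g = u x) (g \in Ugrp).
Proof.
apply: (iffP idP) => [|[x ->]]; rewrite inU; last first.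
  by case: (ent_u x) => -> _ -> ->; rewrite !eqxx.
move=> /and3P[/eqP ha /eqP hc /eqP hd]; exists (eb g).
by have [a b c d] := ent_u (eb g); apply: entP; rewrite ?a ?b ?c ?d.
Qed.

Lemma YP g : reflect (exists2 x, p * x = 0 & g = u x) (g \in Yg).
Proof.
apply: (iffP idP) => [|[x px ->]]; rewrite inY; last first.
  by case: (ent_u x) => -> -> -> ->; rewrite px !eqxx.
move=> /and4P[/eqP ha /eqP hc /eqP hd /eqP pb]; exists (eb g) => //.
by have [a b c d] := ent_u (eb g); apply: entP; rewrite ?a ?b ?c ?d.
Qed.

Lemma VP g : reflect (exists2 x, nunit x & g = v x) (g \in Vgrp).
Proof.
apply: (iffP idP) => [|[x px ->]]; rewrite inV; last first.
  by case: (ent_v x) => -> -> -> ->; rewrite px !eqxx.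
move=> /and4P[/eqP ha /eqP hb /eqP hd pc]; exists (ec g) => //.
by have [a b c d] := ent_v (ec g); apply: entP; rewrite ?a ?b ?c ?d.
Qed.

Lemma inYu x : (u x \in Yg) = (p * x == 0).
Proof. by rewrite inY; case: (ent_u x) => -> -> -> ->; rewrite !eqxx. Qed.

Lemma BunitP g : g \in Bgrp -> ea g \is a GRing.unit /\ ed g \is a GRing.unit.
Proof.
rewrite inB => /eqP c0; have := s_unit g.
by rewrite c0 mulr0 subr0 unitrM => /andP[].
Qed.

Lemma IunitP g : g \in Igrp -> ea g \is a GRing.unit /\ ed g \is a GRing.unit.
Proof.
rewrite inI => nc; have := unitD (s_unit g) (nunitM (eb g) nc).
by rewrite [ec g * _]mulrC subrK unitrM => /andP[].
Qed.

Lemma sBI : Bgrp \subset Igrp.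
Proof. by apply/subsetP=> g; rewrite inB inI => /eqP->; rewrite nunit0. Qed.
Lemma sQI : Qgrp \subset Igrp.
Proof. by apply/subsetP=> g; rewrite inQ inI => /andP[]. Qed.
Lemma sUB : Ugrp \subset Bgrp.
Proof. by apply/subsetP=> g; rewrite inU inB => /and3P[]. Qed.
Lemma sYU : Yg \subset Ugrp.
Proof. by apply/subsetP=> g; rewrite inU inY => /and4P[-> -> ->]. Qed.
Lemma sVQ : Vgrp \subset Qgrp.
Proof. by apply/subsetP=> g; rewrite inV inQ => /and4P[_ -> _ ->]. Qed.
Lemma sDB : Dgrp \subset Bgrp.
Proof. by apply/subsetP=> g; rewrite inD inB => /and4P[]. Qed.
Lemma sMB : Mgrp \subset Bgrp.
Proof. by apply/subsetP=> g; rewrite inM inB => /and4P[]. Qed.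
Lemma sYM : Yg \subset Mgrp.
Proof.
apply/subsetP=> g; rewrite inM inY => /and4P[/eqP-> -> /eqP-> ->].
by rewrite subrr mulr0 eqxx.
Qed.
Lemma sYK : Yg \subset Kgrp.
Proof.
apply/subsetP=> g; rewrite inK inY => /and4P[/eqP-> /eqP-> /eqP-> ->].
by rewrite subrr !mulr0 mulr1 subr0 !eqxx.
Qed.
Lemma sDK : Dgrp \subset Kgrp.
Proof.
apply/subsetP=> g; rewrite inK inD => /and4P[/eqP-> /eqP-> /eqP e1 /eqP e2].
rewrite !mulr0 subr0 e1 e2 !eqxx /=.
have -> : ed g - 1 = (ea g - 1) * (- ed g).
  by rewrite mulrN mulrBl mul1r e1 opprB.
by rewrite annM.
Qed.

Lemma normal_of_conj (L N : {group gT}) : N \subset L ->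
  (forall g h, g \in L -> h \in N -> exists2 h', h' \in N & (h * g = g * h')%g) ->
  (N <| L)%g.
Proof.
move=> sNL H; rewrite /normal sNL; apply/subsetP=> g Lg; rewrite inE.
apply/subsetP=> _ /imsetP[h Nh ->].
have [h' Nh' e] := H g h Lg Nh.
by rewrite conjgE e mulKg.
Qed.

Lemma nUB : (Ugrp <| Bgrp)%g.
Proof.
apply: normal_of_conj sUB _ => g h Bg /UP[x ->].
have [ua ud'] := BunitP Bg; move: Bg; rewrite inB => /eqP c0.
exists (u (x * ed g / ea g)); first by apply/UP; eexists.
have [a1 b1 c1 d1] := ent_u x; have [a2 b2 c2 d2] := ent_u (x * ed g / ea g).
have e : ea g * (x * ed g / ea g) = x * ed g by rewrite mulrC divrK.
by apply: entP; rewrite !entM ?c0 ?a1 ?a2 ?b1 ?b2 ?c1 ?c2 ?d1 ?d2 ?e; ring.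
Qed.

(** The lower left entry of an element of the Iwahori subgroup is not a unit, so it kills every [x]
    with [p * x = 0]. *)
Lemma nYI : (Yg <| Igrp)%g.
Proof.
apply: normal_of_conj (subset_trans sYU (subset_trans sUB sBI)) _ => g h Ig /YP[x px ->].
have [ua ud'] := IunitP Ig; move: Ig; rewrite inI => nc.
exists (u (x * ed g / ea g)); first by apply/YP; exists (x * ed g / ea g); rewrite // -!mulrA annM.
have [a1 b1 c1 d1] := ent_u x; have [a2 b2 c2 d2] := ent_u (x * ed g / ea g).
have e : ea g * (x * ed g / ea g) = x * ed g by rewrite mulrC divrK.
have cx : ec g * x = 0 by apply: ann_nunit.
have cx2 : x * ec g = 0 by rewrite mulrC.
have cx3 : ec g * (x * ed g / ea g) = 0 by rewrite -!mulrA mulrA cx mul0r.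
by apply: entP; rewrite !entM ?a1 ?a2 ?b1 ?b2 ?c1 ?c2 ?d1 ?d2 ?e ?cx2 ?cx3; ring.
Qed.

Lemma nYB : (Yg <| Bgrp)%g.
Proof. by apply: normalS sBI nYI; apply: subset_trans sYU sUB. Qed.

End Subgroups.

(** * Weights of the upper and lower unipotent subgroups *)

Section Weights.
Variable S : gl2_setting.
Local Notation R := (sR S).
Local Notation p := (@sp S).
Local Notation l := (sl S).
Local Notation q := (sq S).
Local Notation gT := (sT S).
Local Notation cR := (s_chain S).
Local Notation psi := (@spsi S).
Local Notation nunit x := (x \isn't a GRing.unit).
Local Notation B := (Bgrp S).
Local Notation Q := (Qgrp S).
Local Notation U := (Ugrp S).
Local Notation Y := (Yg S).
Local Notation V := (Vgrp S).
Implicit Types (g h : gT) (x y z : R).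

Lemma q_gt0 : (0 < q)%N. Proof. by rewrite ltnW ?(chain_q cR). Qed.
Lemma q_neq0 : q%:R != 0 :> algC. Proof. by rewrite pnatr_eq0 -lt0n q_gt0. Qed.
Lemma qX_neq0 n : (q ^ n)%:R != 0 :> algC.
Proof. by rewrite pnatr_eq0 -lt0n expn_gt0 q_gt0. Qed.
Lemma q_ge3 : (2 < q)%N.
Proof. by case: q (chain_q cR) (chain_odd cR) => [|[|[|]]]. Qed.
Lemma qlS : (q ^ l = q * q ^ l.-1)%N.
Proof. by rewrite -expnS -(chain_S cR). Qed.

Lemma sum_Y0 (W : nmodType) (f : gT -> W) :
  \sum_(y in Y) f y = \sum_(z | p * z == 0) f (u z).
Proof.
rewrite (reindex_onto (@u S) (@eb S)) /=.
  apply: eq_bigl => z; rewrite inYu; case: (ent_u z) => _ -> _ _.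
  by rewrite eqxx andbT.
by move=> g /YP[x _ ->]; case: (ent_u x) => _ -> _ _.
Qed.

Lemma sum_U0 (W : nmodType) (f : gT -> W) : \sum_(y in U) f y = \sum_z f (u z).
Proof.
rewrite (reindex_onto (@u S) (@eb S)) /=.
  apply: eq_bigl => z; case: (ent_u z) => _ -> _ _; rewrite eqxx andbT.
  by apply/UP; exists z.
by move=> g /UP[x ->]; case: (ent_u x) => _ -> _ _.
Qed.

Lemma sum_V0 (W : nmodType) (f : gT -> W) :
  \sum_(y in V) f y = \sum_(x | nunit x) f (v x).
Proof.
rewrite (reindex_onto (@v S) (@ec S)) /=.
  apply: eq_bigl => z; case: (ent_v z) => ha hb hc hd; rewrite hc eqxx andbT.
  by rewrite inV ha hb hc hd !eqxx.
by move=> g /VP[x _ ->]; case: (ent_v x) => _ _ -> _.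
Qed.

Lemma nunitE x : nunit x = (x \in [set p ^+ 1 * y | y : R]).
Proof.
apply/(chain_nunitP cR)/imsetP => [[y ->]|[y _ ->]]; exists y; by rewrite ?expr1.
Qed.

Lemma cardY : #|Y| = q.
Proof.
have l1 : (l - l.-1 = 1)%N by rewrite {1}(chain_S cR) subSnn.
have := chain_card cR (leq_pred l); rewrite l1 expn1 => <-.
rewrite -sum1_card sum_Y0 -sum1_card; apply: eq_bigl => z.
apply/eqP/imsetP=> [e|[y _ ->]]; last by rewrite mulrA (chain_pP cR) mul0r.
have := @chain_ann _ _ _ _ cR 1 z (chain_l cR); rewrite expr1 e subn1 => /(_ erefl)[y ->].
by exists y.
Qed.

Lemma cardU : #|U| = (q ^ l)%N.
Proof. by rewrite -sum1_card sum_U0 sum1_card (chain_card_R cR). Qed.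

Lemma cardV : #|V| = (q ^ l.-1)%N.
Proof. by rewrite -sum1_card sum_V0 sum1_card (chain_card_nunit cR). Qed.

Lemma t_inB a d : a \is a GRing.unit -> d \is a GRing.unit -> t a d \in B.
Proof. by move=> ua ud'; rewrite inB; case: (ent_t ua ud') => _ _ -> _. Qed.

Lemma t_inQ a d : a \is a GRing.unit -> d \is a GRing.unit -> t a d \in Q.
Proof. by move=> ua ud'; rewrite inQ; case: (ent_t ua ud') => _ -> -> _; rewrite eqxx nunit0. Qed.

Lemma tu a x : a \is a GRing.unit -> (u x ^ t a 1%R)%g = u (x / a).
Proof.
move=> ua; rewrite conjgE; apply: (mulgI (t a 1)); rewrite !mulgA mulgV mul1g.
have [a1 b1 c1 d1] := ent_u x; have [a2 b2 c2 d2] := ent_u (x / a).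
have [a3 b3 c3 d3] := ent_t ua (unitr1 R).
have e : a * (x / a) = x by rewrite mulrC divrK.
by apply: entP; rewrite !entM ?a1 ?a2 ?a3 ?b1 ?b2 ?b3 ?c1 ?c2 ?c3 ?d1 ?d2 ?d3 ?e; ring.
Qed.

Lemma tv a x : a \is a GRing.unit -> (v x ^ t 1%R a)%g = v (x / a).
Proof.
move=> ua; rewrite conjgE; apply: (mulgI (t 1 a)); rewrite !mulgA mulgV mul1g.
have [a1 b1 c1 d1] := ent_v x; have [a2 b2 c2 d2] := ent_v (x / a).
have [a3 b3 c3 d3] := ent_t (unitr1 R) ua.
have e : a * (x / a) = x by rewrite mulrC divrK.
by apply: entP; rewrite !entM ?a1 ?a2 ?a3 ?b1 ?b2 ?b3 ?c1 ?c2 ?c3 ?d1 ?d2 ?d3 ?e; ring.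
Qed.

Lemma psiU_exists :
  exists2 xi : 'CF(U), xi \is a linear_char & forall x, xi (u x) = psi x.
Proof.
have [psi0 psiD] := s_psi S.
have [|g h /UP[x ->] /UP[y ->]|xi lxi e] := @linear_char_exists _ U (fun g => psi (eb g)).
- by rewrite eb1.
- by rewrite -uD; case: (ent_u x) (ent_u y) (ent_u (x + y)) => _ -> _ _ [_ -> _ _] [_ -> _ _].
exists xi => // x; rewrite e; first by case: (ent_u x) => _ -> _ _.
by apply/UP; exists x.
Qed.

Lemma psiV_exists a :
  exists2 xi : 'CF(V), xi \is a linear_char & forall x, nunit x -> xi (v x) = psi (a * x).
Proof.
have [psi0 psiD] := s_psi S.
have [|g h /VP[x _ ->] /VP[y _ ->]|xi lxi e] :=
   @linear_char_exists _ V (fun g => psi (a * ec g)).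
- by rewrite ec1 mulr0.
- rewrite -vD -psiD -mulrDr; congr (psi (a * _)).
  by case: (ent_v x) (ent_v y) (ent_v (x + y)) => _ _ -> _ [_ _ -> _] [_ _ -> _].
exists xi => // x nx; rewrite e; first by case: (ent_v x) => _ _ -> _.
by apply/VP; exists x.
Qed.

Lemma cfdot_U (L : {group gT}) (c : 'CF(L)) (xi : 'CF(U)) : U \subset L ->
  (forall x, xi (u x) = psi x) ->
  (q ^ l)%:R * '['Res[U] c, xi] = fcoef p psi 0 (fun x => c (u x)) 1.
Proof.
move=> sUL e; rewrite cfdotE cardU mulVKf ?qX_neq0 // sum_U0 /fcoef.
apply: eq_big => [x|x _]; first by rewrite -[x in RHS]mul1r -(expr0 p) imset_f.
by rewrite cfResE // ?e ?mul1r //; apply/UP; exists x.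
Qed.

(** The unit frequencies are the characters of [U] that are nontrivial on [Y], and the diagonal
    torus permutes them transitively. So the complement of the [Y]-fixed vectors contains each of
    the [(q-1)q^(l-1)] of them equally often. *)
Lemma whittaker_dim (L : {group gT}) (c : 'CF(L)) (xi : 'CF(U)) : B \subset L ->
  (forall x, xi (u x) = psi x) ->
  ((q - 1) * q ^ l.-1)%:R * '['Res[U] c, xi] = c 1%g - '['Res[Y] c, 1].
Proof.
move=> sBL e; have sUL := subset_trans (sUB S) sBL; have sYL := subset_trans (sYU S) sUL.
apply: (mulfI (qX_neq0 l)); rewrite mulrCA (cfdot_U _ sUL e).
rewrite (fcoef1 cR (s_psi S) (s_psiP S)); last first.
  move=> a y ua; have tL := subsetP sBL _ (t_inB ua (unitr1 R)).
  by rewrite -(cfunJ c (u (a * y)) tL) tu // mulrAC divrr // mul1r.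
have uc0 : c (u 0) = c 1%g by rewrite u0.
rewrite uc0 mulrBr; congr (_ - _); rewrite cfdotE cardY sum_Y0.
rewrite qlS natrM [q%:R * _]mulrC -[RHS]mulrA mulVKf ?q_neq0 //; congr (_ * _).
have Yu z : p * z == 0 -> u z \in Y by rewrite inYu.
apply: eq_big => [z|z /andP[_ pz]]; last first.
  by rewrite cfResE ?Yu // cfun1E Yu // rmorph1 mulr1.
by rewrite -[z in z \in _]mul1r -(expr0 p) imset_f.
Qed.

Lemma cfdot_V (L : {group gT}) (c : 'CF(L)) (xi : 'CF(V)) a : V \subset L ->
  (forall x, nunit x -> xi (v x) = psi (a * x)) ->
  (q ^ l.-1)%:R * '['Res[V] c, xi] = fcoef p psi 1 (fun x => c (v x)) a.
Proof.
move=> sVL e; rewrite cfdotE cardV mulVKf ?qX_neq0 // sum_V0 /fcoef.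
apply: eq_big => [x|x nx]; first by rewrite nunitE.
by rewrite cfResE // ?e //; apply/VP; exists x.
Qed.

Lemma cfun_tv (L : {group gT}) (c : 'CF(L)) : Q \subset L ->
  forall a y, a \is a GRing.unit -> c (v (a * y)) = c (v y).
Proof.
move=> sQL a y ua; have tL := subsetP sQL _ (t_inQ (unitr1 R) ua).
by rewrite -(cfunJ c (v (a * y)) tL) tv // mulrAC divrr // mul1r.
Qed.

(** The same count on [V], a copy of [p R]. A frequency matters there only modulo the annihilator of
    [p], which accounts for the factor [q]. *)
Lemma whittaker_dimV (L : {group gT}) (c : 'CF(L)) (xi : 'CF(V)) : Q \subset L ->
  (forall x, nunit x -> xi (v x) = psi (1 * x)) ->
  ((q - 1) * q ^ l.-1)%:R * '['Res[V] c, xi] =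
    q%:R * c 1%g - \sum_(y | nunit y && (p * y == 0)) c (v y).
Proof.
move=> sQL e; have sVL := subset_trans (sVQ S) sQL.
apply: (mulfI (qX_neq0 l.-1)); rewrite mulrCA (cfdot_V _ sVL e).
rewrite (fcoef1 cR (s_psi S) (s_psiP S)); last exact: cfun_tv.
have vc0 : c (v 0) = c 1%g by rewrite v0.
rewrite vc0 mulrBr mulrA -natrM mulnC -qlS; congr (_ - _ * _).
by apply: eq_bigl => y; rewrite nunitE.
Qed.

(** Fourier inversion at the identity gives a nonzero coefficient at some frequency, and conjugation
    by the torus replaces that frequency by a power of [p]. *)
Lemma V_constituent (L : {group gT}) (c : 'CF(L)) : Q \subset L -> c \is a character ->
  c != 0 -> exists2 j : 'I_l, True &
  forall xi : 'CF(V), (forall x, nunit x -> xi (v x) = psi (p ^+ j * x)) ->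
    '['Res[V] c, xi] != 0.
Proof.
move=> sQL Nc nzc; have sVL := subset_trans (sVQ S) sQL.
have cU := cfun_tv c sQL.
have : \sum_a fcoef p psi 1 (fun x => c (v x)) a != 0.
  rewrite (fcoef_sum cR (s_psi S) (s_psiP S)) v0 mulf_neq0 //; last by rewrite char1_eq0.
  by rewrite pnatr_eq0 (chain_card_R cR) -lt0n expn_gt0 q_gt0.
have [a na _|h] := pickP (fun a => fcoef p psi 1 (fun x => c (v x)) a != 0); last first.
  by rewrite big1 ?eqxx // => a _; have /negbFE/eqP := h a.
have [j e] : exists j : 'I_l, fcoef p psi 1 (fun x => c (v x)) a =
    fcoef p psi 1 (fun x => c (v x)) (p ^+ j).
  have [a0|nza] := eqVneq a 0; last first.
    have [j [jl [b ub eb']]] := chain_fact cR nza.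
    by exists (Ordinal jl); rewrite eb' fcoefM.
  (* On [p R] the frequencies [0] and [p ^+ l.-1] give the same, trivial, character; hence [l]
     representatives suffice. *)
  have ll : (l.-1 < l)%N by rewrite -(chain_S cR).
  exists (Ordinal ll); apply: eq_bigr => y; rewrite -nunitE => /(chain_nunitP cR)[z ->].
  by rewrite a0 mul0r mulrA [_ * p]mulrC (chain_pP cR) mul0r.
exists j => // xi exi; apply: contraNneq na => z0.
by rewrite e -(cfdot_V c sVL exi) z0 mulr0.
Qed.

End Weights.

(** * The normal closure of [Y] and irreducibility of induction from the Borel subgroup *)

Section NormalClosure.
Variable S : gl2_setting.
Local Notation R := (sR S).
Local Notation p := (@sp S).
Local Notation l := (sl S).
Local Notation q := (sq S).
Local Notation gT := (sT S).
Local Notation cR := (s_chain S).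
Local Notation G := [set: gT]%G.
Local Notation B := (Bgrp S).
Local Notation I := (Igrp S).
Local Notation U := (Ugrp S).
Local Notation Y := (Yg S).
Local Notation V := (Vgrp S).
Local Notation D := (Dgrp S).
Local Notation K := (Kgrp S).
Implicit Types (g h : gT) (x y z : R).

Definition edet g : R := ea g * ed g - eb g * ec g.
Lemma edetM g h : edet (g * h)%g = edet g * edet h.
Proof. by rewrite /edet !entM; ring. Qed.
Lemma edet1 : edet 1%g = 1.
Proof. by rewrite /edet !ent1 mulr1 mulr0 subr0. Qed.
Lemma edetJ g h : edet (g ^ h)%g = edet g.
Proof. by rewrite conjgE !edetM mulrCA -edetM mulVg edet1 mulr1. Qed.

Lemma nKG : (K <| G)%g.
Proof.
rewrite /normal subsetT; apply/subsetP=> g _; rewrite inE.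
apply/subsetP=> _ /imsetP[h Kh ->].
have dJ := edetJ h g; set k := (h ^ g)%g in dJ *.
have e : (h * g = g * k)%g by rewrite -conjgC.
move: Kh; rewrite !inK -/(edet h) -/(edet k) dJ => /and5P[-> /eqP ha /eqP hb /eqP hc /eqP hd].
have pa : p * ea h = p by apply/eqP; rewrite -subr_eq0 -[X in _ - X]mulr1 -mulrBr ha.
have pd : p * ed h = p by apply/eqP; rewrite -subr_eq0 -[X in _ - X]mulr1 -mulrBr hd.
have Ea : p * (ea g * ea k + eb g * ec k) = p * ea g.
  by rewrite -eaM -e eaM mulrDr !mulrA pa hb mul0r addr0.
have Eb : p * (ea g * eb k + eb g * ed k) = p * eb g.
  by rewrite -ebM -e ebM mulrDr !mulrA pa hb mul0r addr0.
have Ec : p * (ec g * ea k + ed g * ec k) = p * ec g.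
  by rewrite -ecM -e ecM mulrDr !mulrA pd hc mul0r add0r.
have Ed : p * (ec g * eb k + ed g * ed k) = p * ed g.
  by rewrite -edM -e edM mulrDr !mulrA pd hc mul0r add0r.
have ug := s_unit g; rewrite -/(edet g) in ug.
rewrite /=; apply/and4P; split; apply/eqP; apply: (mulrI ug); rewrite mulr0 /edet.
- transitivity (ed g * (p * (ea g * ea k + eb g * ec k))
     - eb g * (p * (ec g * ea k + ed g * ec k)) - p * (ea g * ed g - eb g * ec g)).
    by ring.
  by rewrite Ea Ec; ring.
- transitivity (ed g * (p * (ea g * eb k + eb g * ed k))
     - eb g * (p * (ec g * eb k + ed g * ed k))); first by ring.
  by rewrite Eb Ed; ring.
- transitivity (ea g * (p * (ec g * ea k + ed g * ec k))
     - ec g * (p * (ea g * ea k + eb g * ec k))); first by ring.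
  by rewrite Ea Ec; ring.
- transitivity (ea g * (p * (ec g * eb k + ed g * ed k))
     - ec g * (p * (ea g * eb k + eb g * ed k)) - p * (ea g * ed g - eb g * ec g)).
    by ring.
  by rewrite Eb Ed; ring.
Qed.

Lemma uw z : (u z ^ w S)%g = v z.
Proof.
rewrite conjgE; apply: (mulgI (w S)); rewrite !mulgA mulgV mul1g.
have [a1 b1 c1 d1] := ent_u z; have [a2 b2 c2 d2] := ent_v z.
have [a3 b3 c3 d3] := ent_w S.
by apply: entP; rewrite !entM ?a1 ?a2 ?a3 ?b1 ?b2 ?b3 ?c1 ?c2 ?c3 ?d1 ?d2 ?d3; ring.
Qed.

Lemma vuv r z : (v r * u z * v (- r)%R)%g = gl (1 - z * r) z (- (z * r * r)) (1 + z * r).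
Proof.
have ud' : (1 - z * r) * (1 + z * r) - z * (- (z * r * r)) \is a GRing.unit.
  have -> : (1 - z * r) * (1 + z * r) - z * (- (z * r * r)) = 1 by ring.
  exact: unitr1.
have [a1 b1 c1 d1] := ent_u z; have [a2 b2 c2 d2] := ent_v r.
have [a3 b3 c3 d3] := ent_v (- r); have [a4 b4 c4 d4] := s_ent ud'.
by apply: entP; rewrite ?a4 ?b4 ?c4 ?d4 !entM ?a1 ?a2 ?a3 ?b1 ?b2 ?b3 ?c1 ?c2 ?c3 ?d1 ?d2 ?d3; ring.
Qed.

Lemma utv x m n y : m \is a GRing.unit -> n \is a GRing.unit ->
  (u x * t m n * v y)%g = gl (m + x * n * y) (x * n) (n * y) n.
Proof.
move=> um un.
have ud' : (m + x * n * y) * n - x * n * (n * y) \is a GRing.unit.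
  have -> : (m + x * n * y) * n - x * n * (n * y) = m * n by ring.
  by rewrite unitrM um un.
have [a1 b1 c1 d1] := ent_u x; have [a2 b2 c2 d2] := ent_v y.
have [a3 b3 c3 d3] := ent_t um un; have [a4 b4 c4 d4] := s_ent ud'.
by apply: entP; rewrite ?a4 ?b4 ?c4 ?d4 !entM ?a1 ?a2 ?a3 ?b1 ?b2 ?b3 ?c1 ?c2 ?c3 ?d1 ?d2 ?d3; ring.
Qed.

(** Conjugates of [Y] provide the upper and lower unipotent elements of [K]. The diagonal ones are
    the middle factors in the factorisation of the conjugate of [u (n - 1)] by [v (- 1)], and an
    element of [K] with unit [ed] is a product of the three kinds. *)
Lemma normal_closure_Y (N : {group gT}) : (N <| G)%g -> Y \subset N -> K \subset N.
Proof.
move=> nN sYN; have NJ g h : g \in N -> (g ^ h)%g \in N.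
  by move=> Ng; rewrite memJ_norm // (subsetP (normal_norm nN)) // inE.
have Nu z : p * z = 0 -> u z \in N.
  by move=> pz; apply: (subsetP sYN); apply/YP; exists z.
have Nv z : p * z = 0 -> v z \in N by move=> pz; rewrite -uw NJ // Nu.
have Nt n : n \is a GRing.unit -> p * (n - 1) = 0 -> t n^-1 n \in N.
  move=> un pn; pose s := n - 1.
  have e : (v 1%R * u s * v (- 1)%R)%g = (u (s / n)%R * t (n^-1)%R n * v (- (s / n))%R)%g.
    have n1 : n * n^-1 = 1 by rewrite divrr.
    rewrite vuv utv ?unitrV // /s; congr gl; ring: n1.
  have : (u s ^ v (- 1)%R)%g \in N by rewrite NJ // Nu.
  rewrite conjgE vN invgK -vN mulgA e groupMr; last by rewrite Nv // mulrN annM ?oppr0.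
  by rewrite groupMl // Nu // annM.
have main g : g \in K -> ed g \is a GRing.unit -> g \in N.
  rewrite inK => /and5P[/eqP hdet /eqP ha /eqP hb /eqP hc /eqP hd] un.
  have -> : g = (u (eb g / ed g)%R * t ((ed g)^-1)%R (ed g) * v (ec g / ed g)%R)%g.
    rewrite utv ?unitrV // {1}(s_eta g).
    have n1 : ed g * (ed g)^-1 = 1 by rewrite divrr.
    have ad : ea g * ed g = 1 + eb g * ec g by rewrite -hdet; ring.
    congr gl; try by ring: n1.
    apply: (mulIr un); rewrite ad; ring: n1.
  by rewrite !groupM ?Nt ?Nu ?Nv // annM.
apply/subsetP=> g Kg; have [|nd] := boolP (ed g \is a GRing.unit); first exact: main.
rewrite inK in Kg; case/and5P: (Kg) => /eqP hdet _ _ _ /eqP hd.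
  (* A unit killed by [p] forces [p = 0]; then left multiplication by [v 1] leads back to the case
     of a unit entry. *)
  have ud1 : ed g - 1 \is a GRing.unit by rewrite -unitrN opprB unitD ?unitr1 // unitrN.
  have p0 : p = 0 by apply: (mulIr ud1); rewrite hd mul0r.
  have ub : eb g \is a GRing.unit.
    have : 1 + - (ea g * ed g) \is a GRing.unit.
      by apply: unitD; rewrite ?unitr1 // unitrN mulrC nunitM.
    have -> : 1 + - (ea g * ed g) = - (eb g * ec g) by rewrite -hdet; ring.
    by rewrite unitrN unitrM => /andP[].
  rewrite -(groupMl _ (Nv 1 _)) ?p0 ?mul0r //; apply: main.
    by rewrite inK !p0 !mul0r !eqxx !andbT -/(edet _) edetM /edet; case: (ent_v (1 : R)) => -> -> -> ->; rewrite hdet !mulr1 subr0.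
  by rewrite edM; case: (ent_v (1 : R)) => _ _ -> ->; rewrite !mul1r unitD.
Qed.

Lemma fix_K (i : Iirr G) : ~~ (Y \subset cfker 'chi_i) -> '['Res[K] 'chi_i, 1] = 0.
Proof.
move=> nY; apply: contraNeq nY => nz; apply: subset_trans (sYK S) _.
by apply: (constt0_Res_cfker nKG); rewrite irr_consttE irr0.
Qed.

(** Conjugation by [t 2 1] sends [u y] to [u (y / 2)], so [b] is trivial on [u (y - y / 2)]; the
    choice [y = 2 x] reaches every [x]. *)
Lemma lin_U (b : 'CF(B)) : b \is a linear_char -> U \subset cfker b.
Proof.
move=> lb; have two := chain_two cR; apply/subsetP=> _ /UP[x ->].
have uB y : u y \in B by apply: (subsetP (sUB S)); apply/UP; exists y.
have uker y : b (u (y / 2%:R)) = b (u y).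
  by rewrite -tu // cfunJ // t_inB ?unitr1.
rewrite cfkerEchar ?lin_charW // inE uB lin_char1 //=.
pose y := x * 2%:R; have e : x = y - y / 2%:R.
  by rewrite /y mulrK // mulr_natr mulr2n addrK.
rewrite e uD uN (lin_charM lb) ?groupV // (lin_charV lb) // uker mulfV //.
by rewrite (lin_char_neq0 lb).
Qed.

Lemma lin_Y (b : 'CF(B)) : b \is a linear_char -> Y \subset cfker b.
Proof. by move/lin_U; apply: subset_trans (sYU S). Qed.

Lemma cardI : #|I| = (#|B| * #|V|)%N.
Proof.
have e : I :=: (V * B)%g.
  apply/eqP; rewrite eqEsubset; apply/andP; split; last first.
    by rewrite mul_subG ?sBI // (subset_trans (sVQ S) (sQI S)).
  apply/subsetP=> g Ig; have [ua _] := IunitP Ig; move: (Ig); rewrite inI => nc.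
  apply/mulsgP; exists (v (ec g / ea g)) (v (- (ec g / ea g))%R * g)%g.
  - by apply/VP; exists (ec g / ea g); rewrite // nunitM.
  - rewrite inB ecM; case: (ent_v (- (ec g / ea g))) => _ _ -> ->.
    by rewrite mulNr divrK // mul1r addrC subrr.
  - by rewrite vN mulKVg.
rewrite mulnC e TI_cardMg //; apply/eqP; rewrite eqEsubset sub1G andbT.
apply/subsetP=> g; rewrite inE => /andP[/VP[x _ ->]]; rewrite inB.
by case: (ent_v x) => _ _ -> _ => /eqP->; rewrite v0 inE.
Qed.

(** Bruhat cells: matrices whose lower left entry is a unit form [U w B], the others form the
    Iwahori subgroup [V B]. *)
Lemma cardG2 : #|G| = (#|B| * (#|V| + #|U|))%N.
Proof.
rewrite mulnDr -cardI -(cardsID I [set: gT]) setTI; congr (_ + _)%N.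
rewrite mulnC -cardsX.
have <- : (fun xg : gT * gT => (xg.1 * w S * xg.2)%g) @: setX U B = [set: gT] :\: I.
  apply/setP=> g; rewrite !inE negbK andbT; apply/imsetP/idP.
    case=> -[x b] /setXP[/UP[y ->] Bb] /= ->.
    have [ua _] := BunitP Bb; move: Bb; rewrite inB => /eqP c0.
    rewrite ecM c0; have [a1 b1 c1 d1] := ent_u y; have [a2 b2 c2 d2] := ent_w S.
    by rewrite ecM edM c1 d1 a2 c2 d2 mul0r mulr0 add0r mulr1 mul1r addr0.
  move=> uc; exists (u (ea g / ec g), ((w S)^-1 * u (- (ea g / ec g))%R * g)%g); last first.
    by rewrite /= uN !mulgA mulgK mulgV mul1g.
  rewrite inE /=; apply/andP; split; first by apply/UP; eexists.
  have wV : (w S)^-1%g = w S.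
    apply/eqP; rewrite eq_invg_mul; apply/eqP; have [a2 b2 c2 d2] := ent_w S.
    by apply: entP; rewrite !entM !ent1 ?a2 ?b2 ?c2 ?d2; ring.
  rewrite wV inB; apply/eqP; have [a2 b2 c2 d2] := ent_w S.
  have [a1 b1 c1 d1] := ent_u (- (ea g / ec g)).
  rewrite !(ecM, edM) a1 b1 c1 d1 c2 d2.
  have e : ea g / ec g * ec g = ea g by rewrite divrK.
  transitivity (ea g - ea g / ec g * ec g); first by ring.
  by rewrite e subrr.
rewrite card_in_imset // => -[x b] [x' b'] /setXP[/UP[y ->] Bb] /setXP[/UP[y' ->] Bb'] /= e.
have e2 : (b * b'^-1)%g = v (y' - y).
  have e3 : (u y * w S * b * b'^-1 = u y' * w S)%g by rewrite e mulgK.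
  rewrite -uw addrC uD uN conjgE; apply: (mulgI (u y * w S)%g).
  by rewrite mulgA e3 !mulgA mulgK mulgV mul1g.
have : (b * b'^-1)%g \in B by rewrite groupM ?groupV.
rewrite e2 inB; case: (ent_v (y' - y)) => _ _ -> _; rewrite subr_eq0 => /eqP yy.
by rewrite yy in e *; congr (_, _); move: e => /mulgI.
Qed.

Lemma indexGB : #|G : B|%g = (q.+1 * q ^ l.-1)%N.
Proof.
rewrite -divgS ?subsetT // cardG2 mulKn ?cardG_gt0 // cardV cardU qlS.
by rewrite mulSn.
Qed.

Lemma indexIB : #|I : B|%g = (q ^ l.-1)%N.
Proof. by rewrite -divgS ?sBI // cardI mulKn ?cardG_gt0 // cardV. Qed.

(** A constituent without the generic character would be trivial on [Y], hence on [K] and on [D],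
    whereas by reciprocity its restriction to [B] contains [b]. So every constituent is generic, and
    the degree leaves room for only one. *)
Lemma Ind_irr (b : 'CF(B)) d : b \is a linear_char -> d \in D -> b d != 1 ->
  'Ind[G] b \in irr G.
Proof.
move=> lb Dd bd; have [xi lxi exi] := psiU_exists S.
have Nxi := lin_charW lxi; have sBG : B \subset G := subsetT _.
have NI : 'Ind[G] b \is a character by rewrite cfInd_char ?lin_charW.
have Bd := subsetP (sDB S) d Dd.
have wge k : k \in irr_constt ('Ind[G] b) -> 1 <= '['Res[U] 'chi_k, xi].
  move=> kb; have /natrP[n en] : '['Res[U] 'chi_k, xi] \in Num.nat.
    by rewrite Cnat_cfdot_char ?cfRes_char ?irr_char.
  rewrite en ler1n lt0n; apply/eqP=> n0.
  have := whittaker_dim 'chi_k sBG exi; rewrite en n0 mulr0 => /esym/eqP.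
  rewrite subr_eq0 => /eqP fixY.
  have kY : Y \subset cfker 'chi_k by apply: fixed_cfker; rewrite ?subsetT ?irr_char.
  have kD : D \subset cfker ('Res[B] 'chi_k).
    apply: sub_cfker_Res (sDB S) (subset_trans (sDK S) _).
    exact: normal_closure_Y (cfker_normal _) kY.
  have /irrP[j ej] := lin_char_irr lb.
  have jk : j \in irr_constt ('Res[B] 'chi_k).
    by rewrite irr_consttE -ej cfdot_Res_l cfdotC fmorph_eq0; rewrite irr_consttE in kb.
  have := subsetP (cfker_constt (cfRes_char _ (irr_char k)) jk) d (subsetP kD d Dd).
  by rewrite -ej => /cfker1; rewrite lin_char1 // => e; case/eqP: bd.
apply: (irr_of_unique_weight NI _ Nxi wge).
  rewrite cfInd_eq0 ?lin_charW //; apply/eqP=> b0; have := lin_char1 lb.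
  by rewrite b0 cfunE => /esym/eqP; rewrite oner_eq0.
have nzfix : '['Res[Y] ('Ind[G] b), 1] != 0.
  rewrite cfdot_Res_l; apply: (cfdot_Ind_lin_neq0 (x := 1%g)); rewrite ?subsetT ?inE //.
    exact: cfun1_lin_char.
  move=> g Yg _; rewrite conjg1 cfun1E Yg (cfker1 (subsetP (lin_Y lb) g Yg)) lin_char1 //.
have := whittaker_dim ('Ind[G] b) sBG exi.
have /natrP[n ->] : '['Res[U] ('Ind[G] b), xi] \in Num.nat.
  by rewrite Cnat_cfdot_char ?cfRes_char.
move: nzfix; have /natrP[m ->] : '['Res[Y] ('Ind[G] b), 1] \in Num.nat.
  by rewrite Cnat_cfdot_char ?cfRes_char ?cfun1_char.
rewrite cfInd1 // indexGB lin_char1 // mulr1 pnatr_eq0 -lt0n lern1 => m0 /eqP.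
rewrite eq_sym subr_eq -natrM -natrD eqr_nat => /eqP e.
(* For [q = 3] the index of [B] is exactly twice [(q-1)q^(l-1)], so it is the nonzero [Y]-fixed part
   [m] that excludes two generic constituents. *)
have := q_ge3 S; have : (0 < q ^ l.-1)%N by rewrite expn_gt0 q_gt0.
move: (q ^ l.-1)%N e m0 => k e m0 k0 q3; rewrite leqNgt; apply/negP=> n2.
have h1 : ((q - 1) * k * 2 <= (q - 1) * k * n)%N by rewrite leq_mul.
have h2 : (q.+1 * k <= (q - 1) * k * 2)%N by rewrite mulnAC leq_mul //; lia.
by lia.
Qed.

End NormalClosure.

(** * Fixed vectors of Y *)

Section FixedVectors.
Variable S : gl2_setting.
Local Notation R := (sR S).
Local Notation p := (@sp S).
Local Notation l := (sl S).
Local Notation q := (sq S).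
Local Notation gT := (sT S).
Local Notation cR := (s_chain S).
Local Notation G := [set: gT]%G.
Local Notation nunit x := (x \isn't a GRing.unit).
Local Notation B := (Bgrp S).
Local Notation I := (Igrp S).
Local Notation U := (Ugrp S).
Local Notation Y := (Yg S).
Local Notation D := (Dgrp S).
Implicit Types (g h : gT) (x y z : R).

Definition chi0 (i : Iirr G) : 'CF(I) := cffix Y ('Res[I] 'chi_i).

Lemma chi0_char i : chi0 i \is a character.
Proof. by rewrite cffix_char ?cfRes_char ?irr_char. Qed.

Lemma chi0E i g : g \in I -> chi0 i g = q%:R^-1 * \sum_(z | p * z == 0) 'chi_i (u z * g)%g.
Proof.
move=> Ig; rewrite (cffixE (nYI S)) // cardY sum_Y0; congr (_ * _).
apply: eq_bigr => z pz; rewrite cfResE ?subsetT // groupM //.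
by rewrite (subsetP (normal_sub (nYI S))) // inYu.
Qed.

Lemma chi0_1 i : chi0 i 1%g = '['Res[Y] 'chi_i, 1].
Proof.
by rewrite (cffix1 (nYI S)) cfResRes ?subsetT // (subset_trans _ (normal_sub (nYI S))).
Qed.

Lemma D_abelian : abelian D.
Proof.
apply/centsP=> g Dg h Dh; move: Dg Dh; rewrite !inD.
move=> /and4P[/eqP b1 /eqP c1 _ _] /and4P[/eqP b2 /eqP c2 _ _].
by apply: entP; rewrite !entM ?b1 ?b2 ?c1 ?c2; ring.
Qed.

Lemma DunitP g : g \in D -> ea g \is a GRing.unit /\ ed g \is a GRing.unit.
Proof. by move=> Dg; apply: BunitP; apply: (subsetP (sDB S)). Qed.

Lemma DE g : g \in D -> g = t (ea g) (ed g).
Proof.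
move=> Dg; have [ua ud'] := DunitP Dg; move: Dg; rewrite inD => /and4P[/eqP b0 /eqP c0 _ _].
by have [a1 b1 c1 d1] := ent_t ua ud'; apply: entP; rewrite ?a1 ?b1 ?c1 ?d1.
Qed.

Lemma der1B : (B^`(1) \subset U)%g.
Proof.
rewrite derg1 gen_subG; apply/subsetP=> _ /imset2P[x y Bx By ->].
suff H k : k \in B -> (x * y = y * x * k)%g -> k \in U.
  by apply: H; [rewrite groupR | exact: commgC].
move=> Bk e.
have [ux dx] := BunitP Bx; have [uy dy] := BunitP By.
move: Bx By Bk; rewrite !inB inU => /eqP cx /eqP cy /eqP ck; rewrite ck eqxx.
have ea' := congr1 (@ea S) e; have ed' := congr1 (@ed S) e.
move: ea' ed'; rewrite !entM cx cy ck !(mulr0, mul0r, addr0, add0r) => ea' ed'.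
apply/and3P; split=> //; apply/eqP.
  have h : ea y * ea x \is a GRing.unit by rewrite unitrM ux uy.
  by apply: (mulrI h); rewrite mulr1 -ea' mulrC.
have h : ed y * ed x \is a GRing.unit by rewrite unitrM dx dy.
by apply: (mulrI h); rewrite mulr1 -ed' mulrC.
Qed.

Lemma irrB_lin (c : Iirr B) : U \subset cfker 'chi_c -> 'chi_c \is a linear_char.
Proof. by move=> kU; rewrite lin_irr_der1 (subset_trans der1B). Qed.

(* A lower unipotent element conjugates u x to u (x / a) d0 and centralises D, and
   t a 1 conjugates u x to u (x / a); hence the sum is multiplied by al d0. *)
Lemma twist_zero (chi : 'CF(G)) (al : 'CF(D)) d0 x : al \is a linear_char ->
  d0 \in D -> al d0 != 1 -> p * x != 0 ->
  \sum_(d in D) chi (u x * d)%g * (al d)^* = 0.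
Proof.
move=> lal Dd0 ald px; pose f y := \sum_(d in D) chi (u y * d)%g * (al d)^*.
have nx : x != 0 by apply: contraNneq px => ->; rewrite mulr0.
have [k [kl [e ue ex]]] := chain_fact cR nx.
have kl1 : (k < l.-1)%N.
  rewrite ltn_neqAle -ltnS -(chain_S cR) kl andbT; apply: contraNneq px => ek.
  by rewrite ex ek mulrCA (chain_pP cR) mulr0.
have [ua0 ud0] := DunitP Dd0.
move: (Dd0); rewrite inD => /and4P[_ _ /eqP ad0 /eqP pa0].
pose s := 1 - ea d0; have ps : p * s = 0 by rewrite /s -opprB mulrN pa0 oppr0.
have [y ey] : exists y, s = p ^+ l.-1 * y.
  have := @chain_ann _ _ _ _ cR 1 s (chain_l cR); rewrite expr1 subn1; exact.
have p0 : p != 0 by apply: contraNneq px => ->; rewrite mul0r.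
have ns : nunit s.
  by apply: contraNN p0 => us; rewrite -(mulIr_eq0 _ (mulIr us)) ps.
have ss0 : s * s = 0 by apply: ann_nunit.
pose r := e^-1 * p ^+ (l.-1 - k) * y.
have nr : nunit r.
  rewrite /r -mulrA mulrC -mulrA; have -> : (l.-1 - k = (l.-1 - k).-1.+1)%N.
    by rewrite prednK // subn_gt0.
  by rewrite exprS -mulrA nunitM // (chain_p_nunit cR).
have xr : x * r = s.
  rewrite ex /r ey; transitivity (e * e^-1 * (p ^+ k * p ^+ (l.-1 - k)) * y); first by ring.
  by rewrite divrr // mul1r -exprD subnKC // ltnW.
have sr : s * r = 0 by rewrite mulrC; apply: ann_nunit.
pose a := 1 + s; have ua : a \is a GRing.unit by rewrite unitD ?unitr1.
have as1 : (1 - s) * a = 1 by rewrite /a; ring: ss0.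
have d0E : d0 = t (1 - s) a.
  rewrite {1}(DE Dd0); congr t; first by rewrite /s; ring.
  apply: (mulrI ua0); rewrite ad0 -as1; congr (_ * _); rewrite /s; ring.
have u1s : 1 - s \is a GRing.unit by rewrite unitD ?unitr1 // unitrN.
have e1 : (u x ^ (v (- r)%R))%g = (u (x / a)%R * d0)%g.
  rewrite conjgE vN invgK -vN mulgA vuv xr sr oppr0.
  have -> : (u (x / a)%R * d0)%g = (u (x / a)%R * t (1 - s)%R a * v 0%R)%g by rewrite v0 mulg1 d0E.
  by rewrite utv // !mulr0 addr0 divrK.
have e2 d : d \in D -> (d ^ (v (- r)%R))%g = d.
  move=> Dd; rewrite conjgE; apply: (mulgI (v (- r)%R)); rewrite mulKVg.
  move: (Dd); rewrite inD => /and4P[/eqP b0 /eqP c0 /eqP ad /eqP pad].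
  have pdd : p * (ed d - 1) = 0.
    by move: (subsetP (sDK S) d Dd); rewrite inK => /and5P[_ _ _ _ /eqP].
  have ra : r * ea d = r.
    by apply/eqP; rewrite -subr_eq0 -[X in _ - X]mulr1 -mulrBr ann_nunit.
  have rd : r * ed d = r.
    by apply/eqP; rewrite -subr_eq0 -[X in _ - X]mulr1 -mulrBr ann_nunit.
  have [a1 b1 c1 d1] := ent_v (- r).
  apply: entP; rewrite !entM ?a1 ?b1 ?c1 ?d1 ?b0 ?c0; try ring.
  by rewrite mulNr ra mulrN [ed d * r]mulrC rd; ring.
have fT y' d : d \in D -> chi (u (y' / a)%R * d)%g = chi (u y' * d)%g.
  move=> Dd; rewrite -[RHS](cfunJ _ _ (in_setT (t a 1))) conjMg tu //; congr (chi (_ * _)%g).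
  rewrite conjgE; apply: (mulgI (t a 1)); rewrite mulKVg.
  move: (Dd); rewrite inD => /and4P[/eqP b0 /eqP c0 _ _].
  have [a1 b1 c1 d1] := ent_t ua (unitr1 R).
  by apply: entP; rewrite !entM ?a1 ?b1 ?c1 ?d1 ?b0 ?c0; ring.
have fE : f x = al d0 * f x.
  rewrite {2}/f mulr_sumr [RHS](reindex_inj (mulgI d0)).
  apply: eq_big => [d|d Dd]; first by rewrite groupMl.
  have n1 : al d0 * (al d0)^* = 1.
    by rewrite -(lin_charV_conj lal) // -(lin_charM lal) ?groupV // mulgV (lin_char1 lal).
  rewrite (lin_charM lal) // rmorphM.
  transitivity (al d0 * (al d0)^* * (chi (u x * (d0 * d))%g * (al d)^*)); last by ring.
  rewrite n1 mul1r; congr (_ * _).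
  by rewrite -(cfunJ _ (u x * d)%g (in_setT (v (- r)%R))) conjMg e1 e2 // -mulgA fT // groupM.
apply/eqP; rewrite -/(f x) -(mulrI_eq0 _ (_ : GRing.lreg (al d0 - 1))); last first.
  by apply/lregP; rewrite subr_eq0.
by rewrite mulrBl mul1r -fE subrr.
Qed.

(** Take a nontrivial character [j] of [D] occurring in [chi0]. By [twist_zero] the average over [Y]
    twisted by [j] can be extended to all of [U] without changing it, so some [U]-fixed vector has
    type [j]. The corresponding constituent on [B] is linear, and its induction is irreducible. *)
Lemma Ind_of_D (i : Iirr G) : ~~ (D \subset cfker (chi0 i)) ->
  exists2 b : 'CF(B), b \is a linear_char &
    (exists2 d, d \in D & b d != 1) /\ 'chi_i = 'Ind[G] b.
Proof.
move=> nD; have N0 := chi0_char i.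
have sDI : D \subset I := subset_trans (sDB S) (sBI S).
have [j [nzj [d0 Dd0 jd0]]] : exists j : Iirr D, '['Res[D] (chi0 i), 'chi_j] != 0 /\
    exists2 d, d \in D & 'chi_j d != 1.
  have [/existsP[j /andP[h1 h2]]|h] :=
      boolP [exists j : Iirr D, (j != 0) && ('['Res[D] (chi0 i), 'chi_j] != 0)].
    exists j; split=> //; have lj := char_abelianP _ D_abelian j.
    have [d /andP[Dd jd]|hd] := pickP [pred d in D | 'chi_j d != 1]; first by exists d.
    case/eqP: h1; apply: irr_inj; rewrite irr0; apply/cfun_inP=> d Dd.
    by rewrite cfun1E Dd; apply/eqP; have := hd d; rewrite /= Dd => /negbFE.
  have RE : 'Res[D] (chi0 i) = '['Res[D] (chi0 i), 1] *: 1.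
    rewrite {1}['Res[D] _]cfun_sum_cfdot (bigD1 0) // irr0 -[RHS]addr0; congr (_ + _).
    apply: big1 => j /andP[_ nj].
    have [->|h2] := eqVneq '['Res[D] (chi0 i), 'chi_j] 0; first by rewrite scale0r.
    by case/negP: h; apply/existsP; exists j; rewrite nj.
  case/negP: nD; apply: fixed_cfker => //; rewrite -(cfRes1 D) [in RHS]RE.
  by rewrite cfunE cfun1E group1 mulr1.
have lj := char_abelianP _ D_abelian j.
pose f x := \sum_(d in D) 'chi_i (u x * d)%g * ('chi_j d)^*.
have sf : \sum_x f x != 0.
  rewrite (bigID (fun x => p * x == 0)) /= [X in _ + X]big1 ?addr0; last first.
    by move=> x px; rewrite /f (twist_zero _ lj Dd0 jd0).
  move: nzj; rewrite cfdotE => /(contraNneq _); apply => s0.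
  rewrite (eq_bigr (fun d => q%:R^-1 *
     \sum_(z | p * z == 0) 'chi_i (u z * d)%g * ('chi_j d)^*)).
    by rewrite -mulr_sumr exchange_big /= s0 !mulr0.
  by move=> d Dd; rewrite cfResE // chi0E ?(subsetP sDI) // -mulrA mulr_suml.
have [c [mc sc]] : exists c : Iirr B, '['Res[B] 'chi_i, 'chi_c] != 0 /\
   \sum_(d in D) (\sum_(x in U) 'chi_c (x * d)%g) * ('chi_j d)^* != 0.
  have [/existsP[c /andP[h1 h2]]|h] := boolP [exists c : Iirr B,
     ('['Res[B] 'chi_i, 'chi_c] != 0) &&
     (\sum_(d in D) (\sum_(x in U) 'chi_c (x * d)%g) * ('chi_j d)^* != 0)].
    by exists c.
  case/negP: sf; apply/eqP.
  transitivity (\sum_(c : Iirr B) '['Res[B] 'chi_i, 'chi_c] *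
     (\sum_(d in D) (\sum_(x in U) 'chi_c (x * d)%g) * ('chi_j d)^*)); last first.
    apply: big1 => c _; apply/eqP; rewrite mulf_eq0 -[_ || _]negbK negb_or.
    by apply: contraNN h => hc; apply/existsP; exists c.
  rewrite /f exchange_big /=; under [RHS]eq_bigr do rewrite mulr_sumr.
  rewrite [RHS]exchange_big /=; apply: eq_bigr => d Dd.
  under [RHS]eq_bigr do rewrite mulrA.
  rewrite -!mulr_suml; congr (_ * _).
  under [RHS]eq_bigr do rewrite mulr_sumr.
  rewrite [RHS]exchange_big /= sum_U0; apply: eq_bigr => x _.
  have xdB : (u x * d)%g \in B.
    apply: groupM; last exact: (subsetP (sDB S)).
    by apply: (subsetP (sUB S)); apply/UP; exists x.
  rewrite -(cfResE _ (subsetT B) xdB) {1}['Res[B] _]cfun_sum_cfdot sum_cfunE.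
  by apply: eq_bigr => c _; rewrite cfunE.
have [kU|nU] := boolP (U \subset cfker 'chi_c); last first.
  case/eqP: sc; apply: big1 => d Dd.
  by rewrite (normal_sum_irr _ (nUB S)) ?(subsetP (sDB S)) // (negPf nU) mul0r.
have lc := irrB_lin kU; exists 'chi_c => //.
have cj : {in D, 'chi_c =1 'chi_j}.
  have lR : 'Res[D] 'chi_c \is a linear_char by rewrite cfRes_lin_char.
  have /irrP[j' ej'] := lin_char_irr lR.
  suff -> : j = j' by move=> d Dd; rewrite -ej' cfResE // sDB.
  apply/eqP; apply: contraNT sc => jj'.
  rewrite (eq_bigr (fun d => #|U|%:R * ('chi_j' d * ('chi_j d)^*))); last first.
    move=> d Dd; rewrite (normal_sum_irr _ (nUB S)) ?(subsetP (sDB S)) // kU -mulrA.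
    by rewrite -ej' cfResE // sDB.
  rewrite -mulr_sumr; have := cfdot_irr j' j; rewrite eq_sym (negPf jj') cfdotE => /eqP.
  rewrite mulf_eq0 invr_eq0 pnatr_eq0 eqn0Ngt cardG_gt0 => /eqP->.
  by rewrite mulr0.
split; first by exists d0 => //; rewrite cj.
have /irrP[k ek] : 'Ind[G] 'chi_c \in irr G by apply: (Ind_irr lc Dd0); rewrite cj.
rewrite ek; congr 'chi_(_); apply/eqP; move: mc; rewrite cfdot_Res_l ek cfdot_irr.
by case: (i == k); rewrite ?eqxx.
Qed.

End FixedVectors.

Lemma cfResD (gT : finGroupType) (A B : {group gT}) (a b : 'CF(B)) :
  'Res[A] (a + b) = 'Res[A] a + 'Res[A] b.
Proof. by rewrite linearD. Qed.

(** * Characters of the congruence subgroup [K] *)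

Section Congruence.
Variable S : gl2_setting.
Local Notation R := (sR S).
Local Notation p := (@sp S).
Local Notation l := (sl S).
Local Notation q := (sq S).
Local Notation gT := (sT S).
Local Notation cR := (s_chain S).
Local Notation G := [set: gT]%G.
Local Notation nunit x := (x \isn't a GRing.unit).
Local Notation I := (Igrp S).
Local Notation Y := (Yg S).
Local Notation D := (Dgrp S).
Local Notation K := (Kgrp S).
Implicit Types (g h : gT) (x y z : R).

Lemma p_neq0 : (1 < l)%N -> p != 0.
Proof.
move=> l1; apply/eqP=> p0.
have := chain_card_pow cR (chain_l cR); rewrite expr1 p0 => /(_ erefl) e.
by rewrite -e ltnn in l1.
Qed.

Lemma p_eq0 : l = 1%N -> p = 0.
Proof. by move=> e; have := chain_nil cR; rewrite e expr1. Qed.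

Lemma ann_isnt_unit x : (1 < l)%N -> p * x = 0 -> nunit x.
Proof.
by move=> /p_neq0 p0 px; apply: contraNN p0 => ux; rewrite -(mulIr_eq0 _ (mulIr ux)) px.
Qed.

Lemma ann_mul x y : (1 < l)%N -> p * x = 0 -> p * y = 0 -> x * y = 0.
Proof. by move=> l1 px py; apply: ann_nunit (ann_isnt_unit l1 px). Qed.

Lemma K_abelian : (1 < l)%N -> abelian K.
Proof.
move=> l1; apply/centsP=> g Kg h Kh; move: Kg Kh; rewrite !inK.
move=> /and5P[_ /eqP a1 /eqP b1 /eqP c1 /eqP d1] /and5P[_ /eqP a2 /eqP b2 /eqP c2 /eqP d2].
have am := fun x y => @ann_mul x y l1.
have e x y z t' : p * x = 0 -> p * y = 0 -> p * z = 0 -> p * t' = 0 -> x * y = z * t'.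
  by move=> px py pz pt; rewrite (am x y) // (am z t').
apply: entP; rewrite !entM.
- by rewrite [eb h * _]mulrC [ea h * _]mulrC; congr (_ + _); apply: e.
- have -> : ea g * eb h + eb g * ed h = (ea g - 1) * eb h + eb g * (ed h - 1) + (eb h + eb g) by ring.
  have -> : ea h * eb g + eb h * ed g = (ea h - 1) * eb g + eb h * (ed g - 1) + (eb h + eb g) by ring.
  by rewrite (am _ _ a1 b2) (am _ _ b1 d2) (am _ _ a2 b1) (am _ _ b2 d1).
- have -> : ec g * ea h + ed g * ec h = ec g * (ea h - 1) + (ed g - 1) * ec h + (ec h + ec g) by ring.
  have -> : ec h * ea g + ed h * ec g = ec h * (ea g - 1) + (ed h - 1) * ec g + (ec h + ec g) by ring.
  by rewrite (am _ _ c1 a2) (am _ _ d1 c2) (am _ _ c2 a1) (am _ _ d2 c1).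
- by rewrite [ec h * _]mulrC [ed h * _]mulrC; congr (_ + _); apply: e.
Qed.

Lemma sKI : (1 < l)%N -> K \subset I.
Proof.
move=> l1; apply/subsetP=> g; rewrite inK inI => /and5P[_ _ _ /eqP c1 _].
exact: ann_isnt_unit.
Qed.

Lemma t_inD n : n \is a GRing.unit -> p * (n - 1) = 0 -> t n^-1 n \in D.
Proof.
move=> un pn; rewrite inD; case: (ent_t (etrans (unitrV n) un) un) => -> -> -> ->.
rewrite !eqxx mulVr // eqxx /=; apply/eqP.
have -> : n^-1 - 1 = (n - 1) * - n^-1 by rewrite mulrN mulrBl divrr // mul1r opprB.
exact: annM.
Qed.

Lemma KE g : (1 < l)%N -> g \in K -> [/\ ed g \is a GRing.unit,
  p * (eb g / ed g) = 0, p * (ec g / ed g) = 0, t (ed g)^-1 (ed g) \in D &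
  g = (u (eb g / ed g)%R * t ((ed g)^-1)%R (ed g) * v (ec g / ed g)%R)%g].
Proof.
move=> l1; rewrite inK => /and5P[/eqP hdet /eqP ha /eqP hb /eqP hc /eqP hd].
have un : ed g \is a GRing.unit.
  by rewrite -[ed g](subrK 1) addrC unitD ?unitr1 ?ann_isnt_unit.
split; rewrite ?t_inD ?annM // utv ?unitrV // {1}(s_eta g).
have n1 : ed g * (ed g)^-1 = 1 by rewrite divrr.
have ad : ea g * ed g = 1 + eb g * ec g by rewrite -hdet; ring.
congr gl; try by ring: n1.
by apply: (mulIr un); rewrite ad; ring: n1.
Qed.

Lemma u_inK z : p * z = 0 -> u z \in K.
Proof. by move=> pz; apply: (subsetP (sYK S)); apply/YP; exists z. Qed.

Lemma v_inK z : p * z = 0 -> v z \in K.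
Proof.
move=> pz; rewrite -uw memJ_norm ?u_inK //.
by rewrite (subsetP (normal_norm (nKG S))) // inE.
Qed.

Lemma K_triv (xi : 'CF(K)) : (1 < l)%N -> xi \is a linear_char ->
  (forall z, p * z = 0 -> xi (u z) = 1) -> {in D, forall d, xi d = 1} ->
  (forall z, p * z = 0 -> xi (v z) = 1) -> xi = 1.
Proof.
move=> l1 lxi hu hd hv; apply/cfun_inP=> g Kg; rewrite cfun1E Kg.
have [un pb pc Dt e] := KE l1 Kg; have Kt := subsetP (sDK S) _ Dt.
have Ku := u_inK pb; have Kv := v_inK pc.
by rewrite e !(lin_charM lxi) ?groupM // hu // hd // hv // !mulr1.
Qed.

Lemma chi0_decomp i : 'Res[I] 'chi_i = chi0 i + ('Res[I] 'chi_i - chi0 i).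
Proof. by rewrite addrC subrK. Qed.

Lemma chi1_char i : 'Res[I] 'chi_i - chi0 i \is a character.
Proof. by rewrite cffixC_char ?cfRes_char ?irr_char. Qed.

(** The complement of [chi0] has no [Y]-fixed vector, so a character of [K] trivial on [Y] must come
    from [chi0], where [D] acts trivially. *)
Lemma constt_K_D (i : Iirr G) (k : Iirr K) : (1 < l)%N -> D \subset cfker (chi0 i) ->
  '['Res[K] 'chi_i, 'chi_k] != 0 -> (forall z, p * z = 0 -> 'chi_k (u z) = 1) ->
  '['Res[K] (chi0 i), 'chi_k] != 0 /\ {in D, forall d, 'chi_k d = 1}.
Proof.
move=> l1 kD ki kY; have sK := sKI l1.
have lk := char_abelianP _ (K_abelian l1) k.
have NR := chi1_char i; have N0 := chi0_char i.
have nz1 : '['Res[K] ('Res[I] 'chi_i - chi0 i), 'chi_k] = 0.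
  apply/eqP/negPn/negP=> kc.
  have NRK := cfRes_char K NR.
  have /(constt_charP _ NRK)[r Nr e] : k \in irr_constt ('Res[K] ('Res[I] 'chi_i - chi0 i)).
    by rewrite irr_consttE.
  have := cfdot_cffixC (nYI S) ('Res[I] 'chi_i); rewrite -/(chi0 i).
  rewrite -(cfResRes _ (sYK S) sK) e cfResD cfdotDl => /eqP.
  rewrite paddr_eq0 ?cfdot_char_ge0 ?cfRes_char ?irr_char ?cfun1_char // => /andP[/eqP e1 _].
  have : 'Res[Y] 'chi_k = 1.
    apply/cfun_inP=> g Yg; rewrite cfResE ?sYK // cfun1E Yg.
    by case/YP: Yg => z pz ->; apply: kY.
  by move=> h; move: e1; rewrite h cfnorm1 => /eqP; rewrite oner_eq0.
have nz0 : '['Res[K] (chi0 i), 'chi_k] != 0.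
  by move: ki; rewrite -(cfResRes _ sK (subsetT I)) chi0_decomp cfResD cfdotDl nz1 addr0.
split=> // d Dd; have kd : D \subset cfker ('Res[K] (chi0 i)).
  exact: sub_cfker_Res (sDK S) kD.
have sk : cfker ('Res[K] (chi0 i)) \subset cfker 'chi_k.
  by apply: cfker_constt; rewrite ?cfRes_char ?irr_consttE.
by rewrite (cfker1 (subsetP sk d (subsetP kd d Dd))) lin_char1.
Qed.

(** A constituent of [chi0] on [K] that is trivial on the lower copy of [Y] is trivial on [Y] and
    [D] as well, hence on [K]. But [K] has no fixed vector in [chi_i]. *)
Lemma sns_V (i : Iirr G) : (1 < l)%N -> ~~ (Y \subset cfker 'chi_i) ->
  D \subset cfker (chi0 i) -> \sum_(z | p * z == 0) chi0 i (v z) = 0.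
Proof.
move=> l1 Pi kD; have sK := sKI l1; have N0 := chi0_char i.
have NK : 'Res[K] (chi0 i) \is a character by rewrite cfRes_char.
transitivity (\sum_(k : Iirr K) '['Res[K] (chi0 i), 'chi_k] *
    \sum_(z | p * z == 0) 'chi_k (v z)).
  under [RHS]eq_bigr do rewrite mulr_sumr.
  rewrite [RHS]exchange_big /=; apply: eq_bigr => z /eqP pz.
  rewrite -(cfResE _ sK (v_inK pz)) {1}['Res[K] _]cfun_sum_cfdot sum_cfunE.
  by apply: eq_bigr => k _; rewrite cfunE.
apply: big1 => k _; have [->|nz] := eqVneq '['Res[K] (chi0 i), 'chi_k] 0.
  by rewrite mul0r.
have lk := char_abelianP _ (K_abelian l1) k.
have -> : \sum_(z | p * z == 0) 'chi_k (v z) = \sum_(g in Y) 'chi_k (v (eb g)).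
  by rewrite sum_Y0; apply: eq_bigr => z _; case: (ent_u z) => _ -> _ _.
have ebY g : g \in Y -> p * eb g = 0 by rewrite inY => /and4P[_ _ _ /eqP].
have [||hv|->] := @sum_mulchar _ Y (fun g => 'chi_k (v (eb g))); last by rewrite mulr0.
- by rewrite eb1 v0 lin_char1.
- move=> g h Yg Yh; rewrite ebM; move: (Yg) (Yh); rewrite !inY.
  move=> /and4P[/eqP-> _ _ _] /and4P[_ _ /eqP-> _].
  by rewrite mul1r mulr1 addrC vD (lin_charM lk) // v_inK ?ebY.
have kerk : Y \subset cfker ('Res[K] (chi0 i)).
  by apply: sub_cfker_Res (sYK S) (cffix_ker (nYI S) _).
have kerk2 : D \subset cfker ('Res[K] (chi0 i)) by apply: sub_cfker_Res (sDK S) kD.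
have sk : cfker ('Res[K] (chi0 i)) \subset cfker 'chi_k.
  by apply: cfker_constt => //; rewrite irr_consttE.
have k1 : 'chi_k = 1.
  apply: (K_triv l1 lk) => [z pz|d Dd|z pz].
  - have Yz : u z \in Y by apply/YP; exists z.
    by rewrite (cfker1 (subsetP sk _ (subsetP kerk _ Yz))) lin_char1.
  - by rewrite (cfker1 (subsetP sk _ (subsetP kerk2 _ Dd))) lin_char1.
  - have Yz : u z \in Y by apply/YP; exists z.
    by have := hv _ Yz; case: (ent_u z) => _ -> _ _.
have := fix_K Pi; rewrite -(cfResRes _ sK (subsetT I)) chi0_decomp cfResD cfdotDl.
move/eqP; rewrite paddr_eq0 ?cfdot_char_ge0 ?cfRes_char ?chi1_char ?cfun1_char //.
by rewrite -k1 (negPf nz).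
Qed.

(** Each conjugate of [Y] by [v (- z)] fixes a space of dimension [chi0(1)]. A character of [K]
    trivial on the conjugates for [z] and [z'] with [z' - z] a unit is trivial on all of [K], which
    is excluded. So the [q] residue classes of [z] use disjoint sets of characters of [K], and their
    fixed spaces add up inside [chi_i]. *)
Lemma ss_bound (i : Iirr G) : (1 < l)%N -> ~~ (Y \subset cfker 'chi_i) ->
  D \subset cfker (chi0 i) -> q%:R * chi0 i 1%g <= 'chi_i 1%g.
Proof.
move=> l1 Pi kD; have sK := sKI l1; have sKG : K \subset G := subsetT _.
have NK : 'Res[K] 'chi_i \is a character by rewrite cfRes_char ?irr_char.
have lK k := char_abelianP _ (K_abelian l1) k.
have nK g : g \in 'N(K)%g by rewrite (subsetP (normal_norm (nKG S))) // inE.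
pose m k := '['Res[K] 'chi_i, 'chi_k]; have m0 k : 0 <= m k.
  by rewrite cfdot_char_ge0 ?irr_char.
(* The value is [q] if [chi_k] is trivial on the conjugate of [Y] by [v (- z)], and [0]
   otherwise. *)
pose eps (k : Iirr K) (z : R) := \sum_(y in Y) 'chi_k (y ^ v (- z)%R)%g.
have yK (y : gT) z : y \in Y -> (y ^ v z)%g \in K by move=> Yy; rewrite memJ_norm ?(subsetP (sYK S)).
have d0E z : q%:R * chi0 i 1%g = \sum_k m k * eps k z.
  rewrite chi0_1 cfdotE cardY mulVKf ?q_neq0 //.
  under [RHS]eq_bigr do rewrite mulr_sumr.
  rewrite [RHS]exchange_big; apply: eq_bigr => y Yy.
  rewrite cfResE ?subsetT // cfun1E Yy rmorph1 mulr1.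
  rewrite -[LHS](cfunJ _ y (in_setT (v (- z)%R))) -(cfResE _ sKG (yK _ _ Yy)).
  by rewrite {1}['Res[K] _]cfun_sum_cfdot sum_cfunE; apply: eq_bigr => k _; rewrite cfunE.
have epsP k z : {in Y, forall g, 'chi_k (g ^ v (- z)%R)%g = 1} \/ eps k z = 0.
  apply: sum_mulchar; first by rewrite conj1g lin_char1.
  by move=> y y' Yy Yy'; rewrite conjMg (lin_charM (lK k)) ?yK.
have uniq k z z' : m k != 0 -> eps k z != 0 -> eps k z' != 0 -> nunit (z' - z).
  move=> mk; case: (epsP k z) => [h1 _|->]; last by rewrite eqxx.
  case: (epsP k z') => [h2 _|->]; last by rewrite eqxx.
  apply/negP=> ur; set r := z' - z in ur.
  pose k' := conjg_Iirr k (v z).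
  have k'E g : 'chi_k' g = 'chi_k (g ^ v (- z)%R)%g.
    by rewrite conjg_IirrE cfConjgE ?nK // vN.
  have mk' : '['Res[K] 'chi_i, 'chi_k'] != 0.
    by rewrite conjg_IirrE cfdot_Res_conjg ?inE ?nKG.
  have hu x : p * x = 0 -> 'chi_k' (u x) = 1.
    by move=> px; rewrite k'E h1 //; apply/YP; exists x.
  have [_ hd] := constt_K_D l1 kD mk' hu.
  have hv0 x : p * x = 0 -> 'chi_k' (v (- (x * r * r))) = 1.
    move=> px; have Yx : u x \in Y by apply/YP; exists x.
    have : 'chi_k' (u x ^ v (- r)%R)%g = 1.
      rewrite k'E -conjgM -vD; have -> : - r - z = - z' by rewrite /r; ring.
      exact: h2.
    have pxr : p * (x * r) = 0 by apply: annM.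
    have un : 1 + x * r \is a GRing.unit by rewrite unitD ?unitr1 // ann_isnt_unit.
    have inv : (1 + x * r)^-1 = 1 - x * r.
      apply: (mulrI un); rewrite divrr //.
      have := ann_mul l1 pxr pxr; move: (x * r) => s ss0.
      by rewrite mulrDr mulr1 mulrN mulrDl mul1r ss0 addr0 addrK.
    have xx : x * (x * r) = 0 by apply: ann_mul.
    have xxr : x * r * (x * r * r) = 0 by apply: ann_mul => //; apply: annM.
    (* In this factorisation the first two factors are killed by [hu] and [hd]; what survives is a
       lower unipotent element, arbitrary in [K] because [r] is a unit. *)
    have e : (u x ^ v (- r)%R)%g =
       (u x * t ((1 + x * r)^-1)%R (1 + x * r)%R * v (- (x * r * r))%R)%g.
      rewrite conjgE vN invgK -vN mulgA vuv utv ?unitrV // inv.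
      have xr2 : x * (x * r * r) = 0 by rewrite mulrA xx mul0r.
      have {}xx : x * x * r = 0 by rewrite -mulrA.
      by congr gl; ring: xx.
    have Dt : t (1 + x * r)^-1 (1 + x * r) \in D.
      by apply: t_inD => //; rewrite addrAC subrr add0r.
    rewrite e !(lin_charM (lK k')) ?groupM ?u_inK ?v_inK ?(subsetP (sDK S)) //;
      try by rewrite mulrN !annM ?oppr0.
    by rewrite hu // hd // !mul1r.
  have k'1 : 'chi_k' = 1.
    apply: (K_triv l1 (lK _) hu hd) => x px.
    have := hv0 (- x / r / r); rewrite !divrK // opprK; apply.
    by rewrite -mulrA annM // mulrN px oppr0.
  by have := fix_K Pi; rewrite -k'1 => /eqP; rewrite (negPf mk').
have epsq k z : eps k z = 0 \/ eps k z = q%:R.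
  case: (epsP k z) => [h|->]; [right | by left].
  by rewrite /eps (eq_bigr (fun=> 1)) // sumr_const cardY.
have sume k : m k != 0 -> \sum_z eps k z <= (q ^ l.-1)%:R * q%:R.
  move=> mk; rewrite (bigID (fun z => eps k z == 0)) /= big1 ?add0r; last by move=> z /eqP.
  have [z0 nz0|h] := pickP (fun z => eps k z != 0); last first.
    by rewrite big_pred0 ?mulr_ge0 ?ler0n // => z; have := h z.
  rewrite (eq_bigr (fun=> q%:R)) => [|z nz]; last by case: (epsq k z) nz => -> //; rewrite eqxx.
  rewrite sumr_const -[leLHS]mulr_natl ler_wpM2r ?ler0n // ler_nat.
  rewrite -(chain_card_nunit cR) -[X in (_ <= X)%N](card_image (addrI z0)).
  apply: subset_leq_card; apply/subsetP=> z nz; apply/imageP; exists (z - z0).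
    by rewrite inE; apply: uniq nz; rewrite // nz0.
  by rewrite addrC subrK.
have tot : (q ^ l)%:R * (q%:R * chi0 i 1%g) <= (q ^ l.-1)%:R * q%:R * 'chi_i 1%g.
  rewrite -(chain_card_R cR) mulr_natl -sumr_const.
  rewrite (eq_bigr _ (fun z _ => d0E z)) exchange_big /=.
  rewrite -(cfRes1 K 'chi_i) {1}['Res[K] _]cfun_sum_cfdot sum_cfunE mulr_sumr.
  apply: ler_sum => k _; rewrite -mulr_sumr cfunE lin_char1 // mulr1 [leRHS]mulrC -/(m k).
  have [->|mk] := eqVneq (m k) 0; first by rewrite !mul0r.
  by rewrite ler_wpM2l ?m0 ?sume.
move: tot; rewrite qlS natrM [q%:R * (q ^ _)%:R]mulrC ler_pM2l //.
by rewrite mulr_gt0 ?ltr0n ?expn_gt0 ?q_gt0.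
Qed.

End Congruence.

(** * Induction from the Borel to the Iwahori subgroup *)

Section Iwahori.
Variable S : gl2_setting.
Local Notation R := (sR S).
Local Notation l := (sl S).
Local Notation q := (sq S).
Local Notation gT := (sT S).
Local Notation cR := (s_chain S).
Local Notation G := [set: gT]%G.
Local Notation nunit x := (x \isn't a GRing.unit).
Local Notation B := (Bgrp S).
Local Notation I := (Igrp S).
Local Notation Q := (Qgrp S).
Local Notation U := (Ugrp S).
Local Notation Y := (Yg S).
Local Notation V := (Vgrp S).
Local Notation M := (Mgrp S).
Implicit Types (g h : gT) (x y z : R).

Local Notation unit x := (x \is a GRing.unit).

Lemma fix_gt (i : Iirr G) : ~~ (Y \subset cfker 'chi_i) -> chi0 i 1%g != 'chi_i 1%g.
Proof.
move=> Pi; apply: contraNneq Pi => e; apply: fixed_cfker; rewrite ?subsetT ?irr_char //.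
by rewrite -chi0_1.
Qed.

(** The difference is a multiple of [(q-1)q^(l-1)] by [whittaker_dim]. It is nonzero because [Y] is
    not in the kernel, and the upper bound excludes all multiples but the first. *)
Lemma chi0_dim (i : Iirr G) : ~~ (Y \subset cfker 'chi_i) ->
  'chi_i 1%g - chi0 i 1%g < (2 * ((q - 1) * q ^ l.-1))%:R ->
  'chi_i 1%g - chi0 i 1%g = ((q - 1) * q ^ l.-1)%:R.
Proof.
move=> Pi; have [xi lxi exi] := psiU_exists S; rewrite chi0_1.
rewrite -(whittaker_dim 'chi_i (subsetT B) exi).
have /natrP[n en] : '['Res[U] 'chi_i, xi] \in Num.nat.
  by rewrite Cnat_cfdot_char ?cfRes_char ?irr_char ?lin_charW.
have d0 : (0 < (q - 1) * q ^ l.-1)%N by rewrite muln_gt0 subn_gt0 (chain_q cR) expn_gt0 q_gt0.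
move: (whittaker_dim 'chi_i (subsetT B) exi); rewrite en.
move: ((q - 1) * q ^ l.-1)%N d0 => d d0 wE.
rewrite natrM [d%:R * _]mulrC ltr_pM2r ?ltr0n //.
rewrite ltr_nat; case: n en wE => [|[|n]] // en wE _; last by rewrite mul1r.
move: wE; rewrite mulr0 -chi0_1 => /esym/eqP.
by rewrite subr_eq0 eq_sym (negPf (fix_gt Pi)).
Qed.

Lemma B_lin_diag (b : 'CF(B)) g : b \is a linear_char -> g \in B -> b g = b (t (ea g) (ed g)).
Proof.
move=> lb Bg; have [ua ud'] := BunitP Bg; move: (Bg); rewrite inB => /eqP c0.
have e : (u (eb g / ed g)%R * t (ea g) (ed g))%g = g.
  rewrite -[LHS]mulg1 -(v0 S) utv // !mulr0 addr0 divrK //.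
  by rewrite [RHS](s_eta g) c0.
rewrite -[in LHS]e cfkerMl //.
by apply: (subsetP (lin_U lb)); apply/UP; eexists.
Qed.

Lemma tM (a d a' d' : R) : unit a -> unit d -> unit a' -> unit d' ->
  (t a d * t a' d')%g = t (a * a') (d * d').
Proof.
move=> ua ud' ua' ud''; have [a1 b1 c1 d1] := ent_t ua ud'.
have [a2 b2 c2 d2] := ent_t ua' ud''.
have uaa : unit (a * a') by rewrite unitrM ua.
have udd : unit (d * d') by rewrite unitrM ud'.
have [a3 b3 c3 d3] := ent_t uaa udd.
by apply: entP; rewrite ?a3 ?b3 ?c3 ?d3 !entM ?a1 ?b1 ?c1 ?d1 ?a2 ?b2 ?c2 ?d2; ring.
Qed.

Lemma bw_exists (b : 'CF(B)) : b \is a linear_char ->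
  exists2 bw : 'CF(B), bw \is a linear_char &
    forall a d : R, unit a -> unit d -> bw (t a d) = b (t d a).
Proof.
move=> lb.
have [||bw lbw e] := @linear_char_exists _ B (fun g => b (t (ed g) (ea g))).
- by rewrite ed1 ea1 -[t _ _]/(u 0) u0 lin_char1.
- move=> g h Bg Bh; have [ua ud'] := BunitP Bg; have [ua' ud''] := BunitP Bh.
  move: Bg Bh; rewrite !inB => /eqP c1 /eqP c2.
  rewrite -(lin_charM lb) ?t_inB // tM //; congr (b (t _ _)).
    by rewrite edM c1 mul0r add0r.
  by rewrite eaM c2 mulr0 addr0.
exists bw => // a d ua ud'; rewrite e ?t_inB //.
by case: (ent_t ua ud') => -> _ _ ->.
Qed.

Lemma theta_exists (b : 'CF(B)) : b \is a linear_char ->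
  exists2 th : 'CF(Q), th \is a linear_char &
    {in Q, forall g, th g = b (t (ea g) (ed g))}.
Proof.
move=> lb.
have [||th lth e] := @linear_char_exists _ Q (fun g => b (t (ea g) (ed g))).
- by rewrite ed1 ea1 -[t _ _]/(u 0) u0 lin_char1.
- move=> g h Qg Qh; have [ua ud'] := IunitP (subsetP (sQI S) _ Qg).
  have [ua' ud''] := IunitP (subsetP (sQI S) _ Qh).
  move: Qg Qh; rewrite !inQ => /andP[/eqP c1 _] /andP[/eqP c2 _].
  rewrite -(lin_charM lb) ?t_inB // tM //; congr (b (t _ _)).
    by rewrite eaM c1 mul0r addr0.
  by rewrite edM c2 mulr0 add0r.
by exists th.
Qed.

Definition NN (b : 'CF(B)) : 'CF(I) := 'Ind[I] b.

Lemma M_conj m g : m \in M -> g \in I ->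
  (m ^ g)%g \in M /\ (ea (m ^ g)%g = ea m /\ ed (m ^ g)%g = ed m).
Proof.
move=> Mm Ig; have [ua ud'] := IunitP Ig; move: (Ig) Mm; rewrite inI !inM => nc.
move=> /and4P[/eqP c0 /eqP pb /eqP pa /eqP pd].
have uD' := s_unit g.
pose al := ea m - 1; pose de := ed m - 1; pose be := eb m.
pose Di := (ea g * ed g - eb g * ec g)^-1.
have D1 : (ea g * ed g - eb g * ec g) * Di = 1 by rewrite divrr.
pose be' := ed g * (al * eb g + be * ed g - eb g * de) * Di.
have cal : ec g * al = 0 by apply: ann_nunit.
have cde : ec g * de = 0 by apply: ann_nunit.
have cbe : ec g * be = 0 by apply: ann_nunit.
have dm : ea m * ed m - be' * 0 \is a GRing.unit.
  by have := s_unit m; rewrite c0 !mulr0.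
have key x : ec g * x = 0 -> ea g * ed g * Di * x = x.
  move=> cx; transitivity ((ea g * ed g - eb g * ec g) * Di * x + eb g * Di * (ec g * x)).
    by ring.
  by rewrite D1 cx mulr0 addr0 mul1r.
have e : (m ^ g)%g = gl (ea m) be' 0 (ed m).
  rewrite conjgE; apply: (mulgI g); rewrite mulKVg.
  have [a1 b1 c1 d1] := s_ent dm.
  have eam : ea m = 1 + al by rewrite /al addrC subrK.
  have edm : ed m = 1 + de by rewrite /de addrC subrK.
  have kbe' : ea g * be' = al * eb g + be * ed g - eb g * de.
    have : ec g * (al * eb g + be * ed g - eb g * de) = 0.
      rewrite mulrBr mulrDr !mulrA cal cbe !mul0r addr0 sub0r mulrAC cde mul0r oppr0 //.
    move/key => h; rewrite -[RHS]h /be'; ring.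
  have cbe' : ec g * be' = 0.
    rewrite /be'; transitivity (ed g * Di * ((ec g * al) * eb g + (ec g * be) * ed g - eb g * (ec g * de))).
      by ring.
    by rewrite cal cbe cde !mul0r mulr0 addr0 subr0 mulr0.
  apply: entP; rewrite !entM ?a1 ?b1 ?c1 ?d1 ?c0.
  - rewrite eam mulr0 addr0 mulrDl mul1r mulrDr mulr1 -/be [be * _]mulrC cbe addr0.
    by rewrite mulrC.
  - rewrite kbe' eam edm -/be; ring.
  - rewrite mulr0 mul0r add0r addr0 eam edm mulrDl mul1r mulrDr mulr1 cal.
    by rewrite [de * _]mulrC cde.
  - by rewrite cbe' mul0r !add0r mulrC.
have [a1 b1 c1 d1] := s_ent dm; rewrite e; split; last by rewrite a1 d1.
rewrite a1 b1 c1 d1 pa pd !eqxx !andbT /=; apply/eqP; rewrite /be'.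
have -> : ed g * (al * eb g + be * ed g - eb g * de) * Di =
  (al * eb g + be * ed g + de * (- eb g)) * (ed g * Di) by ring.
by apply: annM; apply: annD; [apply: annD; apply: annM | apply: annM].
Qed.

Lemma NN_scalar (b : 'CF(B)) m g : b \is a linear_char -> m \in M -> g \in I ->
  NN b (m * g)%g = b m * NN b g.
Proof.
move=> lb Mm Ig; have Bm := subsetP (sMB S) m Mm.
rewrite /NN !cfIndE ?sBI // mulrCA; congr (_ * _); rewrite mulr_sumr.
apply: eq_bigr => h Ih; have [Mmh [e1 e2]] := M_conj Mm Ih.
have Bmh := subsetP (sMB S) _ Mmh; rewrite conjMg.
have [Bgh|nB] := boolP ((g ^ h)%g \in B); last first.
  have nB' : (m ^ h * g ^ h)%g \notin B by rewrite groupMl.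
  by rewrite (cfun0 b nB) (cfun0 b nB') mulr0.
by rewrite (lin_charM lb) // (B_lin_diag lb Bmh) e1 e2 -(B_lin_diag lb Bm).
Qed.

Lemma NN1 (b : 'CF(B)) : b \is a linear_char -> NN b 1%g = (q ^ l.-1)%:R.
Proof. by move=> lb; rewrite cfInd1 ?sBI // indexIB lin_char1 // mulr1. Qed.

Lemma NN_char (b : 'CF(B)) : b \is a linear_char -> NN b \is a character.
Proof. by move=> lb; rewrite cfInd_char ?lin_charW. Qed.

Lemma NN_Y (b : 'CF(B)) : b \is a linear_char -> Y \subset cfker (NN b).
Proof.
move=> lb; apply/subsetP=> g Yg'; have Mg := subsetP (sYM S) g Yg'.
have Ig : g \in I := subsetP (sBI S) _ (subsetP (sMB S) g Mg).
rewrite cfkerEchar ?NN_char // inE Ig -[X in NN b X]mulg1 NN_scalar ?group1 //.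
by rewrite (cfker1 (subsetP (lin_Y lb) g Yg')) lin_char1 // mul1r eqxx.
Qed.

(** An element of the Iwahori subgroup is one of [V] times one of [B], and [V] is abelian and meets
    [B] trivially. With [NN1] this says that [NN b] restricts to the regular character of [V]. *)
Lemma NN_V (b : 'CF(B)) g : g \in V -> g != 1%g -> NN b g = 0.
Proof.
move=> Vg g1; rewrite /NN cfIndE ?sBI // big1 ?mulr0 // => h Ih; apply: cfun0.
apply: contra g1 => Bgh.
have [ua _] := IunitP Ih; have nc : nunit (ec h) by rewrite -inI.
pose r := ec h / ea h; pose h' := (v (- r)%R * h)%g.
have Bh' : h' \in B.
  rewrite inB ecM; case: (ent_v (- r)) => _ _ -> ->.
  by rewrite /r mulNr divrK // mul1r addrC subrr.
have hE : h = (v r * h')%g by rewrite /h' vN mulKVg.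
case/VP: Vg Bgh => x nx ->; rewrite hE conjgM.
have -> : (v x ^ v r)%g = v x.
  by rewrite conjgE -vD addrC vD -[X in (_ * X)%g]vD; rewrite vD mulKg.
rewrite memJ_norm ?(subsetP (normG B)) // inB; case: (ent_v x) => _ _ -> _ => /eqP->.
by rewrite v0.
Qed.

Lemma cfdot_regV (c : 'CF(Q)) (xi : 'CF(V)) : xi \is a linear_char ->
  c 1%g = (q ^ l.-1)%:R -> {in V, forall g, g != 1%g -> c g = 0} -> '['Res[V] c, xi] = 1.
Proof.
move=> lxi c1 c0; rewrite cfdotE cardV (bigD1 1%g) ?group1 //.
rewrite cfRes1 (lin_char1 lxi) rmorph1 mulr1 c1 big1 => [|g /andP[Vg g1]].
  by rewrite -[X in _ * X](_ : (q ^ l.-1)%:R = _) ?mulVf ?qX_neq0 //; apply/esym/addr0.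
by rewrite cfResE ?sVQ // c0 // mul0r.
Qed.

End Iwahori.

Lemma cfdot_mul1 (gT : finGroupType) (L : {group gT}) (a b : 'CF(L)) :
  '[a * b, 1] = '[a, b^*%CF].
Proof.
rewrite !cfdotE; congr (_ * _); apply: eq_bigr => x Lx.
by rewrite !cfunE cfun1E Lx rmorph1 mulr1 conjCK.
Qed.

Lemma cfdot1_le_Res (gT : finGroupType) (L H : {group gT}) (a : 'CF(L)) :
  H \subset L -> a \is a character -> '[a, 1] <= '['Res[H] a, 1].
Proof.
move=> sHL Na; have := char_sub_constt 0 Na; rewrite irr0 => Nr.
rewrite -{2}(subrK ('[a, 1] *: 1) a) cfResD cfdotDl.
rewrite (_ : 'Res[H] ('[a, 1] *: 1) = '[a, 1] *: 1); last by rewrite linearZ /= cfRes_cfun1.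
by rewrite cfdotZl cfnorm1 mulr1 lerDr cfdot_char_ge0 ?cfRes_char ?cfun1_char.
Qed.

Lemma cffix_cfdot (gT : finGroupType) (L Y : {group gT}) (chi : 'CF(L)) (c : Iirr L) :
  Y \subset cfker 'chi_c -> '[cffix Y chi, 'chi_c] = '[chi, 'chi_c].
Proof.
move=> kc; rewrite /cffix cfdot_suml (bigD1 c) // cfdotZl cfnorm_irr mulr1.
rewrite -[RHS]addr0; congr (_ + _); apply: big1 => k /andP[_ kc'].
by rewrite cfdotZl cfdot_irr (negPf kc') mulr0.
Qed.

(** * Structure of the characters of type ss *)

Section SplitType.
Variable S : gl2_setting.
Local Notation R := (sR S).
Local Notation p := (@sp S).
Local Notation l := (sl S).
Local Notation q := (sq S).
Local Notation gT := (sT S).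
Local Notation cR := (s_chain S).
Local Notation G := [set: gT]%G.
Local Notation B := (Bgrp S).
Local Notation I := (Igrp S).
Local Notation U := (Ugrp S).
Local Notation Y := (Yg S).
Local Notation D := (Dgrp S).
Local Notation M := (Mgrp S).
Implicit Types (g h : gT) (x y z : R).

Local Notation unit x := (x \is a GRing.unit).

(** As [chi0] is nonzero and [q + 1 <= 2 (q - 1)], the complement has dimension exactly
    [(q-1)q^(l-1)], leaving [2q^(l-1)]. Triviality of [D] would contradict [ss_bound] for [l > 1];
    for [l = 1] it would make [chi_i] share an induced character of its own degree with a linear
    character. *)
Lemma ss_D (i : Iirr G) : ~~ (Y \subset cfker 'chi_i) ->
  'chi_i 1%g = (q.+1 * q ^ l.-1)%:R -> chi0 i 1%g != 0 ->
  chi0 i 1%g = (2 * q ^ l.-1)%:R /\ ~~ (D \subset cfker (chi0 i)).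
Proof.
move=> Pi di nz; have q3 := q_ge3 S; have k0 : (0 < q ^ l.-1)%N by rewrite expn_gt0 q_gt0.
have N0 := chi0_char i; have /natrP[n en] := Cnat_char1 N0.
have dE : chi0 i 1%g = (2 * q ^ l.-1)%:R.
  have := chi0_dim Pi; rewrite di en.
  have n0 : (0 < n)%N by rewrite lt0n -(pnatr_eq0 algC) -en.
  rewrite ltrBlDr -natrD ltr_nat => h.
  have /h /eqP : (q.+1 * q ^ l.-1 < 2 * ((q - 1) * q ^ l.-1) + n)%N.
    have h1 : (q.+1 * q ^ l.-1 <= 2 * (q - 1) * q ^ l.-1)%N by rewrite leq_mul //; lia.
    by rewrite mulnA; lia.
  rewrite subr_eq -natrD eqr_nat => /eqP h2.
  have h3 : (q.+1 * q ^ l.-1 = (q - 1) * q ^ l.-1 + 2 * q ^ l.-1)%N.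
    by rewrite -mulnDl; congr (_ * _)%N; lia.
  by congr (_%:R); lia.
split=> //; apply/negP=> kD.
have [l1|l1] := leqP l 1.
  have {}l1 : l = 1%N by apply/eqP; rewrite eqn_leq l1 (chain_l cR).
  have p0 := p_eq0 l1.
  have nzR : 'Res[B] (chi0 i) != 0.
    by rewrite cfRes_eq0 // -char1_eq0.
  have [c cc] := neq0_has_constt nzR.
  have sk : cfker ('Res[B] (chi0 i)) \subset cfker 'chi_c.
    by apply: cfker_constt; rewrite ?cfRes_char.
  have kY : Y \subset cfker 'chi_c.
    apply: subset_trans sk; apply: sub_cfker_Res; rewrite ?(normal_sub (nYB S)) //.
    exact: cffix_ker (nYI S) _.
  have kDc : D \subset cfker 'chi_c.
    by apply: subset_trans sk; apply: sub_cfker_Res (sDB S) kD.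
  have UY : U \subset Y.
    by apply/subsetP=> _ /UP[x ->]; apply/YP; exists x; rewrite // p0 mul0r.
  have lc : 'chi_c \is a linear_char by apply: irrB_lin; apply: subset_trans UY kY.
  (* A linear character of [B] trivial on [D], which for [l = 1] consists of all [diag(1/n, n)],
     factors through the determinant and so extends to [G]. *)
  have [||eta leta etaE] := @linear_char_exists _ G (fun g => 'chi_c (t (edet g) 1)).
  - by rewrite edet1 -[t _ _]/(u 0) u0 lin_char1.
  - move=> g h _ _; have ug := s_unit g; have uh := s_unit h.
    by rewrite edetM -(lin_charM lc) ?t_inB ?unitr1 // tM ?unitr1 // mulr1.
  have etaB : 'Res[B] eta = 'chi_c.
    apply/cfun_inP=> g Bg; rewrite cfResE ?subsetT // etaE ?inE //.
    have [ua ud'] := BunitP Bg; rewrite (B_lin_diag lc Bg).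
    have -> : edet g = ea g * ed g by move: Bg; rewrite inB /edet => /eqP->; rewrite mulr0 subr0.
    have -> : t (ea g) (ed g) = (t (ea g * ed g)%R 1%R * t ((ed g)^-1)%R (ed g))%g.
      by rewrite tM ?unitrM ?ua ?unitrV ?unitr1 // mulrK // mul1r.
    rewrite cfkerMr //; apply: (subsetP kDc); apply: t_inD => //.
    by rewrite p0 mul0r.
  have /irrP[k ek] := lin_char_irr leta.
  have ik : i != k.
    apply/eqP=> eik; have := lin_char1 leta; rewrite ek -eik di l1 muln1 => /eqP.
    by rewrite (eqr_nat _ _ 1) eqSS => /eqP q0; move: q3; rewrite q0.
  have ci : i \in irr_constt ('Ind[G] 'chi_c).
    rewrite constt_Ind_Res irr_consttE; move: cc; rewrite irr_consttE.
    rewrite -(cfResRes _ (sBI S) (subsetT I)) chi0_decomp cfResD cfdotDl => cc.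
    rewrite gt_eqF // ltr_wpDr ?cfdot_char_ge0 ?cfRes_char ?chi1_char ?irr_char //.
    by rewrite lt_def cc cfdot_char_ge0 ?cfRes_char ?irr_char.
  have Nc : 'Ind[G] 'chi_c \is a character by rewrite cfInd_char ?irr_char.
  have /(constt_charP _ Nc)[r Nr er] := ci.
  have : '['Ind[G] 'chi_c, 'chi_k] != 0.
    by rewrite -Frobenius_reciprocity -ek etaB cfnorm_irr oner_eq0.
  have : r 1%g = 0.
    have : ('Ind[G] 'chi_c) 1%g = 'chi_i 1%g + r 1%g by rewrite er cfunE.
    rewrite cfInd1 ?subsetT // indexGB lin_char1 // mulr1 di => /eqP.
    by rewrite -subr_eq0 opprD addNKr oppr_eq0 => /eqP.
  move/eqP; rewrite char1_eq0 // => /eqP r0.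
  by rewrite er r0 addr0 cfdot_irr (negPf ik) eqxx.
(* The bound would read [2 q <= q + 1]. *)
have := ss_bound l1 Pi kD; rewrite dE di -natrM ler_nat.
rewrite mulnA leq_mul2r leqNgt; apply/negP; rewrite negb_or negbK; lia.
Qed.

(** The data of a principal series: [bw] is the Weyl conjugate of [b], and the element [a] is a
    witness in [M] on which the scalars of [NN b] and [NN bw] differ. *)
Definition ss_data (i : Iirr G) (b bw : 'CF(B)) := [/\ b \is a linear_char,
  bw \is a linear_char,
  (forall a d : R, unit a -> unit d -> bw (t a d) = b (t d a)),
  (exists a : R, [/\ a \is a GRing.unit, p * (a - 1) = 0 & b (t a 1) != b (t 1 a)]) &
  (exists2 d, d \in D & b d != 1) /\
  [/\ 'chi_i = 'Ind[G] b, NN b \in irr I & chi0 i = NN b + NN bw]].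

Lemma gwd g : ed g * ea g - ec g * eb g \is a GRing.unit.
Proof. by rewrite mulrC [ec g * _]mulrC s_unit. Qed.

Lemma conj_w g : (g ^ w S)%g = gl (ed g) (ec g) (eb g) (ea g).
Proof.
rewrite conjgE; apply: (mulgI (w S)); rewrite mulKVg.
have [a1 b1 c1 d1] := s_ent (gwd g); have [a2 b2 c2 d2] := ent_w S.
by apply: entP; rewrite !entM ?a1 ?a2 ?b1 ?b2 ?c1 ?c2 ?d1 ?d2; ring.
Qed.

(** The intertwiner at [w] shows that [b] and [bw] induce the same irreducible character, so both
    [NN b] and [NN bw] are irreducible and occur once in [chi0] by reciprocity. They differ by their
    scalars on [M], and their degrees exhaust [2q^(l-1)]. *)
Lemma ss_struct (i : Iirr G) : ~~ (Y \subset cfker 'chi_i) ->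
  'chi_i 1%g = (q.+1 * q ^ l.-1)%:R -> chi0 i 1%g != 0 ->
  exists b bw, ss_data i b bw.
Proof.
move=> Pi di nz; have [dE nD] := ss_D Pi di nz.
have [b lb [[d Dd bd] eb']] := Ind_of_D nD.
have [bw lbw bwE] := bw_exists lb.
have [ua ud'] := DunitP Dd; move: (Dd); rewrite inD => /and4P[_ _ /eqP ad /eqP pa].
have edV : ed d = (ea d)^-1 by apply: (mulrI ua); rewrite ad divrr.
have pd : p * (ed d - 1) = 0.
  by move: (subsetP (sDK S) d Dd); rewrite inK => /and5P[_ _ _ _ /eqP].
have one := unitr1 R.
(* For [d = diag(a, 1/a)] the value [b d] is the quotient of [b (t a 1)] by [b (t 1 a)]. *)
have ba : b (t (ea d) 1) != b (t 1 (ea d)).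
  apply: contraNneq bd => e; rewrite (DE Dd).
  have -> : t (ea d) (ed d) = (t (ea d) 1%R * t 1%R (ed d))%g by rewrite tM // mulr1 mul1r.
  rewrite (lin_charM lb) ?t_inB // e -(lin_charM lb) ?t_inB // tM // mulr1 ad.
  by rewrite -[t _ _]/(u 0) u0 lin_char1.
have Nb := NN_char lb; have Nbw := NN_char lbw.
have IndN c : 'Ind[G] (NN c) = 'Ind[G] c by rewrite cfIndInd ?sBI ?subsetT.
have bwd : bw d != 1.
  apply: contraNneq bd => e.
  have e1 : b (t (ed d) (ea d)) = 1 by rewrite -bwE // -(DE Dd).
  have : b (t (ea d) (ed d)) * b (t (ed d) (ea d)) = 1.
    rewrite -(lin_charM lb) ?t_inB // tM // [ed d * _]mulrC ad.
    by rewrite -[t _ _]/(u 0) u0 lin_char1.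
  by rewrite e1 mulr1 -(DE Dd) => ->.
have eIw : 'Ind[G] bw = 'Ind[G] b.
  have /irrP[k ek] := Ind_irr lbw Dd bwd.
  have : '['Ind[G] b, 'Ind[G] bw] != 0; last first.
    by rewrite -eb' ek cfdot_irr; have [->|_] := eqVneq i k; rewrite ?eqxx.
  apply: (cfdot_Ind_lin_neq0 (x := w S)); rewrite ?subsetT ?in_setT // => g Bg Bgw.
  have [ga gd] := BunitP Bg; move: (Bg); rewrite inB => /eqP gc.
  move: Bgw; rewrite conj_w inB ec_gl ?gwd // => /eqP gb.
  by rewrite gb gc (B_lin_diag lbw Bg) bwE.
have iN : NN b \in irr I by apply: (Ind_irr_irr (subsetT I) Nb); rewrite IndN -eb' mem_irr.
have iNw : NN bw \in irr I by apply: (Ind_irr_irr (subsetT I) Nbw); rewrite IndN eIw -eb' mem_irr.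
exists b, bw; split=> //; first by exists (ea d).
split; first by exists d.
split=> //.
have /irrP[k ek] := iN; have /irrP[k' ek'] := iNw.
have kk' : k != k'.
  apply: contraNneq ba => e.
  have Mt (a' d' : R) : unit a' -> unit d' -> p * (a' - 1) = 0 -> p * (d' - 1) = 0 -> t a' d' \in M.
    move=> u1 u2 p1 p2; rewrite inM; case: (ent_t u1 u2) => -> -> -> ->.
    by rewrite p1 p2 mulr0 !eqxx.
  have tM' : t (ea d) 1 \in M by apply: Mt => //; rewrite subrr mulr0.
  have nz1 : NN b 1%g != 0 by rewrite (NN1 lb) qX_neq0.
  apply/eqP; apply: (mulIf nz1); rewrite -(NN_scalar lb tM') ?group1 // -bwE //.
  have -> : NN b = NN bw by rewrite ek ek' e.
  by rewrite -(NN_scalar lbw tM') ?group1.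
have coef (c : 'CF(B)) (j : Iirr I) : c \is a linear_char -> NN c = 'chi_j ->
    'Ind[G] c = 'chi_i -> '[chi0 i, 'chi_j] = 1.
  move=> lc ej eI; rewrite /chi0 cffix_cfdot; last by rewrite -ej; apply: NN_Y.
  by rewrite cfdot_Res_l -ej IndN eI cfnorm_irr.
have c1 := coef _ _ lb ek (esym eb').
have c2 : '[chi0 i, 'chi_k'] = 1 by apply: (coef _ _ lbw ek'); rewrite eIw -eb'.
have N0 := chi0_char i.
have := char_sub_constt k N0; rewrite c1 scale1r => N1.
have := char_sub_constt k' N1; rewrite cfdotBl c2 cfdot_irr (negPf kk') subr0 scale1r => N2.
apply/eqP; rewrite -subr_eq0 ek ek' opprD addrA -char1_eq0 // !cfunE -ek -ek'.
by rewrite (NN1 lb) (NN1 lbw) dE mulSn mul1n natrD addrAC addrK subrr.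
Qed.

End SplitType.

(** * Multiplicities in GL_2 *)

Lemma cfResM (gT : finGroupType) (L H : {group gT}) (a b : 'CF(L)) :
  'Res[H] (a * b) = 'Res[H] a * 'Res[H] b.
Proof. by rewrite rmorphM. Qed.

Section TripleProducts.
Variable S : gl2_setting.
Local Notation R := (sR S).
Local Notation p := (@sp S).
Local Notation l := (sl S).
Local Notation q := (sq S).
Local Notation gT := (sT S).
Local Notation cR := (s_chain S).
Local Notation psi := (@spsi S).
Local Notation G := [set: gT]%G.
Local Notation nunit x := (x \isn't a GRing.unit).
Local Notation B := (Bgrp S).
Local Notation I := (Igrp S).
Local Notation Q := (Qgrp S).
Local Notation U := (Ugrp S).
Local Notation Y := (Yg S).
Local Notation V := (Vgrp S).
Local Notation D := (Dgrp S).
Local Notation M := (Mgrp S).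
Implicit Types (g h : gT) (x y z : R).

Local Notation unit x := (x \is a GRing.unit).
Local Notation dd := ((q - 1) * q ^ l.-1)%N.
Definition tau (i j k : Iirr G) : algC := '['chi_i * 'chi_j * 'chi_k, 1].

(** By reciprocity both sides count the conjugate of [Psi] against characters induced to the Iwahori
    subgroup. The one from [B] is irreducible, and it occurs in the one from [Q] since [b] and [th]
    agree on the diagonal torus. *)
Lemma to_Q (b : 'CF(B)) (th : 'CF(Q)) (Psi : 'CF(I)) : b \is a linear_char ->
  th \is a linear_char -> {in Q, forall g, th g = b (t (ea g) (ed g))} ->
  NN b \in irr I -> Psi \is a character ->
  '[b * 'Res[B] Psi, 1] <= '[th * 'Res[Q] Psi, 1].
Proof.
move=> lb lth thE iN NPsi; have /irrP[k ek] := iN.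
rewrite !cfdot_mul1 !cfAutRes !Frobenius_reciprocity -/(NN b) ek.
have NI : 'Ind[I] th \is a character by rewrite cfInd_char ?lin_charW.
have : '['Ind[I] b, 'Ind[I] th] != 0.
  apply: (cfdot_Ind_lin_neq0 (x := 1%g)); rewrite ?sBI ?sQI ?group1 // => g Qg.
  rewrite conjg1 => Bg; rewrite thE // (B_lin_diag lb Bg) //.
rewrite -/(NN b) ek cfdotC fmorph_eq0 => kc.
have /(constt_charP _ NI)[r Nr ->] : k \in irr_constt ('Ind[I] th) by rewrite irr_consttE.
by rewrite cfdotDl lerDl cfdot_char_ge0 // cfConjC_char.
Qed.

(** After reduction to [B] the mixed terms vanish, one factor being trivial on [Y] and the other
    having no [Y]-fixed vector. In the remaining term [b x1] and the conjugate of [y1] both contain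
    the generic character exactly once, as does every constituent at least once. *)
Lemma tau_le (i j k : Iirr G) b bw : ss_data i b bw ->
  'chi_j 1%g - chi0 j 1%g = dd%:R -> 'chi_k 1%g - chi0 k 1%g = dd%:R ->
  tau i j k <= 1 + '[b * 'Res[B] (chi0 j * chi0 k), 1].
Proof.
move=> [lb _ _ _ [_ [ei _ _]]] dj dk; have sBG : B \subset G := subsetT _.
have [xi lxi exi] := psiU_exists S; have Nxi := lin_charW lxi.
have ResB m : 'Res[B] 'chi_m = 'Res[B] (chi0 m) + 'Res[B] ('Res[I] 'chi_m - chi0 m).
  by rewrite -cfResD -chi0_decomp cfResRes ?sBI ?subsetT.
have N0 m : 'Res[B] (chi0 m) \is a character by rewrite cfRes_char ?chi0_char.
have N1 m : 'Res[B] ('Res[I] 'chi_m - chi0 m) \is a character.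
  by rewrite cfRes_char ?chi1_char.
have K0 m : Y \subset cfker ('Res[B] (chi0 m)).
  by apply: sub_cfker_Res (normal_sub (nYB S)) (cffix_ker (nYI S) _).
have F1 m : '['Res[Y] ('Res[B] ('Res[I] 'chi_m - chi0 m)), 1] = 0.
  by rewrite cfResRes ?sBI ?(normal_sub (nYB S)) //; apply: cfdot_cffixC (nYI S) _.
have d1 m : 'Res[B] ('Res[I] 'chi_m - chi0 m) 1%g = 'chi_m 1%g - chi0 m 1%g.
  by rewrite cfRes1 !cfunE cfRes1.
have E : tau i j k = '[b * ('Res[B] 'chi_j * 'Res[B] 'chi_k), 1].
  rewrite /tau -mulrA !cfdot_mul1 ei -Frobenius_reciprocity; congr ('[_, _]).
  by rewrite -cfAutRes cfResM.
have Nb := lin_charW lb.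
have fixmul (a c : 'CF(B)) : Y \subset cfker a ->
    '['Res[Y] (a * c), 1] = a 1%g * '['Res[Y] c, 1].
  move=> ka; rewrite cfResM cfRes_sub_ker // mulr_algl cfdotZl //.
have cross (a c : 'CF(B)) : a \is a character -> c \is a character ->
    Y \subset cfker a -> '['Res[Y] c, 1] = 0 -> '[a * c, 1] = 0.
  move=> Na Nc ka fc; apply/eqP; rewrite eq_le cfdot_char_ge0 ?rpredM ?cfun1_char // andbT.
  apply: le_trans (cfdot1_le_Res (normal_sub (nYB S)) _) _; rewrite ?rpredM //.
  by rewrite fixmul // fc mulr0.
have kb := lin_Y lb.
have kbm (a : 'CF(B)) : Y \subset cfker a -> Y \subset cfker (b * a).
  by move=> ka; apply: subset_trans (cfker_mul _ _); rewrite subsetI kb.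
rewrite E [in leLHS](ResB j) [in leLHS](ResB k) cfResM.
move: (F1 j) (F1 k) (d1 j) (d1 k) (N1 j) (N1 k) => Fj Fk d1j d1k N1j N1k.
move: (K0 j) (K0 k) (N0 j) (N0 k) => K0j K0k N0j N0k.
clear E ResB; move: ('Res[B] (chi0 j)) ('Res[B] (chi0 k)) K0j K0k N0j N0k => x0 y0 Kx0 Ky0 Nx0 Ny0.
rewrite dj in d1j; rewrite dk in d1k.
move: ('Res[B] ('Res[I] 'chi_j - chi0 j)) ('Res[B] ('Res[I] 'chi_k - chi0 k))
  Fj Fk d1j d1k N1j N1k => x1 y1 Fx Fy dx dy Nx Ny.
rewrite mulrDl !mulrDr !cfdotDl.
have -> : '[b * (x0 * y1), 1] = 0 by rewrite mulrA; apply: cross; rewrite ?rpredM ?kbm.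
have -> : '[b * (x1 * y0), 1] = 0.
  by rewrite [x1 * _]mulrC mulrA; apply: cross; rewrite ?rpredM ?kbm.
rewrite addr0 add0r addrC lerD2r mulrA cfdot_mul1.
have d0 : dd%:R != 0 :> algC.
  by rewrite pnatr_eq0 -lt0n muln_gt0 subn_gt0 (chain_q cR) expn_gt0 q_gt0.
have wt (c : 'CF(B)) : '['Res[Y] c, 1] = 0 -> c 1%g = dd%:R -> '['Res[U] c, xi] = 1.
  move=> fc c1; apply: (mulfI d0); rewrite mulr1.
  by rewrite (whittaker_dim c (subxx B) exi) fc subr0.
have Fbx : '['Res[Y] (b * x1), 1] = 0 by rewrite fixmul // Fx mulr0.
(* One weight is enough here, hence the index type ['I_1] for [cfdot_le_restr]. *)
have -> : 1 = \sum_(j0 : 'I_1) '['Res[U] (b * x1), xi].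
  by rewrite big_ord1 wt // cfunE lin_char1 // mul1r.
apply: (@cfdot_le_restr _ B U _ (fun=> xi)); rewrite ?sUB ?rpredM ?cfConjC_char //.
- move=> c cc; exists 0; apply: contraTneq isT => w0.
  have := whittaker_dim 'chi_c (subxx B) exi; rewrite w0 mulr0.
  have -> : '['Res[Y] 'chi_c, 1] = 0.
    have Nbx : b * x1 \is a character by rewrite rpredM.
    have /(constt_charP _ Nbx)[r Nr e] := cc.
    move: Fbx; rewrite e cfResD cfdotDl => /eqP.
    by rewrite paddr_eq0 ?cfdot_char_ge0 ?cfRes_char ?irr_char ?cfun1_char // => /andP[/eqP].
  by rewrite subr0 => /esym/eqP; rewrite (negPf (irr1_neq0 c)).
- move=> _; rewrite wt //.
    by rewrite -cfAutRes -[1]cfConjC_cfun1 cfdot_conjC Fy rmorph0.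
  by rewrite cfunE dy rmorph_nat.
Qed.

Lemma triv_D_zero (b : 'CF(B)) (Psi : 'CF(I)) : b \is a linear_char ->
  (exists2 d, d \in D & b d != 1) -> Psi \is a character -> D \subset cfker Psi ->
  '[b * 'Res[B] Psi, 1] = 0.
Proof.
move=> lb [d Dd bd] NP kD; have Nb := lin_charW lb.
have NR : 'Res[B] Psi \is a character by rewrite cfRes_char.
apply/eqP; rewrite eq_le cfdot_char_ge0 ?rpredM ?cfun1_char // andbT.
apply: le_trans (cfdot1_le_Res (sDB S) _) _; rewrite ?rpredM //.
rewrite cfResM (cfRes_sub_ker (phi := 'Res[B] Psi)); last exact: sub_cfker_Res (sDB S) kD.
rewrite mulr_algr cfdotZl.
suff -> : '['Res[D] b, 1] = 0 by rewrite mulr0.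
have /irrP[k ek] := lin_char_irr (cfRes_lin_char D lb).
rewrite ek -irr0 cfdot_irr; have [k0|//] := eqVneq k 0.
case/eqP: bd; have : 'Res[D] b = 1 by rewrite ek k0 irr0.
by move/cfunP/(_ d); rewrite cfResE ?sDB // cfun1E Dd.
Qed.

Lemma scalar_one (Psi : 'CF(Q)) m (ka : algC) : m \in Q ->
  {in Q, forall g, Psi (m * g)%g = ka * Psi g} -> '[Psi, 1] != 0 -> ka = 1.
Proof.
move=> Qm H nz; apply: (mulIf nz); rewrite mul1r !cfdotE mulrCA; congr (_ * _).
rewrite mulr_sumr [RHS](reindex_inj (mulgI m)).
apply: eq_big => [g|g Qg]; first by rewrite groupMl.
by rewrite H // mulrA !cfun1E Qg groupMl // Qg.
Qed.

Lemma t_inM (a d : R) : unit a -> unit d -> p * (a - 1) = 0 -> p * (d - 1) = 0 -> t a d \in M.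
Proof.
move=> u1 u2 p1 p2; rewrite inM; case: (ent_t u1 u2) => -> -> -> ->.
by rewrite p1 p2 mulr0 !eqxx.
Qed.

Lemma xi_family : exists xi : 'I_l -> 'CF(V), forall j : 'I_l, xi j \is a linear_char /\
  forall x, nunit x -> xi j (v x) = psi (p ^+ j * x).
Proof.
apply: (@fin_all_exists _ (fun=> 'CF(V)) (fun (j : 'I_l) xi => xi \is a linear_char /\
  forall x, nunit x -> xi (v x) = psi (p ^+ j * x))) => j.
by have [xi lxi e] := psiV_exists (p ^+ j); exists xi.
Qed.

Lemma V_bound (xi : 'I_l -> 'CF(V)) (al be : 'CF(Q)) :
  (forall j : 'I_l, xi j \is a linear_char /\
    forall x, nunit x -> xi j (v x) = psi (p ^+ j * x)) ->
  al \is a character -> be \is a character ->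
  (forall j, '['Res[V] be, xi j] <= 1) ->
  '[al, be] <= \sum_j '['Res[V] al, xi j].
Proof.
move=> xiP Na Nb hb; apply: (cfdot_le_restr (sVQ S)) => //.
  by move=> j; have [/lin_charW] := xiP j.
move=> c _; have [j _ H] := V_constituent (subxx Q) (irr_char c) (irr_neq0 c).
by exists j; apply: H; have [] := xiP j.
Qed.

Lemma NN_thV (b' : 'CF(B)) (th : 'CF(Q)) (xi : 'CF(V)) : b' \is a linear_char ->
  th \is a linear_char -> xi \is a linear_char ->
  '['Res[V] (th * 'Res[Q] (NN b')), xi] = 1.
Proof.
move=> lb' lth lxi; apply: cfdot_regV => //.
  by rewrite cfunE cfRes1 (lin_char1 lth) mul1r NN1.
move=> g Vg g1; have Qg := subsetP (sVQ S) g Vg.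
by rewrite cfunE cfResE ?sQI // NN_V // mulr0.
Qed.

Lemma NN_conjV (b' : 'CF(B)) (xi : 'CF(V)) : b' \is a linear_char ->
  xi \is a linear_char -> '['Res[V] (('Res[Q] (NN b'))^*)%CF, xi] = 1.
Proof.
move=> lb' lxi; apply: cfdot_regV => //.
  by rewrite cfunE cfRes1 NN1 // rmorph_nat.
move=> g Vg g1; have Qg := subsetP (sVQ S) g Vg.
by rewrite cfunE cfResE ?sQI // NN_V // rmorph0.
Qed.

(** Restricted to [V], both [th * NN b'] and the conjugate of [NN b''] are regular characters, so
    each of the [l] weights occurs exactly once in either. *)
Lemma T_le (b' b'' : 'CF(B)) (th : 'CF(Q)) : b' \is a linear_char ->
  b'' \is a linear_char -> th \is a linear_char ->
  '[th * 'Res[Q] (NN b' * NN b''), 1] <= l%:R.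
Proof.
move=> lb' lb'' lth; have [xi xiP] := xi_family.
have Nth := lin_charW lth.
have N' : 'Res[Q] (NN b') \is a character by rewrite cfRes_char ?NN_char.
have N'' : 'Res[Q] (NN b'') \is a character by rewrite cfRes_char ?NN_char.
rewrite cfResM mulrA cfdot_mul1.
apply: le_trans (V_bound xiP _ _ _) _; rewrite ?rpredM ?cfConjC_char //.
  by move=> j; have [lx _] := xiP j; rewrite NN_conjV.
rewrite (eq_bigr (fun=> 1)) ?sumr_const ?card_ord // => j _.
by have [lx _] := xiP j; rewrite NN_thV.
Qed.

(** A diagonal matrix in [M] acts on the product by the scalar on the left, which must be [1] if the
    trivial character occurs. *)
Lemma T_cond (b b' b'' : 'CF(B)) (th : 'CF(Q)) : b \is a linear_char ->
  b' \is a linear_char -> b'' \is a linear_char -> th \is a linear_char ->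
  {in Q, forall g, th g = b (t (ea g) (ed g))} ->
  '[th * 'Res[Q] (NN b' * NN b''), 1] != 0 ->
  forall a d : R, unit a -> unit d -> p * (a - 1) = 0 -> p * (d - 1) = 0 ->
  b (t a d) * b' (t a d) * b'' (t a d) = 1.
Proof.
move=> lb lb' lb'' lth thE nz a d ua ud' pa pd.
have Mt := t_inM ua ud' pa pd; have Qt := t_inQ ua ud'.
apply: (scalar_one Qt _ nz) => g Qg; have Ig := subsetP (sQI S) g Qg.
have Qtg := groupM Qt Qg; have [a1 b1 c1 d1] := ent_t ua ud'.
rewrite !cfunE !cfResE ?sQI // !cfunE (NN_scalar lb') // (NN_scalar lb'') //.
by rewrite (lin_charM lth) // (thE _ Qt) a1 d1; ring.
Qed.

End TripleProducts.

(** * Bounds for each combination of types *)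

Section Bounds.
Variable S : gl2_setting.
Local Notation R := (sR S).
Local Notation p := (@sp S).
Local Notation l := (sl S).
Local Notation q := (sq S).
Local Notation gT := (sT S).
Local Notation cR := (s_chain S).
Local Notation psi := (@spsi S).
Local Notation G := [set: gT]%G.
Local Notation nunit x := (x \isn't a GRing.unit).
Local Notation B := (Bgrp S).
Local Notation I := (Igrp S).
Local Notation Q := (Qgrp S).
Local Notation Y := (Yg S).
Local Notation V := (Vgrp S).
Local Notation D := (Dgrp S).
Local Notation M := (Mgrp S).
Implicit Types (g h : gT) (x y z : R).

Local Notation unit x := (x \is a GRing.unit).
Local Notation dd := ((q - 1) * q ^ l.-1)%N.

Local Notation snsdim := (if (l <= 1)%N then q else (q ^ 2 - 1) * q ^ (l - 2))%N.

Lemma tauC (i j k : Iirr G) : tau i j k = tau j i k.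
Proof. by rewrite /tau (mulrC 'chi_i). Qed.

Lemma tauAC (i j k : Iirr G) : tau i j k = tau i k j.
Proof. by rewrite /tau mulrAC. Qed.

Lemma tau_fix0 (i j k : Iirr G) : chi0 i 1%g = 0 -> tau i j k <= 1.
Proof.
move=> h; apply: s_gelfand; apply/eqP; move/eqP: h.
rewrite chi0E ?group1 // mulf_eq0 invr_eq0 (negPf (q_neq0 S)).
by under eq_bigr do rewrite mulg1.
Qed.

(** The degree is the smallest possible dimension of the complement of [chi0], so nothing is left
    for [chi0]. *)
Lemma tau_cus (i j k : Iirr G) : ~~ (Y \subset cfker 'chi_i) -> 'chi_i 1%g = dd%:R ->
  tau i j k <= 1.
Proof.
move=> Pi di; apply: tau_fix0; have [n en] := natrP (Cnat_char1 (chi0_char i)).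
have := chi0_dim Pi; rewrite di en => h; apply: (addrI (- dd%:R)); rewrite addr0.
apply: oppr_inj; rewrite opprD opprK -[RHS]opprK opprK; apply: h.
rewrite ltrBlDr -natrD ltr_nat ltn_addr // mul2n -addnn -[X in (X < _)%N]addn0 ltn_add2l.
by rewrite muln_gt0 subn_gt0 (chain_q cR) expn_gt0 q_gt0.
Qed.

(** The degree is below [2(q-1)q^(l-1)], which fixes the dimension of [chi0]. If [D] acted
    nontrivially, [chi_k] would be induced from a linear character of [B] and have degree
    [(q+1)q^(l-1)]. *)
Lemma sns_struct (k : Iirr G) : ~~ (Y \subset cfker 'chi_k) ->
  'chi_k 1%g = snsdim%:R ->
  [/\ 'chi_k 1%g - chi0 k 1%g = dd%:R,
    chi0 k 1%g = (if (l <= 1)%N then 1%N else ((q - 1) * q ^ (l - 2))%N)%:R &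
    D \subset cfker (chi0 k)].
Proof.
move=> Pk dk; have [n en] := natrP (Cnat_char1 (chi0_char k)); have q3 := q_ge3 S.
have l0 := chain_l cR.
set N := (if _ then _ else _) in dk.
have NE : N = (dd + if (l <= 1)%N then 1%N else ((q - 1) * q ^ (l - 2))%N)%N.
  rewrite /N; case: (leqP l 1) => l1.
    by rewrite (_ : l.-1 = 0)%N; [rewrite muln1; lia|lia].
  rewrite (_ : l.-1 = (l - 2).+1); last by lia.
  rewrite [(q ^ (l - 2).+1)%N]expnS mulnA -mulnDl; congr (_ * _)%N.
  by rewrite (expnS q 1) expn1; nia.
have lt : (N < 2 * dd)%N.
  rewrite NE mul2n -addnn ltn_add2l; case: (leqP l 1) => l1.
    by rewrite (_ : l.-1 = 0)%N; [rewrite muln1; lia|lia].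
  rewrite (_ : l.-1 = (l - 2).+1); last by lia.
  rewrite ltn_pmul2l; last by lia.
  by rewrite ltn_exp2l; lia.
have e1 : 'chi_k 1%g - chi0 k 1%g = dd%:R.
  apply: chi0_dim Pk _; rewrite dk en ltrBlDr -natrD ltr_nat; exact: ltn_addr lt.
split=> //.
  by apply: (addrI dd%:R); rewrite -natrD -NE -dk -e1 subrK.
apply: contraT => /Ind_of_D[b lb [_ e]].
move: dk; rewrite e cfInd1 ?subsetT // (lin_char1 lb) mulr1 indexGB => /eqP.
rewrite eqr_nat NE; case: (leqP l 1) => l1.
  by rewrite (_ : l.-1 = 0)%N; [rewrite !muln1; lia|lia].
rewrite (_ : l.-1 = (l - 2).+1); last by lia.
rewrite expnS !mulnA -mulnDl eqn_pmul2r ?expn_gt0 ?q_gt0 //.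
by move/eqP; nia.
Qed.

(** For [l > 1] the correction term of [whittaker_dimV] vanishes by [sns_V], so the weight with
    [j = 0] occurs [q(q-1)q^(l-2) / ((q-1)q^(l-1)) = 1] times and the others do not occur. For
    [l = 1] the character is linear and there is only one weight. *)
Lemma sns_weights (k : Iirr G) (xi : 'I_l -> 'CF(V)) : ~~ (Y \subset cfker 'chi_k) ->
  'chi_k 1%g = snsdim%:R ->
  (forall j : 'I_l, xi j \is a linear_char /\
    forall x, nunit x -> xi j (v x) = psi (p ^+ j * x)) ->
  \sum_j '['Res[V] ('Res[Q] (chi0 k))^*%CF, xi j] <= 1.
Proof.
move=> Pk dk xiP; have [_ d0 kD] := sns_struct Pk dk; have l0 := chain_l cR.
set al := cfAut _ _; have Na : al \is a character.
  by rewrite cfConjC_char cfRes_char ?chi0_char.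
have al1 : al 1%g = (if (l <= 1)%N then 1%N else ((q - 1) * q ^ (l - 2))%N)%:R.
  by rewrite cfunE cfRes1 d0 rmorph_nat.
case: (leqP l 1) d0 al1 => l1 d0 al1.
  have la : 'Res[V] al \is a linear_char by rewrite cfRes_lin_char // qualifE /= Na al1 eqxx.
  have /irrP[r ->] := lin_char_irr la.
  apply: (@le_trans _ _ (\sum_(j < l) 1)); last first.
    by rewrite sumr_const card_ord -[leRHS]/(1%:R) ler_nat.
  apply: ler_sum => j _; have [/lin_char_irr/irrP[s ->] _] := xiP j.
  by rewrite cfdot_irr -[leRHS]/(1%:R) ler_nat leq_b1.
have sns0 : \sum_(y | nunit y && (p * y == 0)) al (v y) = 0.
  have := congr1 Num.conj (sns_V l1 Pk kD); rewrite rmorph0 rmorph_sum => e0.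
  rewrite -[RHS]e0; apply: eq_big => [y|y /andP[ny _]].
    by case: eqP => [/ann_isnt_unit ->|]; rewrite ?andbF.
  rewrite cfunE cfResE ?sQI //; apply: (subsetP (sVQ S)); apply/VP; by exists y.
have dd0 : (dd%:R : algC) != 0.
  by rewrite pnatr_eq0 -lt0n muln_gt0 subn_gt0 (chain_q cR) expn_gt0 q_gt0.
rewrite (bigD1 (Ordinal l0)) //= big1 ?addr0.
  have [_ x0] := xiP (Ordinal l0).
  suff -> : '['Res[V] al, xi (Ordinal l0)] = 1 by [].
  apply: (mulfI dd0); rewrite mulr1 (whittaker_dimV al (subxx Q)); last first.
    by move=> x nx; rewrite x0 // expr0.
  rewrite sns0 subr0 al1 -natrM mulnCA -expnS; congr (_ * _ ^ _)%:R; lia.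
(* The coefficients at nonunit frequencies are nonnegative and their sum is zero by [sns0], so the
   one at [p ^+ j] vanishes. *)
move=> j j0; have [_ xj] := xiP j.
have sm := @fcoef_sum_nunit R p l q cR psi (s_psi S) (s_psiP S) 1 (fun x => al (v x)).
have nj : nunit (p ^+ j).
  have -> : nat_of_ord j = j.-1.+1.
    by rewrite prednK // lt0n; apply: contraNneq j0 => j0; apply/eqP/val_inj.
  by rewrite exprS (chain_pM_nunit cR).
apply: (mulfI (qX_neq0 S l.-1)); rewrite mulr0 (cfdot_V al (sVQ S) xj).
apply/eqP; move/eqP: sm.
have -> : \sum_(y in [set p ^+ 1 * x | x : R] | p * y == 0) al (v y) = 0.
  by rewrite -[RHS]sns0; apply: eq_bigl => y; rewrite nunitE.
rewrite mulr0 psumr_eq0; first by move/allP/(_ _ (mem_index_enum (p ^+ j))); rewrite nj.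
move=> a _; have [xa la ea] := psiV_exists a.
rewrite -(cfdot_V al (sVQ S) ea); apply: mulr_ge0; first exact: ler0n.
apply: cfdot_char_ge0; [exact: cfRes_char|exact: lin_charW].
Qed.

(** The hypothesis says that [b] is trivial on the squares of elements of [D], and every element of
    [D] is such a square. *)
Lemma D_square (b : 'CF(B)) : b \is a linear_char ->
  (forall n : R, unit n -> p * (n - 1) = 0 -> b (t n^-1 n) * b (t n^-1 n) = 1) ->
  (1 < l)%N -> {in D, forall d, b d = 1}.
Proof.
move=> lb h l1 d Dd; have [ua ud'] := DunitP Dd.
have := Dd; rewrite inD => /and4P[_ _ /eqP ad /eqP pa].
have u2 := chain_two cR.
(* First order square root: [n - 1] is half of [ed d - 1], and its square vanishes for [l > 1]. *)
pose n : R := (ed d + 1) / 2%:R.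
have pd : p * (ed d - 1) = 0.
  have -> : ed d - 1 = - (ea d - 1) * ed d by rewrite mulNr mulrBl ad mul1r opprB.
  by rewrite mulrA mulrN pa oppr0 mul0r.
have nE : n - 1 = (ed d - 1) / 2%:R.
  apply: (mulIr u2); rewrite mulrBl !divrK // mul1r mulr2n; ring.
have pn : p * (n - 1) = 0 by rewrite nE mulrA pd mul0r.
have un : unit n.
  rewrite -[n](subrK 1) addrC unitD ?unitr1 //; exact: ann_isnt_unit l1 pn.
have nn : n * n = ed d.
  have n0 : (n - 1) * (n - 1) = 0 by apply: ann_mul.
  have -> : n * n = (n - 1) * (n - 1) + (2%:R * (n - 1) + 1) by ring.
  by rewrite n0 add0r nE mulrC divrK // subrK.
have dE : d = (t n^-1%R n * t n^-1%R n)%g.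
  have e : n^-1 * n^-1 = ea d.
    by apply: (mulIr ud'); rewrite ad -nn mulrACA mulVr // mulr1.
  by rewrite {1}(DE Dd) tM ?unitrV // e nn.
by rewrite dE (lin_charM lb) ?t_inB ?unitrV // h.
Qed.

(** The roles in [V_bound] are exchanged: the character regular on [V] serves as the bound, and the
    sns factor carries at most one weight in total. *)
Lemma term_sns_le (k : Iirr G) (b' : 'CF(B)) (th : 'CF(Q)) :
  ~~ (Y \subset cfker 'chi_k) ->
  'chi_k 1%g = snsdim%:R ->
  b' \is a linear_char -> th \is a linear_char ->
  '[th * 'Res[Q] (NN b' * chi0 k), 1] <= 1.
Proof.
move=> Pk dk lb' lth; have [xi xiP] := xi_family S.
have Nth := lin_charW lth.
have N' : 'Res[Q] (NN b') \is a character by rewrite cfRes_char ?NN_char.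
have Nk : 'Res[Q] (chi0 k) \is a character by rewrite cfRes_char ?chi0_char.
rewrite cfResM mulrA cfdot_mul1 cfdotC_char ?rpredM ?cfConjC_char //.
apply: le_trans (V_bound xiP _ _ _) (sns_weights Pk dk xiP); rewrite ?rpredM ?cfConjC_char //.
by move=> j; have [lx _] := xiP j; rewrite NN_thV.
Qed.

Lemma tau_ss_sns_sns (i j k : Iirr G) : ~~ (Y \subset cfker 'chi_i) ->
  ~~ (Y \subset cfker 'chi_j) -> ~~ (Y \subset cfker 'chi_k) ->
  'chi_i 1%g = (q.+1 * q ^ l.-1)%:R ->
  'chi_j 1%g = snsdim%:R ->
  'chi_k 1%g = snsdim%:R ->
  tau i j k <= 1.
Proof.
move=> Pi Pj Pk di dj dk; have [e|nz] := eqVneq (chi0 i 1%g) 0; first exact: tau_fix0.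
have [b [bw sd]] := ss_struct Pi di nz.
have [ej _ kj] := sns_struct Pj dj; have [ek _ kk] := sns_struct Pk dk.
apply: le_trans (tau_le sd ej ek) _; have [lb _ _ _ [bD _]] := sd.
rewrite triv_D_zero ?addr0 ?rpredM ?chi0_char //.
by apply: subset_trans (cfker_mul _ _); rewrite subsetI kj.
Qed.

Lemma chi1_ss (i : Iirr G) : ~~ (Y \subset cfker 'chi_i) ->
  'chi_i 1%g = (q.+1 * q ^ l.-1)%:R -> chi0 i 1%g != 0 -> 'chi_i 1%g - chi0 i 1%g = dd%:R.
Proof.
move=> Pi di nz; have [-> _] := ss_D Pi di nz; rewrite di -natrB ?leq_mul2r; last first.
  by apply/orP; right; have := q_ge3 S; lia.
by rewrite -mulnBl; congr (_ * _)%:R; have := q_ge3 S; lia.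
Qed.

(** Besides the generic contribution there are two terms, from [NN b'] and [NN b'w], each at most
    [1]. A common element of [M] acting by a known scalar on [chi0 k] shows that they cannot both be
    nonzero. *)
Lemma tau_ss_ss_sns (i j k : Iirr G) : ~~ (Y \subset cfker 'chi_i) ->
  ~~ (Y \subset cfker 'chi_j) -> ~~ (Y \subset cfker 'chi_k) ->
  'chi_i 1%g = (q.+1 * q ^ l.-1)%:R -> 'chi_j 1%g = (q.+1 * q ^ l.-1)%:R ->
  'chi_k 1%g = snsdim%:R ->
  tau i j k <= 2.
Proof.
move=> Pi Pj Pk di dj dk.
have [e|nzi] := eqVneq (chi0 i 1%g) 0; first exact: le_trans (tau_fix0 _ _ e) (ler1n _ 2).
have [e|nzj] := eqVneq (chi0 j 1%g) 0.
  by rewrite tauC; exact: le_trans (tau_fix0 _ _ e) (ler1n _ 2).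
have [b [bw sd]] := ss_struct Pi di nzi; have [b' [b'w sd']] := ss_struct Pj dj nzj.
have [ek d0 kk] := sns_struct Pk dk.
apply: le_trans (tau_le sd (chi1_ss Pj dj nzj) ek) _; rewrite [leRHS](natrD _ 1 1) lerD2l.
have [lb _ _ _ [_ [_ iN _]]] := sd.
have [lb' lb'w ew [a [ua pa ba]] [[d Dd bd] [_ _ ej]]] := sd'.
have [th lth thE] := theta_exists lb.
apply: le_trans (to_Q lb lth thE iN _) _; first by rewrite rpredM ?chi0_char.
rewrite ej mulrDl cfResD mulrDr cfdotDl.
have [->|nz] := eqVneq ('[th * 'Res[Q] (NN b' * chi0 k), 1]) 0.
  by rewrite add0r term_sns_le.
suff -> : '[th * 'Res[Q] (NN b'w * chi0 k), 1] = 0 by rewrite addr0 term_sns_le.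
apply/eqP; apply: contraT => nz'.
have scal (b1 : 'CF(B)) (m : gT) ka : b1 \is a linear_char -> m \in M -> m \in Q ->
    {in I, forall g, chi0 k (m * g)%g = ka * chi0 k g} ->
    '[th * 'Res[Q] (NN b1 * chi0 k), 1] != 0 -> b (t (ea m) (ed m)) * b1 m * ka = 1.
  move=> lb1 Mm Qm hk; apply: (scalar_one Qm) => g Qg; have Ig := subsetP (sQI S) g Qg.
  rewrite !cfunE !cfResE ?sQI ?groupM // !cfunE (NN_scalar lb1) // hk //.
  by rewrite (lin_charM lth) // (thE _ Qm); ring.
(* For [l = 1] the character [chi0 k] is linear, so [t a 1] acts on it by a nonzero scalar that
   cancels in the comparison. *)
have [l1|l1] := leqP l 1.
  have lk : chi0 k \is a linear_char by rewrite qualifE /= chi0_char d0 l1 eqxx.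
  have Mt := t_inM ua (unitr1 R) pa (etrans (congr1 _ (subrr 1)) (mulr0 p)).
  have Qt := t_inQ ua (unitr1 R); have It := subsetP (sQI S) _ Qt.
  have hk : {in I, forall g, chi0 k (t a 1%R * g)%g = chi0 k (t a 1) * chi0 k g}.
    by move=> g Ig; rewrite (lin_charM lk).
  have h1 := scal _ _ _ lb' Mt Qt hk nz; have h2 := scal _ _ _ lb'w Mt Qt hk nz'.
  case/eqP: ba; rewrite -(ew a 1) ?unitr1 //.
  move: h1; rewrite -h2 => /(mulIf _); rewrite (lin_char_neq0 lk) // => /(_ isT).
  move/(mulfI _); apply; rewrite (lin_char_neq0 lb) //.
  by case: (ent_t ua (unitr1 R)) => -> _ _ ->; rewrite t_inB ?unitr1.
(* For [l > 1] only [D] is known to act by scalars on [chi0 k]. Comparing the two terms gives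
   [b' d = b' d^-1] on [D], so [b'] is trivial there. *)
case/eqP: bd; apply: (D_square lb') => // n un pn.
have Dn := t_inD un pn; have un' : unit n^-1 by rewrite unitrV.
have Bn := subsetP (sDB S) _ Dn.
have pn' : p * (n^-1 - 1) = 0.
  have -> : n^-1 - 1 = - (n - 1) * n^-1 by rewrite mulNr mulrBl mulrV // mul1r opprB.
  by rewrite mulrA mulrN pn oppr0 mul0r.
have Mt := t_inM un' un pn' pn; have Qt := t_inQ un' un.
have hk : {in I, forall g, chi0 k (t n^-1%R n * g)%g = 1 * chi0 k g}.
  by move=> g Ig; rewrite mul1r cfkerMl // (subsetP kk _ Dn).
have := scal _ _ _ lb' Mt Qt hk nz; have := scal _ _ _ lb'w Mt Qt hk nz'.
rewrite ew // !mulr1; case: (ent_t un' un) => -> _ _ -> h2 h1.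
have e1 : b' (t n^-1 n) * b' (t n n^-1) = 1.
  by rewrite -(lin_charM lb') ?t_inB // tM // mulVr ?mulrV // [t 1 1]s_one (lin_char1 lb').
rewrite -{1}e1; congr (_ * _); apply: (mulfI _ (etrans h1 (esym h2))).
by rewrite (lin_char_neq0 lb).
Qed.

Lemma sum4_le (a b c d x : algC) : 0 <= x -> a <= x -> b <= x -> c <= x -> d <= x ->
  (a != 0 -> b != 0 -> False) -> (a != 0 -> c != 0 -> False) ->
  (a != 0 -> d != 0 -> False) -> (b != 0 -> c != 0 -> False) ->
  (b != 0 -> d != 0 -> False) -> (c != 0 -> d != 0 -> False) -> a + b + (c + d) <= x.
Proof.
move=> x0 ax bx cx dx; have [->|_] := eqVneq a 0; have [->|_] := eqVneq b 0;
  have [->|_] := eqVneq c 0; have [->|_] := eqVneq d 0; rewrite ?add0r ?addr0 //;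
  by move=> h1 h2 h3 h4 h5 h6; exfalso; auto.
Qed.

(** At most one of the four products of halves survives. If two of them differ in one factor,
    [T_cond] makes that factor agree at [t a 1] and [t 1 a]; if they differ in both, evaluating one
    at [t a 1] and the other at [t 1 a] makes [b] agree there. Either contradicts [ss_data]. *)
Lemma tau_ss_ss_ss (i j k : Iirr G) : ~~ (Y \subset cfker 'chi_i) ->
  ~~ (Y \subset cfker 'chi_j) -> ~~ (Y \subset cfker 'chi_k) ->
  'chi_i 1%g = (q.+1 * q ^ l.-1)%:R -> 'chi_j 1%g = (q.+1 * q ^ l.-1)%:R ->
  'chi_k 1%g = (q.+1 * q ^ l.-1)%:R -> tau i j k <= (l + 1)%:R.
Proof.
move=> Pi Pj Pk di dj dk; have le1 : (1 : algC) <= (l + 1)%:R by rewrite ler1n addn1.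
have [e|nzi] := eqVneq (chi0 i 1%g) 0; first exact: le_trans (tau_fix0 _ _ e) le1.
have [e|nzj] := eqVneq (chi0 j 1%g) 0.
  by rewrite tauC; exact: le_trans (tau_fix0 _ _ e) le1.
have [e|nzk] := eqVneq (chi0 k 1%g) 0.
  by rewrite tauAC tauC; exact: le_trans (tau_fix0 _ _ e) le1.
have [b [bw sd]] := ss_struct Pi di nzi; have [b' [b'w sd']] := ss_struct Pj dj nzj.
have [b'' [b''w sd'']] := ss_struct Pk dk nzk.
apply: le_trans (tau_le sd (chi1_ss Pj dj nzj) (chi1_ss Pk dk nzk)) _.
rewrite addnC natrD lerD2l.
have [lb _ _ [a [ua pa ba]] [_ [_ iN _]]] := sd.
have [lb' lb'w ew' [a' [ua' pa' ba']] [_ [_ _ ej]]] := sd'.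
have [lb'' lb''w ew'' [a'' [ua'' pa'' ba'']] [_ [_ _ ek]]] := sd''.
have [th lth thE] := theta_exists lb.
apply: le_trans (to_Q lb lth thE iN _) _; first by rewrite rpredM ?chi0_char.
rewrite ej ek mulrDl !mulrDr !cfResD !mulrDr !cfdotDl.
have p1 : p * (1 - 1) = 0 by rewrite subrr mulr0.
have u1 := unitr1 R.
have nz (c : 'CF(B)) (x y : R) : c \is a linear_char -> unit x -> unit y -> c (t x y) != 0.
  by move=> lc ux uy; rewrite (lin_char_neq0 lc) ?t_inB.
apply: sum4_le; rewrite ?ler0n ?T_le //.
- move=> /T_cond h1 /T_cond h2; case/eqP: ba''; rewrite -(ew'' a'' 1) //.
  have := h1 _ lb lb' lb'' lth thE a'' 1 ua'' u1 pa'' p1.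
  rewrite -(h2 _ lb lb' lb''w lth thE a'' 1 ua'' u1 pa'' p1).
  by move/(mulfI _); apply; rewrite mulf_neq0 ?nz.
- move=> /T_cond h1 /T_cond h2; case/eqP: ba'; rewrite -(ew' a' 1) //.
  have := h1 _ lb lb' lb'' lth thE a' 1 ua' u1 pa' p1.
  rewrite -(h2 _ lb lb'w lb'' lth thE a' 1 ua' u1 pa' p1).
  by move/(mulIf _) => /(_ (nz _ _ _ lb'' ua' u1)) /(mulfI _); apply; rewrite nz.
- move=> /T_cond h1 /T_cond h2; case/eqP: ba.
  have := h2 _ lb lb'w lb''w lth thE a 1 ua u1 pa p1; rewrite ew' // ew'' //.
  rewrite -(h1 _ lb lb' lb'' lth thE 1 a u1 ua p1 pa).
  by move/(mulIf _) => /(_ (nz _ _ _ lb'' u1 ua)) /(mulIf _); apply; rewrite nz.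
- move=> /T_cond h1 /T_cond h2; case/eqP: ba.
  have := h2 _ lb lb'w lb'' lth thE 1 a u1 ua p1 pa; rewrite ew' //.
  have := h1 _ lb lb' lb''w lth thE a 1 ua u1 pa p1; rewrite ew'' // => <-.
  by move/(mulIf _) => /(_ (nz _ _ _ lb'' u1 ua)) /(mulIf _) e; rewrite e ?nz.
- move=> /T_cond h1 /T_cond h2; case/eqP: ba'; rewrite -(ew' a' 1) //.
  have := h1 _ lb lb' lb''w lth thE a' 1 ua' u1 pa' p1.
  rewrite -(h2 _ lb lb'w lb''w lth thE a' 1 ua' u1 pa' p1).
  by move/(mulIf _) => /(_ (nz _ _ _ lb''w ua' u1)) /(mulfI _); apply; rewrite nz.
- move=> /T_cond h1 /T_cond h2; case/eqP: ba''; rewrite -(ew'' a'' 1) //.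
  have := h1 _ lb lb'w lb'' lth thE a'' 1 ua'' u1 pa'' p1.
  rewrite -(h2 _ lb lb'w lb''w lth thE a'' 1 ua'' u1 pa'' p1).
  by move/(mulfI _); apply; rewrite mulf_neq0 ?nz.
Qed.

End Bounds.

(** * The claims for [GL_2] *)

Definition mult_claims (x : algC) (l : nat) (a b c : ttype) :=
  [/\ (a = cus \/ b = cus \/ c = cus) -> x <= 1,
      exactly_two_types a b c -> x <= 2 /\ (x = 2 -> perm_ss_sns_ss a b c)
    & (a = ss /\ b = ss /\ c = ss) -> x <= (l + 1)%:R].

Lemma mult_claims_le1 x l a b c : x <= 1 -> mult_claims x l a b c.
Proof.
move=> h; split=> // [_|_]; last by apply: le_trans h _; rewrite ler1n addn1.
split=> [|e]; first exact: le_trans h (ler1n _ 2).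
by move: h; rewrite e -[leRHS]/(1%:R) ler_nat.
Qed.

Section Claims.
Variable S : gl2_setting.
Local Notation R := (sR S).
Local Notation p := (@sp S).
Local Notation l := (sl S).
Local Notation q := (sq S).
Local Notation gT := (sT S).
Local Notation cR := (s_chain S).
Local Notation G := [set: gT]%G.
Local Notation Y := (Yg S).
Local Notation K := (Kgrp S).
Implicit Types (g h : gT) (x y z : R).

Lemma type_dimE (a : ttype) : type_dim q l a = match a with
  | cus => (q - 1) * q ^ l.-1
  | ss => q.+1 * q ^ l.-1
  | sns => if (l <= 1)%N then q else (q ^ 2 - 1) * q ^ (l - 2)
  end%N.
Proof.
rewrite /type_dim (subn1 l); case: leqP => // l1.
have -> : l.-1 = 0%N by have := chain_l cR; lia.
by case: a; rewrite ?expn0 ?muln1.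
Qed.

Lemma tau_claims (i j k : Iirr G) (a b c : ttype) : ~~ (Y \subset cfker 'chi_i) ->
  ~~ (Y \subset cfker 'chi_j) -> ~~ (Y \subset cfker 'chi_k) ->
  has_type q l i a -> has_type q l j b -> has_type q l k c ->
  mult_claims (tau i j k) l a b c.
Proof.
move=> Pi Pj Pk; rewrite /has_type !type_dimE => di dj dk.
case: a di => di; first by apply: mult_claims_le1; apply: tau_cus.
- case: b dj => dj; first by apply: mult_claims_le1; rewrite tauC; apply: tau_cus.
  + case: c dk => dk; first by apply: mult_claims_le1; rewrite tauAC tauC; apply: tau_cus.
    * split=> [[|[]]|[[]]|_] //; exact: tau_ss_ss_ss.
    * split=> [[|[]]|_|[_ []]] //; split; first exact: tau_ss_ss_sns.
      by right; left.
  + case: c dk => dk; first by apply: mult_claims_le1; rewrite tauAC tauC; apply: tau_cus.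
    * split=> [[|[]]|_|[_ []]] //; split; first by rewrite tauAC; apply: tau_ss_ss_sns.
      by left.
    * by apply: mult_claims_le1; apply: tau_ss_sns_sns.
- case: b dj => dj; first by apply: mult_claims_le1; rewrite tauC; apply: tau_cus.
  + case: c dk => dk; first by apply: mult_claims_le1; rewrite tauAC tauC; apply: tau_cus.
    * split=> [[|[]]|_|[]] //; split; first by rewrite tauC tauAC; apply: tau_ss_ss_sns.
      by right; right.
    * by apply: mult_claims_le1; rewrite tauC; apply: tau_ss_sns_sns.
  + case: c dk => dk; first by apply: mult_claims_le1; rewrite tauAC tauC; apply: tau_cus.
    * by apply: mult_claims_le1; rewrite tauAC tauC; apply: tau_ss_sns_sns.
    * by split=> [[|[]]|[[]]|[]].
Qed.

Lemma ker_Y_K (i : Iirr G) : Y \subset cfker 'chi_i -> K \subset cfker 'chi_i.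
Proof. exact: normal_closure_Y (cfker_normal _). Qed.

(** For [l = 1] the subgroup [K] is [SL_2(R)], which contains all commutators. *)
Lemma ker_Y_lin (i : Iirr G) : l = 1%N -> Y \subset cfker 'chi_i -> 'chi_i 1%g = 1.
Proof.
move=> l1 kY; apply: lin_char1; rewrite lin_irr_der1 derg1 gen_subG.
apply: subset_trans (ker_Y_K kY); apply/subsetP => _ /imset2P[g h _ _ ->].
have e : edet [~ g, h]%g = 1.
  by rewrite commgEl edetM edetJ -edetM mulVg edet1.
by rewrite inK -/(edet _) e (p_eq0 l1) !mul0r !eqxx.
Qed.

(** When [p] kills [N] and [l > 1], products of entries of [N] vanish, so the determinant of [1 + N]
    is [1] plus the trace of [N]. *)
Lemma trace0_inK g : (1 < l)%N -> p * (ea g - 1) = 0 -> p * eb g = 0 -> p * ec g = 0 ->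
  ea g + ed g = 2%:R -> g \in K.
Proof.
move=> l1 pa pb pc e; have ed' : ed g = 1 - (ea g - 1).
  by rewrite -[ed g](addKr (ea g)) e mulr2n; ring.
have pd : p * (ed g - 1) = 0 by rewrite ed' addrAC subrr add0r mulrN pa oppr0.
rewrite inK pa pb pc pd !eqxx !andbT ed' (ann_mul l1 pb pc).
have -> : ea g * (1 - (ea g - 1)) - 0 = 1 - (ea g - 1) * (ea g - 1) by ring.
by rewrite (ann_mul l1 pa pa) subr0.
Qed.

End Claims.

(* Summing over the scalar matrices r leaves the elements of trace zero, on which the
   character is constant. *)
Lemma occurs_of_trace0 (R : finComUnitRingType) (p : R) (l q : nat) (psi : R -> algC)
    (gT : finGroupType) (L : {group gT}) (Kc : {set gT}) (f : gT -> R) (i : Iirr L) :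
  chain_ring p l q -> is_add_char psi -> (exists x, psi (p ^+ l.-1 * x) != 1) ->
  1%g \in Kc -> f 1%g = 0 -> {in Kc, forall g, f g = 0 -> g \in cfker 'chi_i} ->
  exists r : R, \sum_(g in Kc) 'chi_i g * (psi (r * f g))^* != 0.
Proof.
move=> cR psiA psiP K1 f1 kK; apply/existsP; apply: contraT; rewrite negb_exists => /forallP h.
have : \sum_r \sum_(g in Kc) 'chi_i g * (psi (r * f g))^* = 0.
  by apply: big1 => r _; apply/eqP; have := h r; rewrite negbK.
rewrite exchange_big (eq_bigr (fun g => 'chi_i 1%g * (#|R|%:R *+ (f g == 0)))) => [|g Kg].
  move/eqP; rewrite psumr_eq0 => [/allP/(_ 1%g (mem_index_enum _))|g _].
    rewrite K1 f1 eqxx mulr1n mulf_eq0 (negPf (irr1_neq0 i)) pnatr_eq0.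
    by move/eqP/card0_eq/(_ 0).
  by rewrite mulr_ge0 ?mulrn_wge0 ?ler0n // char1_ge0 ?irr_char.
rewrite -mulr_sumr (sum_add_char cR psiA psiP); case: eqP => [f0|_]; last by rewrite !mulr0n !mulr0.
by rewrite (cfker1 (kK g Kg f0)).
Qed.

Section GL2.
Variables (R : finComUnitRingType) (p : R) (l q : nat).
Hypothesis cR : chain_ring p l q.
Variable psi : R -> algC.
Hypotheses (psiH : is_add_char psi) (psiP : exists x, psi (p ^+ l.-1 * x) != 1).

Lemma gl2_ent (a b c d : R) : a * d - b * c \is a GRing.unit ->
  [/\ GLval (gl2 a b c d) 0 0 = a, GLval (gl2 a b c d) 0 1 = b,
      GLval (gl2 a b c d) 1 0 = c & GLval (gl2 a b c d) 1 1 = d].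
Proof. by move=> h; rewrite gl2K // !mx2E. Qed.

Lemma gl2_mulE (g h : {'GL_2[R]}) :
  [/\ GLval (g * h)%g 0 0 = GLval g 0 0 * GLval h 0 0 + GLval g 0 1 * GLval h 1 0,
      GLval (g * h)%g 0 1 = GLval g 0 0 * GLval h 0 1 + GLval g 0 1 * GLval h 1 1,
      GLval (g * h)%g 1 0 = GLval g 1 0 * GLval h 0 0 + GLval g 1 1 * GLval h 1 0 &
      GLval (g * h)%g 1 1 = GLval g 1 0 * GLval h 0 1 + GLval g 1 1 * GLval h 1 1].
Proof. by rewrite GL_MxE !mulmx2. Qed.

Definition GL2_setting : gl2_setting :=
  @Gl2Setting R p l q cR {'GL_2[R]} (@gl2 R)
    (fun g => GLval g 0 0) (fun g => GLval g 0 1)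
    (fun g => GLval g 1 0) (fun g => GLval g 1 1)
    (@gl2_unit R) (@gl2_eta R) gl2_ent gl2_mulE (@gl2_1 R) psi psiH psiP
    (@triple_mult_le1 R p l q cR).

Definition generic (i : Iirr 'GL_2[R]%G) : Prop := ~~ (Yg GL2_setting \subset cfker 'chi_i).

(** Passing to the dual of the third character makes the multiplicity symmetric, and changes neither
    its degree nor its kernel. *)
Lemma generic_claims (i j k : Iirr 'GL_2[R]%G) (a b c : ttype) :
  generic i -> generic j -> generic k ->
  has_type q l i a -> has_type q l j b -> has_type q l k c ->
  mult_claims (tensor_mult i j k) l a b c.
Proof.
move=> gi gj gk hi hj hk.
have e : tensor_mult i j k = '['chi_i * 'chi_j * 'chi_(conjC_Iirr k), 1].
  by rewrite cfdot_mul1 conjC_IirrE cfConjCK.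
have gk' : generic (conjC_Iirr k) by rewrite /generic conjC_IirrE cfker_aut.
have hk' : has_type q l (conjC_Iirr k) c.
  by rewrite /has_type conjC_IirrE cfunE hk rmorph_nat.
by rewrite e; apply: (@tau_claims GL2_setting i j (conjC_Iirr k) a b c).
Qed.

(** If [Y] is in the kernel then so is [K]. For [l > 1] the trace-zero elements of the congruence
    subgroup lie in [K], and some [psi_A] with [A] scalar must occur; for [l = 1] the character is
    linear. *)
Lemma regular_generic (i : Iirr 'GL_2[R]%G) :
  regular_rep 'GL_2[R]%G predT psi p l i -> generic i.
Proof.
rewrite /regular_rep /generic => reg; apply/negP => kY; move: reg.
have l0 := chain_l cR; case: ifP => [l1 /eqP[]|].
  apply: (@ker_Y_lin GL2_setting i _ kY); apply/eqP; rewrite eqn_leq l1; exact: l0.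
move/negbT; rewrite -ltnNge => l1 reg.
have kK := @ker_Y_K GL2_setting i kY.
have [|||r] := @occurs_of_trace0 R p l q psi _ 'GL_2[R]%G (Kcong 'GL_2[R]%G p l)
  (fun g => \tr (GLval g - 1%:M)) i cR psiH psiP.
- by rewrite inE group1; apply/existsP; exists 0; rewrite GL_1E scaler0 addr0.
- by rewrite GL_1E subrr mxtrace0.
- move=> g; rewrite inE => /andP[_ /existsP[X /eqP eg]]; rewrite tr_mx2 => tr0.
  have ent a b : GLval g a b = (a == b)%:R + p ^+ l.-1 * X a b by rewrite eg !mxE.
  have ann a b : p * (p ^+ l.-1 * X a b) = 0 by rewrite mulrA (chain_pP cR) mul0r.
  apply: (subsetP kK); apply: (@trace0_inK GL2_setting g l1).
  + by rewrite /= ent eqxx addrAC subrr add0r.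
  + by rewrite /= ent add0r.
  + by rewrite /= ent add0r.
  + by move/eqP: tr0; rewrite !mxE addrACA -opprD subr_eq0 => /eqP.
move=> nz; apply: (reg r%:M isT).
  rewrite /occurs_in; congr (_ != 0): nz; apply: eq_bigr => g _.
  by rewrite /psiA mul_scalar_mx mxtraceZ.
by exists r, 0; rewrite scaler0 addr0.
Qed.

Lemma GL2_claims :
  tensor_claims 'GL_2[R]%G (regular_rep 'GL_2[R]%G predT psi p l) q l.
Proof.
move=> i j k /regular_generic gi /regular_generic gj /regular_generic gk a b c ha hb hc.
exact: generic_claims.
Qed.

End GL2.

(** * Quotients of complete discrete valuation rings *)

Section CDVR.
Variables (O : idomainType) (pi : O) (F : finFieldType) (red : {rmorphism O -> F}).
Hypothesis cdvr : is_cdvr pi.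
Hypothesis redS : forall y : F, exists x : O, red x = y.
Hypothesis redK : forall x : O, red x = 0 <-> exists y : O, x = pi * y.
Hypothesis oddF : odd #|F|.

Lemma red_unit x : red x != 0 -> x \is a GRing.unit.
Proof.
have [_ _ fact _] := cdvr => nz.
have x0 : x != 0 by apply: contraNneq nz => ->; rewrite rmorph0.
have [[|n] [u uu e]] := fact x x0; first by rewrite e expr0 mulr1.
case/eqP: nz; apply/redK; exists (u * pi ^+ n).
by rewrite e exprS mulrCA.
Qed.

Lemma card_odd_two : (2%:R : F) != 0.
Proof.
apply/eqP=> e; have := oddF; rewrite -cardsT.
have o2 : (#[1%R : F]%g %| 2)%N by rewrite order_dvdn FinRing.zmodXgE e FinRing.zmod1gE.
have o1 : (#[1%R : F]%g != 1)%N by rewrite order_eq1 FinRing.zmod1gE oner_eq0.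
have : (#[1%R : F]%g %| #|[set: F]|)%N by apply: order_dvdG; rewrite inE.
have -> : #[1%R : F]%g = 2.
  by move: o2 o1; rewrite dvdn_divisors //= !inE => /orP[] /eqP ->.
by rewrite dvdn2 => /negPf ->.
Qed.

Lemma two_unit : (2%:R : O) \is a GRing.unit.
Proof. by apply: red_unit; rewrite rmorph_nat card_odd_two. Qed.

Lemma pi_cap x : (forall n, exists y, x = pi ^+ n * y) -> x = 0.
Proof.
have [pi0 piU fact _] := cdvr => h; apply/eqP; apply: contraT => /fact[n [u uu e]].
have [y ey] := h n.+1; case/negP: piU; move: uu.
have -> : u = pi * y.
  apply: (mulIf (expf_neq0 n pi0)); rewrite -e ey exprS; ring.
by rewrite unitrM => /andP[].
Qed.

(** Newton's iteration: by [stepE] the new error is the square of the correction, so the [n]-th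
    iterate is a root modulo [pi ^+ n.+1], and completeness provides the limit. *)
Lemma hensel_sqrt th x : th \is a GRing.unit -> red (x * x - th) = 0 ->
  exists y, y * y = th.
Proof.
have [_ _ _ cmpl] := cdvr => uth rx.
have rth : red th != 0 by rewrite -unitfE rmorph_unit.
pose step y := y - (y * y - th) / (2%:R * y).
have stepE y : y \is a GRing.unit -> step y * step y - th = ((y * y - th) / (2%:R * y)) ^+ 2.
  move=> uy; have u2y : 2%:R * y \is a GRing.unit by rewrite unitrM two_unit.
  have e : (y * y - th) / (2%:R * y) * (2%:R * y) = y * y - th by rewrite divrK.
  rewrite /step; move: e; set z := _ / _ => e.
  have -> : (y - z) * (y - z) - th = y * y - th - z * (2%:R * y) + z ^+ 2 by ring.
  by rewrite e subrr add0r.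
have inv n : exists2 y, iter n step x * iter n step x - th = pi ^+ n.+1 * y &
    iter n step x \is a GRing.unit.
  have key z : red (z * z - th) = 0 -> z \is a GRing.unit.
    move=> rz; apply: red_unit; apply: contraNneq rth => z0.
    by move/eqP: rz; rewrite rmorphB rmorphM z0 mul0r sub0r oppr_eq0.
  elim: n => [|n [y ey uy]].
    by have [y ey] := (redK _).1 rx; exists y; rewrite ?expr1 //; apply: key.
  have e : step (iter n step x) * step (iter n step x) - th =
      pi ^+ n.+2 * (pi ^+ n * (y / (2%:R * iter n step x)) ^+ 2).
    by rewrite stepE // ey -mulrA exprMn mulrA -exprD -exprM; congr (pi ^+ _ * _); lia.
  exists (pi ^+ n * (y / (2%:R * iter n step x)) ^+ 2) => //=; apply: key.
  by rewrite e; apply/redK; eexists; rewrite exprS -mulrA.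
have [n|b hb] := cmpl (fun n => iter n step x).
  have [y ey uy] := inv n; exists (- (pi * (y / (2%:R * iter n step x)))).
  by rewrite /= {1}/step ey addrAC subrr add0r mulrN exprSr -!mulrA.
exists b; apply/eqP; rewrite -subr_eq0; apply/eqP; apply: pi_cap => n.
have [y ey] := hb n; have [z ez _] := inv n.
exists (y * (b + iter n step x) + pi * z).
rewrite mulrDr mulrA -ey mulrA -exprSr -ez; ring.
Qed.

Variables (l : nat) (R : finComUnitRingType) (f : {rmorphism O -> R}).
Hypothesis l0 : (1 <= l)%N.
Hypothesis fS : forall y : R, exists x : O, f x = y.
Hypothesis fK : forall x : O, f x = 0 <-> exists y : O, x = pi ^+ l * y.

Lemma quot_pi_nil : f pi ^+ l = 0.
Proof. by rewrite -rmorphXn; apply/fK; exists 1; rewrite mulr1. Qed.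

Lemma quot_pi_nunit : f pi \isn't a GRing.unit.
Proof. by apply/negP => /(unitrX l); rewrite quot_pi_nil unitr0. Qed.

Lemma quot_unit x : (f x \is a GRing.unit) = (red x != 0).
Proof.
apply/idP/idP => [|/red_unit]; last exact: rmorph_unit.
apply: contraTneq => /redK[y ->]; rewrite rmorphM unitrM negb_and.
by rewrite quot_pi_nunit.
Qed.

Lemma quot_pi_neq0 i : (i < l)%N -> f pi ^+ i != 0.
Proof.
have [pi0 piU _ _] := cdvr => il; apply: contraNneq piU; rewrite -rmorphXn => /fK[y e].
have : (1 : O) \is a GRing.unit by rewrite unitr1.
have -> : (1 : O) = pi * (pi ^+ (l - i).-1 * y).
  apply: (mulfI (expf_neq0 i pi0)); rewrite mulr1 {1}e !mulrA -exprSr -exprD.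
  by congr (pi ^+ _ * _); lia.
by rewrite unitrM => /andP[].
Qed.

(** Induction on [l - i]: a set-theoretic section [s] of the reduction identifies the ideal of
    [f pi ^+ i] with the product of [F] and the ideal of the next power. *)
Lemma quot_card i : (i <= l)%N -> #|[set f pi ^+ i * x | x : R]| = (#|F| ^ (l - i))%N.
Proof.
move=> il; rewrite -{1}(subKn il); have := leq_subr i l; move: (l - i)%N => n {i il}.
elim: n => [|n IHn] nl.
  rewrite subn0 expn0; apply/eqP/cards1P; exists 0; apply/setP=> x; rewrite inE.
  apply/imsetP/eqP => [[y _ ->]|->]; first by rewrite quot_pi_nil mul0r.
  by exists 0; rewrite ?mulr0.
have nl' := ltnW nl; have iE : (l - n)%N = (l - n.+1).+1 by lia.
move: IHn => /(_ nl'); rewrite iE => IHn; set i := (l - n.+1)%N in iE IHn *.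
have sP y : exists x, red x == y by have [x /eqP] := redS y; exists x.
pose s y := xchoose (sP y); have sE y : red (s y) = y by apply/eqP/(xchooseP (sP y)).
set I1 := [set _ | x in _] in IHn.
pose h (yz : F * R) := f pi ^+ i * f (s yz.1) + yz.2.
rewrite expnS -IHn -[#|F|]cardsT -cardsX -(card_in_imset (f := h)).
  apply: eq_card => x; apply/imsetP/imsetP=> [[r _ ->]|[[y z]]].
    have [t <-] := fS r.
    have [w ew] : exists w, t - s (red t) = pi * w.
      by apply/redK; rewrite rmorphB sE subrr.
    exists (red t, f pi ^+ i.+1 * f w); first by rewrite !inE; apply/imsetP; exists (f w).
    by rewrite /h /= exprSr -mulrA -mulrDr -rmorphM -ew -rmorphD addrC subrK.
  rewrite !inE /= => /imsetP[w _ ->] ->; exists (f (s y) + f pi * w) => //.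
  by rewrite /h mulrDr mulrA -exprSr.
move=> [y z] [y' z']; rewrite !inE /= => /imsetP[w _ ->] /imsetP[w' _ ->].
rewrite /h /= => e; have [yy|ne] := eqVneq y y'; first by move: e; rewrite yy => /addrI ->.
have pi0 := quot_pi_neq0 (_ : i < l)%N.
have us : f (s y - s y') \is a GRing.unit by rewrite quot_unit rmorphB !sE subr_eq0.
have e1 : f pi ^+ i * (f (s y - s y') + f pi * (w - w')) = 0.
  rewrite rmorphB mulrDr mulrA -exprSr !mulrBr addrACA -opprD e; exact: subrr.
have u1 : f (s y - s y') + f pi * (w - w') \is a GRing.unit.
  have [t et] := fS (w - w'); rewrite -et -rmorphM -rmorphD quot_unit rmorphD.
  have -> : red (pi * t) = 0 by apply/redK; exists t.
  by rewrite addr0 rmorphB !sE subr_eq0.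
have /negP[] := pi0 ltac:(lia).
by apply/eqP/(mulIr u1); rewrite mul0r.
Qed.

Lemma quot_chain_ring : chain_ring (f pi) l #|F|.
Proof.
split=> //; first exact: quot_pi_nil.
- move=> x nz; have [z ez] := fS x; have [_ _ fact _] := cdvr.
  have z0 : z != 0 by apply: contraNneq nz => e; rewrite -ez e rmorph0.
  have [n [u uu e]] := fact z z0; exists n; split.
    rewrite ltnNge; apply: contraNN nz => ln; rewrite -ez e.
    rewrite -(subnK ln) exprD rmorphM rmorphM [f (pi ^+ l)]rmorphXn quot_pi_nil.
    by rewrite !mulr0.
  by exists (f u); rewrite ?rmorph_unit // -ez e rmorphM rmorphXn.
- exact: quot_card.
- exact: card_finNzRing_gt1.
by have := rmorph_unit f two_unit; rewrite rmorph_nat.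
Qed.

(** If [a * a - f th] were not a unit, [th] would be a square in the residue field, and by Hensel's
    lemma in [O]. *)
Lemma quot_nonsquare th : th \is a GRing.unit -> ~ (exists x : O, x * x = th) ->
  forall a : R, a * a - f th \is a GRing.unit.
Proof.
move=> uth nsq a; have [x <-] := fS a; rewrite -rmorphM -rmorphB quot_unit.
by apply: contra_notN nsq => /eqP; apply: hensel_sqrt.
Qed.

End CDVR.

(** * Central products *)

Lemma cfResZ (gT : finGroupType) (L K : {group gT}) a (f : 'CF(L)) :
  'Res[K] (a *: f) = a *: 'Res[K] f.
Proof. exact: linearZ. Qed.

Section CentralProduct.
Variables (gT : finGroupType) (H A Z : {group gT}).
Hypotheses (sZ : Z \subset ('Z(H))%g) (HE : (Z * A)%g = H).

Lemma cprod_subA : A \subset H. Proof. by rewrite -HE mulG_subr. Qed.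
Lemma cprod_subZ : Z \subset H. Proof. by rewrite -HE mulG_subl. Qed.

Lemma cprod_normal : (A <| H)%g.
Proof.
rewrite /normal cprod_subA -HE mul_subG ?normG //.
apply: subset_trans (cent_sub A); apply: subset_trans (centS cprod_subA).
by apply: subset_trans sZ (subsetIr _ _).
Qed.

Lemma Res_center_irr (c : Iirr H) : exists2 lam : 'CF(Z), lam \is a linear_char &
  'Res[Z] 'chi_c = 'chi_c 1%g *: lam.
Proof.
have sZc : Z \subset 'Z('chi_c)%CF.
  by apply: subset_trans sZ _; rewrite -cap_cfcenter_irr bigcap_inf.
have [lam llam e] := cfcenter_Res 'chi_c.
exists ('Res[Z] lam); first exact: cfRes_lin_char.
by rewrite -cfResZ -e cfResRes // cfcenter_sub.
Qed.

(** [A] is normal in [H], so a constituent with an [A]-fixed vector is trivial on [A]; being trivial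
    on [Z] too, it is the trivial character of [H = Z A]. *)
Lemma cfdot_Res_cprod (chi : 'CF(H)) : chi \is a character -> Z \subset cfker chi ->
  '['Res[A] chi, 1] = '[chi, 1].
Proof.
move=> Nchi kZ.
have -> : 'Res[A] chi = \sum_c '[chi, 'chi_c] *: 'Res[A] 'chi_c.
  by rewrite {1}(cfun_sum_cfdot chi) linear_sum; apply: eq_bigr => c _; apply: linearZ.
rewrite cfdot_suml.
rewrite (bigD1 0) // irr0 big1 ?addr0 => [|c c0].
  by rewrite cfRes_cfun1 cfdotZl cfnorm1 mulr1; apply: addr0.
rewrite cfdotZl; have [->|nz] := eqVneq '[chi, 'chi_c] 0; first by rewrite mul0r.
have kc : Z \subset cfker 'chi_c by apply: subset_trans kZ (cfker_constt _ _); rewrite ?irr_consttE.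
rewrite (cfdot_Res_cfun1 cprod_normal); have := normal_sum_irr c cprod_normal (group1 H).
under eq_bigr do rewrite mulg1.
move->; case: ifP => [kA|_]; last by rewrite !mulr0.
case/eqP: c0; apply/eqP; rewrite -subGcfker.
by apply: (@subset_trans _ _ (Z * A)%g); rewrite ?mul_subG // HE.
Qed.

(** [chi] times its conjugate is trivial on [Z], where [chi] is a multiple of a linear character; so
    the norm of [chi] may be computed on [A]. *)
Lemma cprod_Res_irr (c : Iirr H) : 'Res[A] 'chi_c \in irr A.
Proof.
have Nc := irr_char c; rewrite irrEchar cfRes_char // -[X in '[_, X]]cfConjCK -cfdot_mul1.
rewrite cfAutRes -cfResM cfdot_Res_cprod ?rpredM ?cfConjC_char //.
  by rewrite cfdot_mul1 cfConjCK cfnorm_irr eqxx.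
have [lam llam e] := Res_center_irr c.
apply/subsetP=> z Zz; rewrite cfkerEchar ?rpredM ?cfConjC_char // inE.
have Hz := subsetP cprod_subZ z Zz; rewrite Hz /= !cfunE.
rewrite -(cfResE 'chi_c cprod_subZ Zz) e cfunE rmorphM mulrACA.
by rewrite -(normCK (lam z)) (normC_lin_char llam Zz) expr1n mulr1 eqxx.
Qed.

Lemma cprod_extend (i : Iirr A) : exists c : Iirr H, 'Res[A] 'chi_c = 'chi_i.
Proof.
have : 'Ind[H] 'chi_i != 0 by rewrite cfInd_eq0 ?cprod_subA ?irr_char ?irr_neq0.
move/neq0_has_constt => [c]; rewrite constt_Ind_Res => cc; exists c; move: cc.
have /irrP[m ->] := cprod_Res_irr c.
by rewrite constt_irr inE => /eqP ->.
Qed.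

(** A nonzero multiplicity forces the three central characters to cancel, so that the triple product
    is trivial on [Z]. *)
Lemma cprod_mult (a b c : Iirr H) : '['chi_a * 'chi_b, 'chi_c] != 0 ->
  '['Res[A] 'chi_a * 'Res[A] 'chi_b, 'Res[A] 'chi_c] = '['chi_a * 'chi_b, 'chi_c].
Proof.
have Nc m : 'chi_m \is a character := irr_char (G := H) m.
rewrite -[in X in X != 0](cfConjCK 'chi_c) -[in RHS](cfConjCK 'chi_c) -!cfdot_mul1 => nz.
rewrite -[in X in '[_, X]](cfConjCK ('Res[A] 'chi_c)) -cfdot_mul1 cfAutRes -!cfResM.
have NF : 'chi_a * 'chi_b * ('chi_c)^*%CF \is a character by rewrite !rpredM ?cfConjC_char.
apply: cfdot_Res_cprod => //.
have [la lla ea] := Res_center_irr a; have [lb llb eb] := Res_center_irr b.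
have [lc llc ec] := Res_center_irr c.
have ll : la * lb * lc^*%CF \is a linear_char by rewrite !rpredM ?cfAut_lin_char.
have eF : 'Res[Z] ('chi_a * 'chi_b * ('chi_c)^*%CF) =
    ('chi_a 1%g * 'chi_b 1%g * 'chi_c 1%g) *: (la * lb * lc^*%CF).
  rewrite !cfResM -cfAutRes ea eb ec cfAutZ_Cnat ?Cnat_irr1 //.
  by apply/cfunP=> z; rewrite !cfunE; ring.
have l1 : la * lb * lc^*%CF = 1.
  have /irrP[m em] := lin_char_irr ll; rewrite em; apply/eqP; rewrite -irr0.
  apply: contraNT nz => m0; rewrite eq_le cfdot_char_ge0 ?cfun1_char // andbT.
  apply: le_trans (cfdot1_le_Res cprod_subZ NF) _.
  have m0' : m != 0 by apply: contraNneq m0 => ->.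
  by rewrite eF em cfdotZl -irr0 cfdot_irr (negPf m0') mulr0.
have val x : x \in Z -> ('chi_a * 'chi_b * ('chi_c)^*%CF) x =
    'chi_a 1%g * 'chi_b 1%g * 'chi_c 1%g.
  by move=> Zx; rewrite -(cfResE _ cprod_subZ Zx) eF l1 cfunE cfun1E Zx mulr1.
apply/subsetP=> z Zz; rewrite cfkerEchar // inE (subsetP cprod_subZ) //.
by rewrite (val z Zz) (val 1%g (group1 Z)) eqxx.
Qed.

(** Any extensions of [i] and [j] will do; the extension of [k] is then chosen among the
    constituents of their product, so that the central characters match. *)
Lemma cprod_lift (i j k : Iirr A) : tensor_mult i j k != 0 -> exists a b c : Iirr H,
  [/\ 'Res[A] 'chi_a = 'chi_i, 'Res[A] 'chi_b = 'chi_j, 'Res[A] 'chi_c = 'chi_k &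
      tensor_mult a b c != 0].
Proof.
have [a ea] := cprod_extend i; have [b eb] := cprod_extend j.
rewrite /tensor_mult -ea -eb -cfResM cfdot_Res_l cfdot_sum_irr => nz.
have /existsP[c] : [exists c, '['chi_a * 'chi_b, 'chi_c] * ('['Ind[H] 'chi_k, 'chi_c])^* != 0].
  by apply: contraNT nz; rewrite negb_exists => /forallP h; rewrite big1 // => c _;
    apply/eqP; have := h c; rewrite negbK.
rewrite mulf_eq0 negb_or fmorph_eq0 => /andP[nz1]; rewrite -irr_consttE constt_Ind_Res.
have /irrP[m em] := cprod_Res_irr c; rewrite em constt_irr inE => /eqP e.
by exists a, b, c; rewrite em e.
Qed.

End CentralProduct.

(** Up from [A] to [H], then down to the image of [L]. The characters are compared only on elements
    of [L] mapped into [A]; this covers degrees and the image of [K], which is what genericity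
    needs. *)
Lemma cprod_transfer (gT rT : finGroupType) (H A Z : {group gT}) (L : {group rT})
    (phi : {morphism L >-> gT}) (i j k : Iirr A) :
  Z \subset ('Z(H))%g -> (Z * A)%g = H -> (Z * (phi @* L))%g = H ->
  tensor_mult i j k != 0 ->
  exists i' j' k' : Iirr L,
  [/\ {in L, forall x, phi x \in A -> 'chi_i' x = 'chi_i (phi x)},
      {in L, forall x, phi x \in A -> 'chi_j' x = 'chi_j (phi x)},
      {in L, forall x, phi x \in A -> 'chi_k' x = 'chi_k (phi x)} &
      tensor_mult i' j' k' = tensor_mult i j k].
Proof.
move=> sZ HA HL nz; have [a [b [c [ea eb ec nzH]]]] := cprod_lift sZ HA nz.
have irr' m : cfMorph ('Res[phi @* L] 'chi[H]_m) \in irr L.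
  by rewrite cfMorph_irr ?subxx //; apply: cprod_Res_irr sZ HL m.
have sLH : (phi @* L)%g \subset H by rewrite -HL mulG_subr.
have val (m : Iirr H) (n : Iirr A) (n' : Iirr L) : 'Res[A] 'chi_m = 'chi_n ->
    cfMorph ('Res[phi @* L] 'chi_m) = 'chi_n' ->
    {in L, forall x, phi x \in A -> 'chi_n' x = 'chi_n (phi x)}.
  move=> <- <- x Lx Ax; rewrite cfMorphE ?subxx // cfResE ?mem_morphim //.
  by rewrite cfResE // -HA mulG_subr.
have /irrP[i' ei'] := irr' a; have /irrP[j' ej'] := irr' b; have /irrP[k' ek'] := irr' c.
exists i', j', k'; split; [exact: val ea ei'|exact: val eb ej'|exact: val ec ek'|].
rewrite /tensor_mult -ei' -ej' -ek' -rmorphM cfMorph_iso ?subxx //.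
rewrite (cprod_mult sZ HL nzH) -(cprod_mult sZ HA nzH) ea eb ec //.
Qed.

(** * The unitary group *)

Lemma chain_sub_unit (R : finComUnitRingType) (p : R) l q (x y : R) : chain_ring p l q ->
  x + y \is a GRing.unit -> (x \is a GRing.unit) || (y \is a GRing.unit).
Proof.
move=> cR; apply: contraLR; rewrite negb_or => /andP[/(chain_nunitP cR)[a ->] /(chain_nunitP cR)[b ->]].
by rewrite -mulrDr (chain_pM_nunit cR).
Qed.

(* The squares have index two in the group of units. *)
Lemma chain_sqrt (R : finComUnitRingType) (p : R) l q (m r : R) : chain_ring p l q ->
  m \is a GRing.unit -> r \is a GRing.unit -> (forall x, x * x != m) ->
  exists x, (x * x = r) \/ (x * x = m * r).
Proof.
move=> cR um ur nm; pose Un := [set x : R | x \is a GRing.unit].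
pose Sq := [set x * x | x in Un]; pose mSq := [set m * x | x in Sq].
have u2 := chain_two cR.
have SU : Sq \subset Un.
  by apply/subsetP=> _ /imsetP[x Ux ->]; move: Ux; rewrite !inE unitrM => ->.
have mU : mSq \subset Un.
  by apply/subsetP=> _ /imsetP[x /(subsetP SU) Ux ->]; move: Ux; rewrite !inE unitrM um.
have cm : #|mSq| = #|Sq| by rewrite card_imset //; apply: mulrI.
have card2 : #|Un| = (2 * #|Sq|)%N.
  rewrite -sum1_card (partition_big_imset (fun x => x * x)) -/Sq.
  rewrite (eq_bigr (fun=> 2)) ?sum_nat_const 1?mulnC // => y0 /imsetP[x].
  rewrite inE => ux ->; rewrite sum1dep_card.
  have nx : x != - x.
    rewrite -subr_eq0 opprK -mulr2n -mulr_natl; apply: contraTneq ux => e.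
    by have := mulrI u2; move/(_ x 0); rewrite mulr0 => /(_ e) ->; rewrite unitr0.
  have <- : #|[set x; - x]| = 2 by rewrite cards2 nx.
  apply: eq_card => y; rewrite !inE; apply/andP/orP=> [[uy /eqP e]|[] /eqP ->]; last first.
  - by rewrite unitrN mulrNN eqxx.
  - by rewrite ux eqxx.
  have e0 : (y - x) * (y + x) = 0.
    have -> : (y - x) * (y + x) = y * y - x * x by ring.
    by rewrite e subrr.
  have ux2 : (y + x) - (y - x) \is a GRing.unit.
    have -> : (y + x) - (y - x) = 2%:R * x by ring.
    by rewrite unitrM u2.
  have /orP[u1|u1] := chain_sub_unit cR ux2.
    by left; rewrite -subr_eq0; apply/eqP/(mulIr u1); rewrite mul0r.
  right; rewrite -addr_eq0; rewrite unitrN in u1.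
  by apply/eqP/(mulrI u1); rewrite mulr0.
have dis : Sq :&: mSq = set0.
  apply/setP=> y; rewrite !inE; apply/andP=> -[/imsetP[a Ua ->] /imsetP[_ /imsetP[b Ub ->] e]].
  rewrite inE in Ub; case/eqP: (nm (a / b)); apply: (mulIr Ub); apply: (mulIr Ub).
  transitivity ((a / b * b) * (a / b * b)); first by ring.
  by rewrite divrK // -mulrA.
have UE : Sq :|: mSq = Un.
  apply/eqP; rewrite eqEcard subUset SU mU /= card2 mul2n -addnn -{2}cm -cardsUI dis.
  by rewrite cards0 addn0.
have : r \in Sq :|: mSq by rewrite UE inE.
case/setUP=> [/imsetP[x _ ->]|/imsetP[_ /imsetP[x _ ->] ->]]; first by exists x; left.
by exists (m * x); right; rewrite mulrACA -mulrA.
Qed.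

Section GU.
Variables (R : finComUnitRingType) (p : R) (l q : nat).
Hypothesis cR : chain_ring p l q.
Variables (S : finComUnitRingType) (iota : {rmorphism R -> S}) (th : R) (vt : S).
Variable cj : {rmorphism S -> S}.
Hypothesis nsq : forall a : R, a * a - th \is a GRing.unit.
Hypothesis vt2 : vt ^+ 2 = iota th.
Hypothesis vtS : forall s : S, exists a b : R, s = iota a + iota b * vt.
Hypothesis vtF : forall a b : R, iota a + iota b * vt = 0 -> a = 0 /\ b = 0.
Hypothesis cjR : forall a : R, cj (iota a) = iota a.
Hypothesis cjvt : cj vt = - vt.

Lemma th_unit : th \is a GRing.unit.
Proof. by have := nsq 0; rewrite mul0r sub0r unitrN. Qed.

Lemma vt_unit : vt \is a GRing.unit.
Proof. by have := rmorph_unit iota th_unit; rewrite -vt2 unitrX_pos. Qed.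

Lemma iota_eq0 a : iota a = 0 -> a = 0.
Proof. by move=> e; have [] := @vtF a 0; rewrite // e rmorph0 mul0r addr0. Qed.

Lemma iota_unit a : iota a \is a GRing.unit -> a \is a GRing.unit.
Proof.
move=> ua; apply: contraT => na; have := na; rewrite -(chain_PM_eq0 cR) => /eqP/(congr1 iota).
rewrite rmorphM rmorph0 => e; have /eqP[] := chain_Pneq0 cR.
by apply: iota_eq0; apply: (mulIr ua); rewrite mul0r.
Qed.

Lemma cj_basis a b : cj (iota a + iota b * vt) = iota a - iota b * vt.
Proof. by rewrite rmorphD rmorphM !cjR cjvt mulrN. Qed.

Lemma norm_basis a b :
  (iota a + iota b * vt) * cj (iota a + iota b * vt) = iota (a * a - th * (b * b)).
Proof.
rewrite cj_basis rmorphB !rmorphM -vt2; ring.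
Qed.

Lemma basis_unit a b : (a \is a GRing.unit) || (b \is a GRing.unit) ->
  iota a + iota b * vt \is a GRing.unit.
Proof.
move=> uab; suff : iota (a * a - th * (b * b)) \is a GRing.unit.
  by rewrite -norm_basis unitrM => /andP[].
apply: rmorph_unit; have [ub|nb] := boolP (b \is a GRing.unit).
  have -> : a * a - th * (b * b) = (a / b * (a / b) - th) * (b * b).
    by rewrite mulrBl [a / b * _ * _]mulrACA !divrK.
  by rewrite unitrM nsq unitrM ub.
have ua : a \is a GRing.unit by case/orP: uab => // ub; rewrite ub in nb.
have /(chain_nunitP cR)[y ->] := nb.
have -> : a * a - th * (p * y * (p * y)) = a * a + p * (- (th * y * (p * y))) by ring.
by apply: (chain_unitD cR); rewrite unitrM ua.
Qed.

Lemma norm1_unit (e : S) : (1 + e \is a GRing.unit) || (1 - e \is a GRing.unit).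
Proof.
have [a [b ->]] := vtS e.
have -> : 1 + (iota a + iota b * vt) = iota (1 + a) + iota b * vt.
  by rewrite rmorphD rmorph1 addrA.
have -> : 1 - (iota a + iota b * vt) = iota (1 - a) + iota (- b) * vt.
  by rewrite rmorphB rmorph1 rmorphN mulNr opprD addrA.
have : (1 + a) + (1 - a) \is a GRing.unit.
  have -> : (1 + a) + (1 - a) = 2%:R by ring.
  exact: chain_two cR.
by move/(chain_sub_unit cR)/orP => [u1|u1]; apply/orP; [left|right]; rewrite basis_unit ?u1.
Qed.

(* If all norms a^2 - th were squares, then so would be - n th for all n, hence th. *)
Lemma norm_onto r : r \is a GRing.unit -> exists s, s * cj s = iota r.
Proof.
move=> ur.
have nth (x : R) : x * x != th.
  by apply: contraTneq (nsq x) => ->; rewrite subrr unitr0.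
have [m [y um [my nm]]] : exists m, exists2 y, m \is a GRing.unit & y * cj y = iota m /\
    (forall x, x * x != m).
  have : ~~ [forall a, exists x, x * x == a * a - th].
    apply/negP=> /forallP h.
    have all n : exists x, x * x == - (th *+ n).
      elim: n => [|n [x /eqP ex]]; first by exists 0; rewrite mulr0n oppr0 mulr0.
      have /existsP[y /eqP ey] := h x; exists y.
      by rewrite ey ex mulrSr opprD.
    have [x /eqP ex] := all #|R|.-1.
    have c0 : th *+ #|R| = 0 by rewrite -cardsT -FinRing.zmodXgE expg_cardG ?inE.
    case/eqP: (nth x); rewrite ex; apply/eqP; rewrite eq_sym -addr_eq0 -mulrS prednK ?c0 //.
    by apply/card_gt0P; exists 0.
  rewrite negb_forall => /existsP[a]; rewrite negb_exists => /forallP h.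
  exists (a * a - th), (iota a + iota 1 * vt); first exact: nsq.
  by rewrite norm_basis !mulr1; split.
have [x [ex|ex]] := chain_sqrt cR um ur nm.
  by exists (iota x); rewrite cjR -rmorphM ex.
have uy : cj y \is a GRing.unit.
  by have := rmorph_unit iota um; rewrite -my unitrM => /andP[].
have uy' : y \is a GRing.unit.
  by have := rmorph_unit iota um; rewrite -my unitrM => /andP[].
exists (iota x / y); rewrite rmorphM cjR rmorphV // mulrACA -rmorphM ex rmorphM -my -invrM //.
by rewrite mulrC [cj y * y]mulrC mulKr // unitrM uy' uy.
Qed.

Lemma cj_fixed s : cj s = s -> exists a, s = iota a.
Proof.
have [a [b ->]] := vtS s; rewrite cj_basis => e; exists a.
move/addrI: e => e; have e0 : iota 0 + iota (b + b) * vt = 0.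
  by rewrite rmorph0 add0r rmorphD mulrDl -{1}e addNr.
have [_ b0] := vtF e0.
have b0' : b = 0 by apply: (mulrI (chain_two cR)); rewrite mulr0 mulr_natl mulr2n.
by rewrite b0' rmorph0 mul0r addr0.
Qed.

Lemma star_mx2 a b c d : star cj (mx2 a b c d) = mx2 (cj d) (cj b) (cj c) (cj a).
Proof.
by apply: mx2P; rewrite mx2E /star !mulmx2 !mxE /=;
  rewrite ?mul0r ?mul1r ?mulr0 ?mulr1 ?addr0 ?add0r.
Qed.

(** Conjugation by [diag(1, vt)] after extension of scalars, with image [G1]. *)
Definition phi_fun (g : {'GL_2[R]}) : {'GL_2[S]} :=
  gl2 (iota (GLval g 0 0)) (iota (GLval g 0 1) / vt)
      (iota (GLval g 1 0) * vt) (iota (GLval g 1 1)).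

Lemma phi_det (a b c d : R) :
  iota a * iota d - iota b / vt * (iota c * vt) = iota (a * d - b * c).
Proof. by rewrite mulrA -[_ / vt * _]mulrA [vt^-1 * _]mulrC mulrA divrK ?vt_unit // rmorphB !rmorphM. Qed.

Lemma phi_gl2 a b c d : a * d - b * c \is a GRing.unit ->
  phi_fun (gl2 a b c d) = gl2 (iota a) (iota b / vt) (iota c * vt) (iota d).
Proof. by move=> h; rewrite /phi_fun gl2K // !mx2E. Qed.

Lemma phi_val g : GLval (phi_fun g) = mx2 (iota (GLval g 0 0)) (iota (GLval g 0 1) / vt)
      (iota (GLval g 1 0) * vt) (iota (GLval g 1 1)).
Proof. by rewrite gl2K // phi_det rmorph_unit // gl2_unit. Qed.

Lemma phi_morph : {in ('GL_2[R])%g &, {morph phi_fun : g h / (g * h)%g}}.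
Proof.
move=> g h _ _; apply: GL2P; rewrite GL_MxE !phi_val mx2M.
have [-> -> -> ->] := gl2_mulE g h; rewrite !rmorphD !rmorphM.
have k x y : x / vt * (y * vt) = x * y by rewrite mulrA [x / vt * y]mulrAC divrK ?vt_unit.
have k' x y : x * vt * (y / vt) = x * y by rewrite mulrA [x * vt * y]mulrAC mulrK ?vt_unit.
congr mx2; rewrite ?k ?k' // mulrDl mulrA; congr (_ + _); rewrite ?mulrA //; exact: mulrAC.
Qed.
Canonical phi := Morphism phi_morph.

Local Notation GS := [set: {'GL_2[S]}]%G.
Local Notation ZS := ('Z(GS))%G.

Definition scal (s : S) : {'GL_2[S]} := gl2 s 0 0 s.

Lemma scal_val s : s \is a GRing.unit -> GLval (scal s) = s%:M.
Proof.
move=> us; rewrite gl2K; last by rewrite mulr0 subr0 unitrM us.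
by apply: mx2P; rewrite mx2E !mxE.
Qed.

Lemma scal_center s : s \is a GRing.unit -> scal s \in ZS.
Proof.
move=> us; rewrite inE in_setT; apply/centP=> g _; apply: GL2P.
by rewrite !GL_MxE scal_val // scalar_mxC.
Qed.

Lemma star_scale s M : star cj (s *: M) = cj s *: star cj M.
Proof. by rewrite /star map_mxZ linearZ /= -scalemxAr -scalemxAl. Qed.

Lemma cjV s : s \is a GRing.unit -> cj s^-1 = (cj s)^-1.
Proof. exact: rmorphV. Qed.

(** The involution changes the sign of [vt], so on the image of [phi_fun] the operation [star] is
    the adjugate, and the product is the determinant. *)
Lemma phi_star g : star cj (GLval (phi_fun g)) *m GLval (phi_fun g) =
  (iota (GLval g 0 0 * GLval g 1 1 - GLval g 0 1 * GLval g 1 0))%:M.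
Proof.
rewrite phi_val star_mx2 mx2M !rmorphM cjV ?vt_unit // cjvt !cjR -phi_det invrN.
by apply: mx2P; rewrite mx2E !mxE /=; ring.
Qed.

(** Scaling by an [s] whose norm is the inverse of the determinant turns [phi_star] into the
    unitarity condition. *)
Lemma phi_sub : ((phi @* 'GL_2[R])%g \subset ZS * GU_group cj)%g.
Proof.
apply/subsetP=> _ /morphimP[g _ _ ->].
pose d := GLval g 0 0 * GLval g 1 1 - GLval g 0 1 * GLval g 1 0.
have ud := gl2_unit g; rewrite -/d in ud.
have [s es] : exists s, s * cj s = iota d^-1 by apply: norm_onto; rewrite unitrV.
have us : s \is a GRing.unit.
  by have := rmorph_unit iota (_ : d^-1 \is a GRing.unit); rewrite -es unitrV unitrM => /(_ ud)/andP[].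
apply/mulsgP; exists (scal s)^-1%g (scal s * phi_fun g)%g; last by rewrite mulKg.
  by rewrite groupV scal_center.
rewrite inE GL_MxE scal_val // mul_scalar_mx star_scale -scalemxAl -scalemxAr scalerA.
rewrite phi_star -/d mulrC es -mul_scalar_mx -scalar_mxM -rmorphM mulVr // rmorph1.
exact: eqxx.
Qed.

(** For a unitary matrix [star] is the inverse, hence the adjugate divided by the determinant; these
    are the entrywise comparisons. *)
Lemma GU_entries a b c d : mx2 (cj d) (cj b) (cj c) (cj a) *m mx2 a b c d = 1%:M ->
  [/\ (a * d - b * c) * cj a = a, (a * d - b * c) * cj b = - b,
      (a * d - b * c) * cj c = - c & (a * d - b * c) * cj d = d].
Proof.
rewrite mx2M mx2_1 => /matrixP e.
have e1 := e 0 0; have e2 := e 0 1; have e3 := e 1 0; have e4 := e 1 1.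
rewrite !mx2E in e1 e2 e3 e4; split.
- have -> : (a * d - b * c) * cj a = a * (cj c * b + cj a * d) - b * (cj c * a + cj a * c) by ring.
  by rewrite e3 e4 mulr0 mulr1 subr0.
- have -> : (a * d - b * c) * cj b = a * (cj d * b + cj b * d) - b * (cj d * a + cj b * c) by ring.
  by rewrite e1 e2 mulr0 mulr1 sub0r.
- have -> : (a * d - b * c) * cj c = d * (cj c * a + cj a * c) - c * (cj c * b + cj a * d) by ring.
  by rewrite e3 e4 mulr0 mulr1 sub0r.
have -> : (a * d - b * c) * cj d = d * (cj d * a + cj b * c) - c * (cj d * b + cj b * d) by ring.
by rewrite e1 e2 mulr0 mulr1 subr0.
Qed.

Lemma cjK s : cj (cj s) = s.
Proof. by have [a [b ->]] := vtS s; rewrite cj_basis rmorphB rmorphM !cjR cjvt mulrN opprK. Qed.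

(** The classical solution [1 + cj e] works if it is a unit. Otherwise [1 - cj e] is one, and the
    factor [vt] corrects its sign. *)
Lemma hilbert90 e : e * cj e = 1 -> exists2 s, s \is a GRing.unit & cj s = e * s.
Proof.
move=> e1; have /orP[u1|u1] := norm1_unit (cj e).
  by exists (1 + cj e) => //; rewrite rmorphD rmorph1 cjK mulrDr e1 mulr1 addrC.
exists (vt * (1 - cj e)); first by rewrite unitrM vt_unit.
by rewrite rmorphM rmorphB rmorph1 cjK cjvt [RHS]mulrCA [e * (1 - _)]mulrBr e1 mulr1 mulNr -mulrN opprB.
Qed.

(** The determinant [e] of a unitary matrix has norm one. With [cj s = e * s], scaling by [s] makes
    the diagonal entries, [b * vt] and [c / vt] fixed by [cj], which puts the matrix in the image of
    [phi]. *)
Lemma GU_sub : (GU_group cj \subset ZS * (phi @* 'GL_2[R]))%g.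
Proof.
apply/subsetP=> g; rewrite inE; elim/gl2_ind: g => a b c d ud.
rewrite gl2K // star_mx2 => /eqP /GU_entries; move: ud; set e := a * d - b * c.
move=> ue [ea eb ec ed].
have e1 : e * cj e = 1.
  apply: (mulrI ue); rewrite mulr1.
  have -> : e * (e * cj e) = (e * cj a) * (e * cj d) - (e * cj b) * (e * cj c).
    by rewrite /e rmorphB !rmorphM; ring.
  by rewrite ea eb ec ed mulrNN.
have [s us es] := hilbert90 e1.
have [a' ea'] : exists a', s * a = iota a'.
  by apply: cj_fixed; rewrite rmorphM es mulrAC ea mulrC.
have [d' ed'] : exists d', s * d = iota d'.
  by apply: cj_fixed; rewrite rmorphM es mulrAC ed mulrC.
have [b' eb'] : exists b', s * b * vt = iota b'.
  by apply: cj_fixed; rewrite !rmorphM es cjvt [e * s * _]mulrAC eb mulNr mulrNN [b * s]mulrC.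
have [c' ec'] : exists c', s * c / vt = iota c'.
  apply: cj_fixed; rewrite !rmorphM cjV ?vt_unit // es cjvt [e * s * _]mulrAC ec invrN.
  by rewrite mulNr mulrNN [c * s]mulrC.
have eb2 : s * b = iota b' / vt by rewrite -eb' mulrK ?vt_unit.
have ec2 : s * c = iota c' * vt by rewrite -ec' divrK ?vt_unit.
have ud' : a' * d' - b' * c' \is a GRing.unit.
  apply: iota_unit; rewrite -phi_det -ea' -ed' -eb2 -ec2.
  have -> : s * a * (s * d) - s * b * (s * c) = s * s * e by rewrite /e; ring.
  by rewrite !unitrM us ue.
apply/mulsgP; exists (scal s)^-1%g (phi_fun (gl2 a' b' c' d')).
- by rewrite groupV scal_center.
- by apply/morphimP; exists (gl2 a' b' c' d'); rewrite ?inE.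
apply: (mulgI (scal s)); rewrite mulKVg; apply: GL2P.
rewrite GL_MxE scal_val // phi_gl2 // !gl2K ?phi_det ?rmorph_unit //.
by rewrite mul_scalar_mx -ea' -ed' -eb2 -ec2; apply: mx2P; rewrite !mxE.
Qed.

Lemma GU_cprod : (ZS * GU_group cj)%g = (ZS * (phi @* 'GL_2[R]))%g.
Proof.
apply/eqP; rewrite eqEsubset; apply/andP; split.
  by apply: subset_trans (mulgS _ GU_sub) _; rewrite mulgA mulGid.
by apply: subset_trans (mulgS _ phi_sub) _; rewrite mulgA mulGid.
Qed.

(** * Regular characters of the unitary group and the claims for [GU_2] *)

Variable psi' : R -> algC.
Variable psi : S -> algC.
Hypotheses (psiH : is_add_char psi') (psiP : exists x, psi' (p ^+ l.-1 * x) != 1).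
Hypothesis psiE : forall x y : R, psi (iota x + iota y * vt) = psi' x * psi' y.

Local Notation GLset := (GL2_setting cR psiH psiP).

Lemma phi_SL (g : {'GL_2[R]}) : GLval g 0 0 * GLval g 1 1 - GLval g 0 1 * GLval g 1 0 = 1 ->
  phi_fun g \in GU_group cj.
Proof. by move=> e; rewrite inE phi_star e rmorph1 eqxx. Qed.

Lemma iota_ann x (y : S) : iota x = y -> iota p * y = 0 -> p * x = 0.
Proof. by move=> <-; rewrite -rmorphM; apply: iota_eq0. Qed.

(** Products of entries of [N] with conjugates of entries vanish, so unitarity of [1 + N] becomes
    linear: [cj d = - a], [cj b = - b], [cj c = - c]. Hence the trace is [a - cj a], a multiple of
    [vt], and when it is zero the matrix comes from [K]. *)
Lemma GU_trace0 (g : {'GL_2[S]}) : (1 < l)%N ->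
  g \in Kcong (GU_group cj) (iota p) l ->
  exists2 y, \tr (GLval g - 1%:M) = iota y * vt &
    y = 0 -> exists2 h, h \in Kgrp GLset & g = phi_fun h.
Proof.
move=> l1; rewrite inE => /andP[]; rewrite inE => /eqP GUg /existsP[X /eqP gE].
pose N := iota p ^+ l.-1 *: X; rewrite -/N in gE.
have ann i j : iota p * N i j = 0.
  by rewrite mxE mulrA -rmorphXn -rmorphM (chain_pP cR) rmorph0 mul0r.
have NN0 i j i' j' : cj (N i j) * N i' j' = 0.
  rewrite [N i' j']mxE mulrA -[l.-1]prednK; last by lia.
  by rewrite exprS mulrA [_ * iota p]mulrC -{1}(cjR p) -rmorphM ann rmorph0 !mul0r.
pose a := N 0 0; pose b := N 0 1; pose c := N 1 0; pose d := N 1 1.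
have gE' : GLval g = mx2 (1 + a) b c (1 + d).
  by apply: mx2P; rewrite gE mx2E mxE [(1%:M : 'M_2) _ _]mxE /= ?mulr1n ?mulr0n ?add0r.
move: GUg; rewrite gE' star_mx2 mx2M mx2_1 => /matrixP e.
have e1 := e 0 0; have e2 := e 0 1; have e3 := e 1 0.
rewrite !mx2E !rmorphD !rmorph1 in e1 e2 e3.
have ed : cj d = - a.
  apply/eqP; rewrite -addr_eq0; apply/eqP/(addrI 1); rewrite addr0 -[RHS]e1.
  by rewrite mulrDl !mulrDr !mul1r !mulr1 !NN0 !addr0; ring.
have eb : cj b = - b.
  apply/eqP; rewrite -addr_eq0; apply/eqP; rewrite -[RHS]e2.
  by rewrite mulrDl mulrDr mul1r mulr1 !NN0 !addr0 addrC.
have ec : cj c = - c.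
  apply/eqP; rewrite -addr_eq0; apply/eqP; rewrite -[RHS]e3.
  by rewrite mulrDl mulrDr mul1r mulr1 !NN0 !addr0.
have ed' : d = - cj a by rewrite -[d]cjK ed rmorphN.
have [x [y exy]] := vtS a.
have trE : \tr (GLval g - 1%:M) = iota (y + y) * vt.
  rewrite gE addrAC subrr add0r tr_mx2 -/a -/d ed' exy cj_basis rmorphD; ring.
exists (y + y); first by rewrite -gE' -mx2_1.
move=> y2.
have y0 : y = 0 by apply: (mulrI (chain_two cR)); rewrite mulr0 mulr_natl mulr2n.
have ax : a = iota x by rewrite exy y0 rmorph0 mul0r addr0.
have [b' eb'] : exists b', b * vt = iota b'.
  by apply: cj_fixed; rewrite rmorphM eb cjvt mulrNN.
have [c' ec'] : exists c', c / vt = iota c'.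
  by apply: cj_fixed; rewrite rmorphM cjV ?vt_unit // ec cjvt invrN mulrNN.
have px : p * x = 0 by apply: (iota_ann (esym ax)); apply: ann.
have pb : p * b' = 0 by apply: (iota_ann (esym eb')); rewrite mulrA ann mul0r.
have pc : p * c' = 0 by apply: (iota_ann (esym ec')); rewrite mulrA ann mul0r.
have det1' : (1 + x) * (1 - x) - b' * c' = 1.
  have -> : (1 + x) * (1 - x) - b' * c' = 1 - x * x - b' * c' by ring.
  by rewrite (@ann_mul GLset x x l1 px px) (@ann_mul GLset b' c' l1 pb pc) !subr0.
have ud' : (1 + x) * (1 - x) - b' * c' \is a GRing.unit by rewrite det1' unitr1.
exists (gl2 (1 + x) b' c' (1 - x)).
  apply: (@trace0_inK GLset _ l1); rewrite /= gl2K // !mx2E //.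
    by rewrite addrAC subrr add0r.
  by ring.
apply: GL2P; rewrite gE' phi_gl2 // gl2K ?phi_det ?det1' ?rmorph1 ?unitr1 //.
congr mx2.
- by rewrite rmorphD rmorph1 ax.
- by rewrite -eb' mulrK ?vt_unit.
- by rewrite -ec' divrK ?vt_unit.
by rewrite rmorphB rmorph1 ed' ax cjR.
Qed.

(** As for [GL_2], with the kernel transported along [phi]: elements of the unitary congruence
    subgroup of trace zero are images of elements of [K], on which [i] and [i'] agree. *)
Lemma regular_generic_GU (i : Iirr (GU_group cj)) (i' : Iirr 'GL_2[R]%G) :
  {in 'GL_2[R]%G, forall x, phi x \in GU_group cj -> 'chi_i' x = 'chi_i (phi x)} ->
  regular_rep (GU_group cj) (lieU cj) psi (iota p) l i -> generic cR psiH psiP i'.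
Proof.
move=> link reg; apply/negP => kY; move: reg; rewrite /regular_rep.
have l0 := chain_l cR.
have inGL (x : {'GL_2[R]}) : x \in 'GL_2[R]%G by rewrite inE.
have deg : 'chi_i' 1%g = 'chi_i 1%g by rewrite link ?morph1 ?group1.
case: ifP => [l1 /eqP[]|].
  rewrite -deg; apply: (@ker_Y_lin GLset i' _ kY); apply/eqP; rewrite eqn_leq l1; exact: l0.
move/negbT; rewrite -ltnNge => l1 reg.
have kK := @ker_Y_K GLset i' kY.
have kK' h : h \in Kgrp GLset -> phi_fun h \in cfker 'chi_i.
  move=> Kh; have GUh : phi_fun h \in GU_group cj.
    by apply: phi_SL; have := Kh; rewrite inK => /and5P[/eqP].
  rewrite cfkerEirr inE -link // -deg; apply/eqP; apply: cfker1; exact: (subsetP kK).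
(* The coordinate of the trace along [vt]; on the congruence subgroup it exists, so the default [0]
   is never the value by failure. *)
pose tr0 (g : {'GL_2[S]}) : R := odflt 0 [pick y | \tr (GLval g - 1%:M) == iota y * vt].
have tr0E g : g \in Kcong (GU_group cj) (iota p) l -> \tr (GLval g - 1%:M) = iota (tr0 g) * vt.
  move=> /(GU_trace0 l1)[y ey _]; rewrite /tr0; case: pickP => [z /eqP //|/(_ y)].
  by rewrite ey eqxx.
have vt_inj y z : iota y * vt = iota z * vt -> y = z.
  move/(mulIr vt_unit)/eqP; rewrite -subr_eq0 -rmorphB => /eqP/iota_eq0/eqP.
  by rewrite subr_eq0 => /eqP.
have K1 : 1%g \in Kcong (GU_group cj) (iota p) l.
  by rewrite inE group1; apply/existsP; exists 0; rewrite GL_1E scaler0 addr0.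
have [||r nz] := @occurs_of_trace0 R p l q psi' _ (GU_group cj) (Kcong (GU_group cj) (iota p) l)
  tr0 i cR psiH psiP K1.
- by apply: vt_inj; rewrite -tr0E // GL_1E subrr mxtrace0 rmorph0 mul0r.
- move=> g Kg t0; have [y ey /(_ _)[]] := GU_trace0 l1 Kg; last by move=> h Kh ->; apply: kK'.
  by rewrite -t0; apply: vt_inj; rewrite -ey tr0E.
(* Scalar matrices of the Lie algebra are multiples of [vt]; dividing by [th], the square of [vt],
   gives [c * (y * vt) = r * y]. *)
pose c := iota (r / th) * vt.
have cc : cj c = - c by rewrite rmorphM cjR cjvt mulrN.
apply: (reg c%:M).
- rewrite /lieU (_ : c%:M = c *: 1%:M); last by rewrite scalemx1.
  by rewrite star_scale star1 cc scaleNr subrr.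
- rewrite /occurs_in; congr (_ != 0): nz; apply: eq_bigr => g Kg.
  congr (_ * Num.conj _); rewrite /psiA mul_scalar_mx mxtraceZ tr0E //.
  have -> : c * (iota (tr0 g) * vt) = iota (r * tr0 g) + iota 0 * vt.
    rewrite rmorph0 mul0r addr0 /c mulrACA -expr2 vt2 -!rmorphM; congr (iota _).
    by rewrite mulrAC divrK ?th_unit // mulrC.
  by rewrite psiE psiH.1 mulr1.
by exists c, 0; rewrite scaler0 addr0.
Qed.

Lemma GU_claims : tensor_claims (GU_group cj)
  (regular_rep (GU_group cj) (lieU cj) psi (iota p) l) q l.
Proof.
move=> i j k ri rj rk a b c ha hb hc.
(* The transfer lifts all three characters with matching central characters, which requires a
   nonzero multiplicity. *)
have [e|nz] := eqVneq (tensor_mult i j k) 0.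
  by rewrite e; apply: (@mult_claims_le1 0 l a b c); apply: ler01.
have HE : (ZS <*> (phi @* 'GL_2[R]))%g = (ZS * (phi @* 'GL_2[R]))%g.
  apply: cent_joinEl; apply: subset_trans (subsetIr _ _) (centS (subsetT _)).
have [|||i' [j' [k' [li lj lk e]]]] := @cprod_transfer _ _ (ZS <*> (phi @* 'GL_2[R]))%G
  (GU_group cj) ZS 'GL_2[R]%G phi i j k _ _ _ nz.
- rewrite subsetI joing_subl; apply: subset_trans (subsetIr _ _) (centS (subsetT _)).
- by rewrite GU_cprod -HE.
- by rewrite -HE.
have deg (m : Iirr (GU_group cj)) (m' : Iirr 'GL_2[R]%G) t :
    {in 'GL_2[R]%G, forall x, phi x \in GU_group cj -> 'chi_m' x = 'chi_m (phi x)} ->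
    has_type q l m t -> has_type q l m' t.
  by move=> lm; rewrite /has_type lm ?morph1 ?group1.
rewrite -e; apply: (@generic_claims R p l q cR psi' psiH psiP i' j' k').
- exact: regular_generic_GU li ri.
- exact: regular_generic_GU lj rj.
- exact: regular_generic_GU lk rk.
- exact: deg li ha.
- exact: deg lj hb.
- exact: deg lk hc.
Qed.

End GU.

Theorem theorem1p1
  (O : idomainType) (pi : O)
  (F : finFieldType) (red : {rmorphism O -> F}) (l : nat) :
  (* O is a complete DVR with uniformizer pi *)
  is_cdvr pi ->
  (* F = O / pi O is its residue field, finite of odd characteristic; q = #|F| *)
  (forall y : F, exists x : O, red x = y) ->
  (forall x : O, red x = 0 <-> exists y : O, x = pi * y) ->
  odd #|F| ->
  (1 <= l)%N ->
  (* Case G = GL_2 *)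
  (forall (R : finComUnitRingType) (f : {rmorphism O -> R}) (psi : R -> algC),
     (* R = o_l = O / p^l *)
     (forall y : R, exists x : O, f x = y) ->
     (forall x : O, f x = 0 <-> exists y : O, x = pi ^+ l * y) ->
     is_add_char psi -> (exists x : R, psi (f pi ^+ l.-1 * x) != 1) ->
     tensor_claims ('GL_2[R]%G)
       (regular_rep ('GL_2[R]%G) predT psi (f pi) l) #|F| l)
  /\
  (* Case G = GU_2 *)
  (forall (th : O) (R : finComUnitRingType) (f : {rmorphism O -> R})
          (S : finComUnitRingType) (iota : {rmorphism R -> S}) (vt : S)
          (cj : {rmorphism S -> S}) (psi' : R -> algC) (psi : S -> algC),
     (* theta^2 = th is a non-square unit of O *)
     th \is a GRing.unit -> ~ (exists x : O, x * x = th) ->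
     (* R = o_l = O / p^l *)
     (forall y : R, exists x : O, f x = y) ->
     (forall x : O, f x = 0 <-> exists y : O, x = pi ^+ l * y) ->
     (* S = O_l = o_l[vt], vt^2 = th, with o_l-basis 1, vt *)
     vt ^+ 2 = iota (f th) ->
     (forall s : S, exists a b : R, s = iota a + iota b * vt) ->
     (forall a b : R, iota a + iota b * vt = 0 -> a = 0 /\ b = 0) ->
     (* Galois involution *)
     (forall a : R, cj (iota a) = iota a) -> cj vt = - vt ->
     (* psi (x + vt y) = psi' x psi' y *)
     is_add_char psi' -> (exists x : R, psi' (f pi ^+ l.-1 * x) != 1) ->
     (forall x y : R, psi (iota x + iota y * vt) = psi' x * psi' y) ->
     tensor_claims (GU_group cj)
       (regular_rep (GU_group cj) (lieU cj) psi (iota (f pi)) l) #|F| l).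
Proof.
move=> cdvr redS redK oddF l0; split=> [R f psi fS fK psiA psiP|].
  by have := GL2_claims (quot_chain_ring cdvr redS redK oddF l0 fS fK) psiA psiP.
move=> th R f S iota vt cj psi' psi uth nsq fS fK vt2 vtS vtF cjR cjvt psiA psiP psiE.
by have := GU_claims (quot_chain_ring cdvr redS redK oddF l0 fS fK)
  (quot_nonsquare cdvr redK oddF fS fK uth nsq) vt2 vtS vtF cjR cjvt psiA psiP psiE.
Qed.
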